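(* Let $G=\langle a,b\rangle$ be the free group of rank $2$, identified with the fundamental group of the pants surface $X$ (the disc with two holes), and let $W_2$ be the set of Wecken endomorphisms of $G$. If the limit defining the asymptotic density $D(W_2)$ exists, then $$D(W_2)\ \ge\ \frac{23}{108}.$$
   Context: For a selfmap $f:X\to X$ of a compact surface with boundary, $N(f)$ denotes the Nielsen number (the number of fixed point classes of $f$ with nonzero fixed point index), and $\mathrm{MF}(f)=\min\{\#\mathrm{Fix}(g) : g\simeq f\}$ is the minimal number of fixed points in the homotopy class of $f$. The map $f$ is Wecken if $N(f)=\mathrm{MF}(f)$. The homotopy class of $f$ is determined by the endomorphism $\phi$ it induces on the free group $\pi_1(X)$; an endomorphism $\phi$ is called Wecken if it is induced by a Wecken map of $X$. Density: for a free group $G$ on $n$ generators and a natural number $p$, let $G_p$ be the set of elements of reduced word length at most $p$. An endomorphism $\phi$ of $G=\langle a_1,\dots,a_n\rangle$ is identified with the $n$-tuple $(\phi(a_1),\dots,\phi(a_n))\in G^n$. For a set $S\subset G^n$ of endomorphisms, $D(S)=\lim_{p\to\infty}\frac{|S\cap G_p^n|}{|G_p^n|}$, where $G_p^n=(G_p)^n$. Here $n=2$. *)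

(* Defs.v *)
From mathcomp Require Export all_boot all_order all_algebra.
From mathcomp Require Export all_classical all_reals all_analysis.

Set Implicit Arguments.
Unset Strict Implicit.
Unset Printing Implicit Defensive.

Import Order.TTheory GRing.Theory Num.Theory.
Export numFieldNormedType.Exports.

Local Open Scope classical_set_scope.
Local Open Scope card_scope.
Local Open Scope ring_scope.

(* Selfmaps, paths and homotopies are total functions of the ambient Euclidean
   space or of R; only their values on X, on [0, 1] and on the products of these
   sets are ever constrained or used. *)

Section Homotopy.
Variables (R : realType) (n : nat).
Local Notation E := 'rV[R]_n.+1.
Local Notation unit_interval := (`[0, 1]%classic : set R).
Implicit Types (X : set E) (f g : E -> E) (c d : R -> E) (x y : E).

Definition selfmap X f := {within X, continuous f} /\ f @` X `<=` X.

Definition homotopic X f g :=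
  exists H : R -> E -> E,
    [/\ {within unit_interval `*` X, continuous (fun z : R * E => H z.1 z.2)},
        forall t x, unit_interval t -> X x -> X (H t x),
        forall x, X x -> H 0 x = f x &
        forall x, X x -> H 1 x = g x].

Definition is_path X x y c :=
  [/\ {within unit_interval, continuous c}, c @` unit_interval `<=` X,
      c 0 = x & c 1 = y].

(* homotopy relative to the endpoints *)
Definition path_homotopic X c d :=
  exists H : R -> R -> E,
    [/\ {within unit_interval `*` unit_interval,
           continuous (fun z : R * R => H z.1 z.2)},
        forall s t, unit_interval s -> unit_interval t -> X (H s t),
        forall t, unit_interval t -> H 0 t = c t,
        forall t, unit_interval t -> H 1 t = d t &
        forall s, unit_interval s -> H s 0 = c 0 /\ H s 1 = c 1].

Definition path_rev c : R -> E := fun t => c (1 - t).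

Definition path_cat c d : R -> E :=
  fun t => if t <= 2^-1 then c (2 * t) else d (2 * t - 1).

End Homotopy.

Section FixedPointIndex.
Variables (R : realType) (n : nat).
Local Notation E := 'rV[R]_n.+1.
Implicit Types (X U V C : set E) (f g h r : E -> E).

(* k is the Brouwer degree deg(g, U, 0): g is continuous on the closure of the
   bounded open set U and has no zero on its boundary, and k is the number of
   zeros, counted with the sign of the Jacobian determinant, of a C^1 map h
   having 0 as a regular value on U and closer to g on the closure of U than
   the distance from 0 to the image of the boundary under g. *)
Definition has_degree g U (k : int) :=
  [/\ open U, bounded_set U, {within closure U, continuous g} &
  exists (h : E -> E) (e : R) (s : seq E),
    [/\ 0 < e,
        forall x, closure U x -> ~ U x -> e <= `|g x|,
        forall x, closure U x -> `|g x - h x| < e,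
        (forall x, differentiable h x) /\ continuous (jacobian h) &
        [/\ uniq s,
            forall x, x \in s <-> U x /\ h x = 0,
            forall x, x \in s -> \det (jacobian h x) != 0 &
            k = \sum_(x <- s) sgz (\det (jacobian h x))]]].

Definition Fix X f : set E := [set x | X x /\ f x = x].

(* The fixed point index of f on a set C of fixed points of f isolated from the
   other fixed points: the degree of id - f \o r on an open set isolating C,
   where r is a retraction of a neighbourhood V of X onto X. The result depends
   neither on U nor on (V, r); for the surfaces considered here V and r
   exist. *)
Definition has_index X f C (k : int) :=
  exists (V : set E) (r : E -> E) (U : set E),
    [/\ open V /\ X `<=` V,
        [/\ {within V, continuous r}, r @` V `<=` X &
            forall x, X x -> r x = x],
        closure U `<=` V,
        C `<=` U /\ closure U `&` Fix X f = C &
        has_degree (fun x => x - f (r x)) U k].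

Definition nielsen_equiv X f x y :=
  exists c : R -> E, is_path X x y c /\ path_homotopic X c (f \o c).

Definition fixed_point_class X f C :=
  exists2 x, Fix X f x & C = [set y | Fix X f y /\ nielsen_equiv X f x y].

Definition essential X f C := exists2 k : int, has_index X f C k & k != 0.

(* The relation N(f) = k. *)
Definition nielsen_number X f (k : nat) :=
  [set C | fixed_point_class X f C /\ essential X f C] #= `I_k.

(* The relation MF(f) = m; maps with infinitely many fixed points are irrelevant to the
   minimum. *)
Definition min_fix X f (m : nat) :=
  (exists g, [/\ selfmap X g, homotopic X f g & Fix X g #= `I_m]) /\
  (forall g k, selfmap X g -> homotopic X f g -> Fix X g #= `I_k -> (m <= k)%N).

Definition wecken X f :=
  exists k : nat, nielsen_number X f k /\ min_fix X f k.

End FixedPointIndex.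

(* The letter (false, s) is a^{+-1} and (true, s) is b^{+-1}, with s = true for
   the inverse. Elements of the free group on a, b are the reduced words. *)
Definition letter : finType := (bool * bool)%type.

Definition inv_letter (l : letter) : letter := (l.1, ~~ l.2).

Definition word := seq letter.

Definition reduced (w : word) : bool :=
  sorted (fun l m => m != inv_letter l) w.

Section Pants.
Variable R : realType.
Local Notation E := 'rV[R]_2.

(* squared distance from (c, 0) to x *)
Definition sqdist (c : R) (x : E) : R := (x 0 0 - c) ^+ 2 + x 0 1 ^+ 2.

Definition pants : set E :=
  [set x | [/\ sqdist 0 x <= 5 ^+ 2, 1 <= sqdist 2 x & 1 <= sqdist (- 2) x]].

Definition base : E := 0.

(* The generators a (false) and b (true) of the fundamental group at the origin:
   the circles of radius 2 centred at (2, 0) and (-2, 0), each starting at the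
   origin and going once counterclockwise around one hole. *)
Definition generator (i : bool) (t : R) : E :=
  let c : R := if i then - 2 else 2 in
  \row_(j < 2) (if j == 0 then c * (1 - cos (2 * pi * t))
                else - c * sin (2 * pi * t)).

Definition letter_loop (l : letter) : R -> E :=
  if l.2 then path_rev (generator l.1) else generator l.1.

Definition word_loop (w : word) : R -> E :=
  foldr (fun l c => path_cat (letter_loop l) c) (cst base) w.

(* f induces the endomorphism a |-> phi.1, b |-> phi.2, for the change of base
   point along some path o from base to f base. *)
Definition induces (f : E -> E) (phi : word * word) :=
  exists o : R -> E, is_path pants base (f base) o /\
    forall i : bool,
      path_homotopic pants
        (path_cat o (path_cat (f \o generator i) (path_rev o)))
        (word_loop (if i then phi.2 else phi.1)).

(* An endomorphism is identified with the pair of its values on a and b. *)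
Definition wecken_endo : set (word * word) :=
  [set phi | [/\ reduced phi.1, reduced phi.2 &
     exists f : E -> E, [/\ selfmap pants f, induces f phi & wecken pants f]]].

(* {bseq p of letter} is the finite type of words of length at most p. *)
Definition density_ratio (S : set (word * word)) (p : nat) : R :=
  #|[pred w : {bseq p of letter} * {bseq p of letter} |
      [&& reduced w.1, reduced w.2 &
          `[< S (w.1 : word, w.2 : word) >]]]|%:R /
  #|[pred w : {bseq p of letter} * {bseq p of letter} |
      reduced w.1 && reduced w.2]|%:R.

End Pants.

(* Main.v *)
From HB Require Import structures.
Require Import Defs.
From mathcomp Require Import zify ring lra.

Import Order.TTheory GRing.Theory Num.Theory.

Set Implicit Arguments.
Unset Strict Implicit.
Unset Printing Implicit Defensive.

(** Wecken endomorphisms are produced explicitly. Given reduced words w a and w b,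
    let f be the selfmap of the pants that sends everything to the base point
    except for two short strips across the pants, one beyond each hole;
    the strip at the hole i is swept by f along a polygonal loop spelling w i.
    Every loop a or b crosses its own strip once, so f induces the endomorphism
    phi with values w a, w b ([loop_map_induces]). Apart from the base point, the
    fixed points of f are the passages of the loop w i through its own strip,
    that is, the occurrences of i and its inverse in w i, and near each of them
    id - f is an affine map with nonzero determinant. If these fixed points are
    pairwise Nielsen inequivalent, and remain so under deformation, then f has
    as few fixed points as its homotopy class allows ([wecken_of_affine]).

    Inequivalence is detected in the free group. A cocycle [trans] counts the
    crossings of a cut in each arm, and along it f lifts to [lift_word], a map to
    the free group whose value at a fixed point is the prefix of w i read by the
    loop before that point (a Wagner tail). Equivalent fixed points x, y satisfy
    lift x * z = phi z * lift y for some z ([nielsen_twisted]). If the words are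
    long and the images of different letters separate early, then phi stretches
    z so much that this equation forces z to be trivial up to the obvious
    symmetry, and then the tails to be equal ([occurs_separated],
    [base_separated], under the condition [separated]).

    That a fixed point cannot be removed by a homotopy is proved by hand, in
    place of a fixed point index of arbitrary maps. Colour the vertices of a fine
    grid by the sector of the plane containing the displacement x - f x. The
    signed number of squares showing all three colours is a discrete degree. It
    is counted only over the squares whose vertices carry the label of a given
    fixed point class; the labels are locally constant where the displacement is
    small, hence this count is constant in time ([class_count_const]). It is 3 or
    -3 for the affine fixed points of f, so every map homotopic to f keeps a
    fixed point in each class ([fixed_class_persists]), and two classes never
    share one.

    For the density, the condition [separated] follows from short prefixes of
    the four words phi(a), phi(a)^-1, phi(b), phi(b)^-1, as soon as the words are
    long; and phi may first be conjugated by a letter, since conjugate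
    endomorphisms are induced by the same map ([accept_wecken]). Reduced words
    with prescribed ends are equidistributed up to a bounded error
    ([closing_bounds]), so a pattern of prefixes of total size s has density
    1 / (256 * 3^(s-4)). The tree of patterns of total size at most 8 contains
    accepted leaves of total density 4681 / (256 * 81) ([mass_initials]), that
    is, more than 0.225, while 23/108 is less than 0.213. *)

(** * The free group on two generators *)

Lemma inv_letterK : involutive inv_letter.
Proof. by case=> x s; rewrite /inv_letter /= negbK. Qed.

Lemma inv_letter_neq l : inv_letter l != l.
Proof. by case: l => [] [] []. Qed.

Definition winv (w : word) : word := rev (map inv_letter w).

Lemma winvK : involutive winv.
Proof. by move=> w; rewrite /winv map_rev revK mapK //; exact: inv_letterK. Qed.

Lemma winv_cat u v : winv (u ++ v) = winv v ++ winv u.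
Proof. by rewrite /winv map_cat rev_cat. Qed.

Lemma winv_cons l w : winv (l :: w) = rcons (winv w) (inv_letter l).
Proof. by rewrite /winv /= rev_cons. Qed.

Lemma winv_rcons l w : winv (rcons w l) = inv_letter l :: winv w.
Proof. by rewrite /winv map_rcons rev_rcons. Qed.

Lemma size_winv w : size (winv w) = size w.
Proof. by rewrite /winv size_rev size_map. Qed.

Lemma reduced_cons l w :
  reduced (l :: w) = (ohead w != Some (inv_letter l)) && reduced w.
Proof. by case: w. Qed.

Lemma reduced_cat_joint u l m v :
  reduced (rcons u l) -> reduced (m :: v) -> m != inv_letter l ->
  reduced (rcons u l ++ m :: v).
Proof.
rewrite /reduced; case: u => [|x u] /=; first by move=> _ -> ->.
by rewrite cat_path /= last_rcons => -> -> ->.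
Qed.

Lemma reduced_catl u v : reduced (u ++ v) -> reduced u.
Proof. by rewrite /reduced; case: u => //= x u; rewrite cat_path => /andP[]. Qed.

Lemma reduced_catr u v : reduced (u ++ v) -> reduced v.
Proof.
rewrite /reduced; case: u => //= x u; rewrite cat_path => /andP[_].
exact: path_sorted.
Qed.

Lemma reduced_winv w : reduced w -> reduced (winv w).
Proof.
rewrite /reduced /winv rev_sorted sorted_map => rw.
apply: sub_sorted rw => l m /=; apply: contraNN => /eqP e; apply/eqP.
by rewrite e inv_letterK.
Qed.

(** Left multiplication of a reduced word by a letter. A word acts on the
    reduced words by successive pushes; this action is what makes reduction
    and associativity provable by induction on letters alone. *)
Definition push (l : letter) (w : word) : word :=
  if ohead w == Some (inv_letter l) then behead w else l :: w.

Definition act (u w : word) : word := foldr push w u.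

Lemma reduced_push l w : reduced w -> reduced (push l w).
Proof.
rewrite /push; case: ifPn => [_|h rw]; last by rewrite reduced_cons h.
by case: w => // m w; rewrite reduced_cons => /andP[].
Qed.

Lemma push_invK l w : reduced w -> push l (push (inv_letter l) w) = w.
Proof.
rewrite {2}/push inv_letterK; case: ifPn => [|h rw]; last by rewrite /push /= eqxx.
case: w => // m w /eqP[->]; rewrite reduced_cons /push => /andP[/negPf /= ->].
by [].
Qed.

Lemma reduced_act u w : reduced w -> reduced (act u w).
Proof. by move=> rw; elim: u => //= l u; exact: reduced_push. Qed.

Lemma act_push l u w : reduced w -> act (push l u) w = push l (act u w).
Proof.
move=> rw; rewrite {1}/push; case: ifPn => //=.
case: u => //= m u /eqP[->].
by rewrite push_invK //; exact: reduced_act.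
Qed.

Lemma act_act u v w : reduced w -> act (act u v) w = act u (act v w).
Proof. by move=> rw; elim: u => //= l u IH; rewrite act_push // IH. Qed.

Lemma act_nil w : reduced w -> act w [::] = w.
Proof.
elim: w => // l w IH; rewrite reduced_cons => /andP[h rw] /=.
by rewrite IH // /push (negPf h).
Qed.

Lemma act_winv u w : reduced w -> act (winv u) (act u w) = w.
Proof.
move=> rw; elim: u => // l u IH.
rewrite winv_cons -cats1 /act foldr_cat /= -/(act u w) -{2}IH.
by rewrite -{2}(inv_letterK l) push_invK //; exact: reduced_act.
Qed.

Record free2 := Free2 { free2_word :> seq letter; free2P : reduced free2_word }.

HB.instance Definition _ := [isSub for free2_word].
HB.instance Definition _ := [Choice of free2 by <:].

Lemma free2_inj (u v : free2) : free2_word u = free2_word v -> u = v.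
Proof. exact: val_inj. Qed.

Definition grp (w : word) : free2 := Free2 (reduced_act w (isT : reduced [::])).

Lemma grp_act u (v : free2) : grp (u ++ v) = Free2 (reduced_act u (free2P v)).
Proof.
by apply: free2_inj; rewrite /= /act foldr_cat; congr foldr; apply: act_nil; exact: free2P.
Qed.

Definition mul2 (u v : free2) : free2 := grp (u ++ v).

Lemma val_mul2 (u v : free2) : free2_word (mul2 u v) = act u v.
Proof. by rewrite /mul2 grp_act. Qed.

Lemma mul2A : associative mul2.
Proof.
move=> u v w; apply: free2_inj; rewrite !val_mul2 act_act //; exact: free2P.
Qed.

Lemma mul12 : left_id (grp [::]) mul2.
Proof. by move=> u; apply: free2_inj; rewrite val_mul2. Qed.

Lemma mul21 : right_id (grp [::]) mul2.
Proof. by move=> u; apply: free2_inj; rewrite val_mul2 /= act_nil //; exact: free2P. Qed.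

Definition inv2 (u : free2) : free2 := grp (winv u).

Lemma mulV2 : left_inverse (grp [::]) inv2 mul2.
Proof.
move=> u; apply: free2_inj; rewrite val_mul2 /=.
rewrite (act_nil (reduced_winv (free2P u))) -{2}(act_nil (free2P u)).
exact: act_winv.
Qed.

Lemma mul2V : right_inverse (grp [::]) inv2 mul2.
Proof.
move=> u; have := mulV2 (inv2 u); suff -> : inv2 (inv2 u) = u by [].
apply: free2_inj => /=.
by rewrite (act_nil (reduced_winv (free2P u))) winvK act_nil //; exact: free2P.
Qed.

HB.instance Definition _ := isGroup.Build free2 mul2A mul12 mul21 mulV2 mul2V.

Section WordMorphisms.
Local Open Scope group_scope.

Lemma grp_cat u v : grp (u ++ v) = grp u * grp v.
Proof.
apply: free2_inj; rewrite [RHS]val_mul2 /= /act foldr_cat -/(act v [::]) -/(act u _).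
by rewrite -/(act _ _) act_act //; exact: reduced_act.
Qed.

Lemma grp_cons l w : grp (l :: w) = grp [:: l] * grp w.
Proof. by rewrite -grp_cat. Qed.

Lemma grp_free2 (u : free2) : grp u = u.
Proof. by apply: free2_inj; rewrite /= act_nil //; exact: free2P. Qed.

Lemma val_grp w : reduced w -> free2_word (grp w) = w.
Proof. exact: act_nil. Qed.

Lemma grp_winv w : grp (winv w) = (grp w)^-1.
Proof.
apply/(@mulIg _ (grp w)); rewrite mulVg -grp_cat; apply: free2_inj => /=.
by rewrite /act foldr_cat; exact: act_winv.
Qed.

Lemma grp_inv_letter l : grp [:: inv_letter l] = (grp [:: l])^-1.
Proof. by rewrite -grp_winv. Qed.

Section Endomorphism.
Variable w : bool -> word.

Definition letter_image (l : letter) : word :=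
  if l.2 then winv (w l.1) else w l.1.

Definition subst (u : word) : word := flatten (map letter_image u).

Definition endo (u : free2) : free2 := grp (subst u).

Lemma letter_image_inv l : letter_image (inv_letter l) = winv (letter_image l).
Proof. by case: l => x []; rewrite /letter_image //= winvK. Qed.

Lemma subst_cat u v : subst (u ++ v) = subst u ++ subst v.
Proof. by rewrite /subst map_cat flatten_cat. Qed.

Lemma subst_cons l u : subst (l :: u) = letter_image l ++ subst u.
Proof. by []. Qed.

Lemma grp_subst_push l u : grp (subst (push l u)) = grp (subst (l :: u)).
Proof.
rewrite /push; case: ifP => //; case: u => //= m u /eqP[->].
by rewrite !subst_cons letter_image_inv !grp_cat grp_winv mulVKg.
Qed.

Lemma grp_subst_act u v : grp (subst (act u v)) = grp (subst (u ++ v)).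
Proof.
elim: u => //= l u IH.
by rewrite grp_subst_push !subst_cons !grp_cat IH.
Qed.

Lemma endoM u v : endo (u * v) = endo u * endo v.
Proof. by rewrite /endo [free2_word (u * v)]val_mul2 grp_subst_act subst_cat grp_cat. Qed.

Lemma endo_grp u : endo (grp u) = grp (subst u).
Proof. by rewrite /endo [free2_word (grp u)]/= grp_subst_act cats0. Qed.

Lemma endo1 : endo 1 = 1. Proof. by []. Qed.

Lemma endoV u : endo u^-1 = (endo u)^-1.
Proof. by apply/(@mulIg _ (endo u)); rewrite -endoM !mulVg. Qed.

End Endomorphism.

End WordMorphisms.

Arguments grp : simpl never.
Arguments endo : simpl never.
Arguments subst : simpl never.

(** * Twisted conjugacy *)

(** The prefix of length [j] of [u] is the tail of a fixed point on the letter
    [d] when the next letter is [d], or when the last letter is the inverse of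
    [d]: a loop running backwards has already passed the cut when it meets the
    fixed point. The formula covers both cases. *)
Definition hit (d : letter) (u : word) (j : nat) : bool :=
  (onth u j == Some d) || ((0 < j) && (onth u j.-1 == Some (inv_letter d))).

Section Separation.
Local Open Scope group_scope.
Variables (w : bool -> word) (K : nat).
Local Notation W := (letter_image w).

Definition diverges (d d' : letter) (k : nat) :=
  exists c x y s t, [/\ W d = c ++ x :: s, W d' = c ++ y :: t, x != y & size c = k].

(** The images of different letters must separate before position [K], and up
    to the place of separation no common prefix may be a tail for both of
    them. Since words have size at least 2 * K + 2, cancellation between
    consecutive images leaves at least two letters of each untouched. The
    third clause keeps the base point, whose tail is empty, away from the
    other fixed points. *)
Definition separated :=
  [/\ forall x, reduced (w x),
      forall x, 2 * K + 2 <= size (w x),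
      forall d, ~~ hit d (W d) 0 &
      forall d d', d != d' -> exists k, [/\ k < K, diverges d d' k &
         forall j, j <= k -> ~~ (hit d (W d) j && hit d' (W d') j)]].

Hypothesis sep : separated.

Lemma reduced_image l : reduced (W l).
Proof.
case: sep => rw _ _ _; rewrite /letter_image; case: ifP => // _.
exact: reduced_winv.
Qed.

Lemma size_image l : 2 * K + 2 <= size (W l).
Proof.
by case: sep => _ rw _ _; rewrite /letter_image; case: ifP => // _; rewrite size_winv.
Qed.

Lemma image_diverges d d' : d != d' -> exists2 k, k < K & diverges d d' k.
Proof. by case: sep => _ _ _ h /h[k [? ? _]]; exists k. Qed.

Lemma grp_cancel a c b : grp (a ++ winv c) * grp (c ++ b) = grp (a ++ b).
Proof. by rewrite !grp_cat grp_winv -!mulgA mulKg. Qed.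

Lemma reduced_joint a l m b : reduced (rcons a (inv_letter l)) -> reduced (m :: b) ->
  l != m -> reduced (rcons a (inv_letter l) ++ m :: b).
Proof. by move=> ra rb lm; apply: reduced_cat_joint; rewrite // inv_letterK eq_sym. Qed.

(** In a product of images the end of [W l] cancels against the start of [W m]
    exactly along the common prefix of the images of the inverse of [l] and of
    [m]. *)
Lemma image_fold l m : inv_letter l != m -> exists c x y s t,
  [/\ W l = rcons s x ++ winv c, W m = c ++ y :: t, y != inv_letter x, size c < K &
      K + 2 <= size s].
Proof.
move=> /image_diverges [k kK [c [x [y [s [t [e1 e2 xy ck]]]]]]].
have eW : W l = winv (W (inv_letter l)) by rewrite letter_image_inv winvK.
exists c, (inv_letter x), y, (winv s), t; split=> //.
- by rewrite eW e1 winv_cat winv_cons.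
- by rewrite inv_letterK eq_sym.
- by rewrite ck.
have := size_image (inv_letter l); rewrite e1 size_cat size_winv /= ck.
lia.
Qed.

(** The invariant is a reduced word P ++ drop K (W l): whatever follows
    cancels fewer than [K] letters, so the part [P] is final. Multiplying by
    the image of a further letter restores the same form and makes [P] longer
    by three letters at least. *)
Lemma product_step (P : word) l m (Q : word) :
  reduced (P ++ drop K (W l)) -> inv_letter l != m -> prefix Q (W m) ->
  exists P' S : word, [/\ grp (P ++ drop K (W l)) * grp Q = grp (P' ++ S),
    reduced (P' ++ S), size P + 3 <= size P' & Q = W m -> S = drop K (W m)].
Proof.
move=> rP lm pQ; have [c [x [y [s [t [e1 e2 yx cK Ks]]]]]] := image_fold lm.
have dW : drop K (W l) = rcons (drop K s) x ++ winv c.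
  rewrite e1 cat_rcons drop_cat (_ : K < size s) ?cat_rcons //; lia.
have sd : size (drop K s) = (size s - K)%N by rewrite size_drop.
have rm := reduced_image m.
rewrite dW catA -rcons_cat in rP *.
have rPx := reduced_catl rP.
have [eQ|nQ] := leqP (size Q) (size c).
  (* Q is absorbed by the fold *)
  have eQc : exists c', c = Q ++ c'.
    move/prefixP: pQ => [q' eq']; exists (drop (size Q) c).
    have : take (size Q) (W m) = Q by rewrite eq' take_size_cat.
    rewrite e2 takel_cat //.
    by move=> {1}<-; rewrite cat_take_drop.
  case: eQc => c' ec; exists (rcons (P ++ drop K s) x), (winv c'); split.
  - have := grp_cancel (rcons (P ++ drop K s) x ++ winv c') Q [::].
    by rewrite !cats0 ec winv_cat catA.
  - by move: rP; rewrite ec winv_cat catA => /reduced_catl.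
  - by rewrite size_rcons size_cat sd; lia.
  - move=> QW; move: eQ; rewrite QW e2 size_cat /=; lia.
have eQ : exists t', Q = c ++ y :: t' /\ reduced (y :: t').
  move/prefixP: pQ => [q' eq'].
  exists (behead (drop (size c) Q)).
  have : take (size Q) (W m) = Q by rewrite eq' take_size_cat.
  rewrite e2 take_cat ltnNge (ltnW nQ) /=.
  have := nQ; rewrite -subn_gt0; case: (size Q - size c)%N => [|n] //=.
  move=> _ eQ; rewrite -eQ drop_size_cat //; split=> //.
  apply: (@reduced_catr c (y :: take n t)); rewrite eQ.
  by move: rm; rewrite eq' => /reduced_catl.
case: eQ => t' [eQ rt'].
exists (rcons (P ++ drop K s) x ++ take (K - size c) (y :: t')), (drop (K - size c) (y :: t')).
split.
- by rewrite eQ grp_cancel -catA cat_take_drop.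
- by rewrite -catA cat_take_drop; apply: reduced_cat_joint.
- by rewrite size_cat size_rcons size_cat sd; lia.
- by move=> QW; rewrite -QW eQ drop_cat ltnNge (ltnW cK).
Qed.

Lemma product_tail (P : word) l (g : word) d (q : word) :
  reduced (P ++ drop K (W l)) -> path (fun l m => m != inv_letter l) l g ->
  last l g != inv_letter d -> prefix q (W d) ->
  size P + size g + 3 <=
    size (free2_word (grp (P ++ drop K (W l)) * grp (subst w g) * grp q)).
Proof.
elim: g P l => [|m g IH] P l rP.
  move=> _ ld pq; rewrite (_ : grp (subst w [::]) = 1) // mulg1 addn0.
  have ld' : inv_letter l != d by rewrite -(inj_eq (inv_inj inv_letterK)) inv_letterK.
  have [P' [S [-> rPS sP _]]] := product_step rP ld' pq.
  by rewrite val_grp // size_cat; lia.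
move=> /andP[ml pg] lg pq.
have lm : inv_letter l != m by rewrite eq_sym.
have [P' [S [e rPS sP eS]]] := product_step rP lm (prefix_refl _).
rewrite eS // in e rPS.
rewrite subst_cons [grp (W m ++ _)]grp_cat mulgA e.
apply: leq_trans (IH P' m rPS pg lg pq).
have arith a b n : a + 3 <= b -> a + n.+1 + 3 <= b + n + 3 by lia.
exact: arith sP.
Qed.

(** The image of a nontrivial [g], multiplied by the two tails, is still
    longer than [g]. The boundary conditions on [g] say that neither tail can
    start by cancelling into the image. *)
Lemma not_twisted_conjugate d (p : word) d' (q g : word) :
  reduced g -> g != [::] -> ohead g != Some d -> last d g != inv_letter d' ->
  prefix p (W d) -> prefix q (W d') ->
  grp p * grp g != endo w (grp g) * grp q.
Proof.
case: g => // m g rg _ /= md gd pp pq; apply/eqP => e.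
have {e}eg : grp (m :: g) = grp (winv p) * grp (W m) * grp (subst w g) * grp q.
  rewrite -[LHS](mulKg (grp p)) e grp_winv endo_grp subst_cons grp_cat.
  by rewrite !mulgA.
have dm : d != m by move: md; rewrite eq_sym.
have [P [rP eP]] : exists P : word, reduced (P ++ drop K (W m)) /\ grp (winv p) * grp (W m) = grp (P ++ drop K (W m)).
  have [k kK [c [x [y [s [t [e1 e2 xy ck]]]]]]] := image_diverges dm.
  have rp : reduced p.
    by move/prefixP: pp => [p' ep]; have := reduced_image d; rewrite ep => /reduced_catl.
  have rm := reduced_image m.
  have [pc|cp] := leqP (size p) k.
    exists (take (K - size p) (drop (size p) (W m))).
    have eW : W m = p ++ drop (size p) (W m).
      move/prefixP: pp => [p' ep].
      have : take (size p) (W d) = p by rewrite ep take_size_cat.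
      rewrite e1 takel_cat ?ck // => {1}<-.
      rewrite e2 -{1}(@takel_cat _ _ c (y :: t)) ?ck //.
      by rewrite -e2 cat_take_drop.
    have ed : drop K (W m) = drop (K - size p) (drop (size p) (W m)).
      by rewrite drop_drop subnK //; lia.
    rewrite ed !cat_take_drop; split.
      by move: rm; rewrite {1}eW => /reduced_catr.
    by rewrite eW grp_cat grp_winv mulKg drop_size_cat.
  have [s' [ep]] : exists s', p = c ++ x :: s' /\ True.
    move/prefixP: pp => [p' ep]; have : take (size p) (W d) = p by rewrite ep take_size_cat.
    rewrite e1 take_cat ltnNge ck (ltnW cp) /=.
    have := cp; rewrite -subn_gt0; case: (size p - k)%N => [|n] //= _ <-.
    by exists (take n s).
  move=> _.
  exists (winv (x :: s') ++ take (K - k) (y :: t)).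
  have ed : drop K (W m) = drop (K - k) (y :: t).
    by rewrite e2 drop_cat ck ltnNge ltnW.
  rewrite ed -catA cat_take_drop; split.
    rewrite winv_cons; apply: reduced_joint => //.
    - rewrite -winv_cons; apply: reduced_winv; apply: (@reduced_catr c).
      by rewrite -ep.
    - by apply: (@reduced_catr c); rewrite -e2.
  rewrite ep e2 winv_cat.
  exact: grp_cancel.
rewrite eP in eg.
have := product_tail rP rg gd pq; rewrite -eg val_grp //.
rewrite [size (m :: g)]/= -addnA addnC => h.
have arith a n : n + 3 + a <= n.+1 -> False by lia.
exact: arith h.
Qed.

(** The tail of the fixed point at the letter [l] following the prefix [u],
    where [l] is [d] or its inverse. *)
Definition zeta (d : letter) (u : word) (l : letter) : word :=
  if l == d then u else rcons u l.

Definition occurs (d : letter) (u : word) (l : letter) (v : word) :=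
  W d = u ++ l :: v /\ l.1 = d.1.

Lemma letter_same_axis (l d : letter) : l.1 = d.1 -> l = d \/ l = inv_letter d.
Proof. by case: l d => x [] [y []] /= ->; [left|right|right|left]. Qed.

Lemma occurs_flip d u l v :
  occurs d u l v -> occurs (inv_letter d) (winv v) (inv_letter l) (winv u).
Proof.
case=> eW ax; split; last by rewrite /= ax.
by rewrite letter_image_inv eW winv_cat winv_cons cat_rcons.
Qed.

(** A fixed point on [d] is also a fixed point on the inverse of [d], seen
    from the other end of the loop; the two tails are twisted conjugate by
    [d]. *)
Lemma zeta_flip d u l v : occurs d u l v ->
  grp (zeta (inv_letter d) (winv v) (inv_letter l)) =
  (grp (W d))^-1 * grp (zeta d u l) * grp [:: d].
Proof.
case=> eW /letter_same_axis; rewrite /zeta (inj_eq (inv_inj inv_letterK)) eW.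
rewrite -grp_winv winv_cat winv_cons -cats1 !grp_cat grp_inv_letter !grp_winv => -[->|->].
  by rewrite eqxx !mulgVK grp_winv.
rewrite (negPf (inv_letter_neq d)) -!cats1 !grp_cat inv_letterK grp_inv_letter grp_winv.
by rewrite !mulgA !mulgVK invgK.
Qed.

Lemma zeta_prefix d u l v : occurs d u l v -> prefix (zeta d u l) (W d).
Proof.
case=> eW _; rewrite /zeta; case: ifP => _; apply/prefixP; first by exists (l :: v).
by exists v; rewrite cat_rcons.
Qed.

Lemma zeta_hit d u l v : occurs d u l v -> hit d (W d) (size (zeta d u l)).
Proof.
case=> eW /letter_same_axis; rewrite /zeta /hit eW => -[->|->].
  by rewrite eqxx onth_cat ltnn subnn /= eqxx.
by rewrite (negPf (inv_letter_neq d)) size_rcons /= onth_cat ltnn subnn /= eqxx orbT.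
Qed.

Lemma reduced_zeta d u l v : occurs d u l v -> reduced (zeta d u l).
Proof.
move=> /zeta_prefix/prefixP[t et].
by have := reduced_image d; rewrite et => /reduced_catl.
Qed.

(** Equal tails with different prefixes would require the inverse of [d] and
    [d] to be adjacent in a reduced word. *)
Lemma eq_zeta d u l v u' l' v' : occurs d u l v -> occurs d u' l' v' ->
  zeta d u l = zeta d u' l' -> u = u'.
Proof.
have mixed a b c : reduced (rcons a (inv_letter d) ++ d :: b) -> c -> False.
  rewrite cat_rcons => /reduced_catr; rewrite reduced_cons /= inv_letterK.
  by rewrite eqxx.
move=> [e1 /letter_same_axis a1] [e2 /letter_same_axis a2].
have rd := reduced_image d; rewrite /zeta.
case: a1 e1 => -> e1; case: a2 e2 => -> e2; rewrite ?eqxx ?(negPf (inv_letter_neq d)) //.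
- by move=> eu; case: (mixed u' v true) => //; rewrite -eu -e1.
- by move=> eu; case: (mixed u v' true) => //; rewrite eu -e2.
- by move/rcons_inj => [].
Qed.

(** By [not_twisted_conjugate] the conjugating element is trivial, so the two
    tails are equal. They cannot be tails for different letters, because up to
    the place of separation no prefix is hit by both. *)
Lemma normal_zeta_separated d u l v d' u' l' v' (z : free2) :
  occurs d u l v -> occurs d' u' l' v' ->
  ohead z != Some d -> last (inv_letter (inv_letter d)) z != inv_letter d' \/ z = 1 ->
  grp (zeta d u l) * z = endo w z * grp (zeta d' u' l') -> d = d' /\ u = u'.
Proof.
move=> o o' hz lz ez.
have [z1|zn1] := eqVneq z 1; last first.
  case: lz => [lz|/eqP]; last by rewrite (negPf zn1).
  have zn : free2_word z != [::].
    by apply: contraNneq zn1 => e; apply/eqP/free2_inj.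
  rewrite inv_letterK in lz.
  have := not_twisted_conjugate (free2P z) zn hz lz (zeta_prefix o) (zeta_prefix o').
  by rewrite grp_free2 ez eqxx.
move: ez; rewrite {}z1 mulg1 endo1 mul1g => ez.
have {}ez : zeta d u l = zeta d' u' l'.
  by rewrite -(val_grp (reduced_zeta o)) ez val_grp //; exact: reduced_zeta o'.
have [ed|nd] := eqVneq d d'.
  by subst d'; split=> //; exact: eq_zeta o o' ez.
case: sep => _ _ _ /(_ _ _ nd)[k [kK [c [x [y [s [t [e1 e2 xy ck]]]]]] hk]].
have sk : size (zeta d u l) <= k.
  rewrite leqNgt; apply/negP => lk.
  have /prefixP[r er] := zeta_prefix o.
  have /prefixP[r' er'] := zeta_prefix o'.
  have : onth (W d) k = onth (W d') k by rewrite er er' -ez !onth_cat lk.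
  rewrite e1 e2 !onth_cat ck ltnn subnn /= => -[exy].
  by rewrite exy eqxx in xy.
by have := hk _ sk; rewrite (zeta_hit o) ez (zeta_hit o').
Qed.

Lemma endo_letter l : endo w (grp [:: l]) = grp (W l).
Proof. by rewrite endo_grp subst_cons cats0. Qed.

Lemma twisted_stepl d u l v z q : occurs d u l v ->
  grp (zeta d u l) * z = endo w z * q ->
  grp (zeta (inv_letter d) (winv v) (inv_letter l)) * (grp [:: inv_letter d] * z) =
  endo w (grp [:: inv_letter d] * z) * q.
Proof.
move=> o e; rewrite (zeta_flip o) endoM endo_letter letter_image_inv grp_winv.
by rewrite grp_inv_letter -!mulgA mulVKg e.
Qed.

Lemma twisted_stepr d u l v z p : occurs d u l v ->
  p * z = endo w z * grp (zeta d u l) ->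
  p * (z * grp [:: d]) =
  endo w (z * grp [:: d]) * grp (zeta (inv_letter d) (winv v) (inv_letter l)).
Proof.
move=> o e; rewrite (zeta_flip o) endoM endo_letter mulgA e.
by rewrite -!mulgA mulVKg.
Qed.

(** If the conjugating element starts with [d], looking at the same fixed
    point from the other end of the loop removes this letter. *)
Lemma normalize_left d u l v z q : occurs d u l v ->
  grp (zeta d u l) * z = endo w z * q ->
  exists d1 u1 l1 v1 z1, [/\ occurs d1 u1 l1 v1,
    grp (zeta d1 u1 l1) * z1 = endo w z1 * q, ohead z1 != Some d1 &
    d1 = d /\ u1 = u \/ d1 = inv_letter d /\ u1 = winv v].
Proof.
move=> o e; have [hz|nhz] := eqVneq (ohead z) (Some d); last first.
  by exists d, u, l, v, z; split=> //; left.
have [s es] : exists s : word, free2_word z = d :: s.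
  by case: (free2_word z) hz => // m s [->]; exists s.
have rz := free2P z; rewrite es in rz.
exists (inv_letter d), (winv v), (inv_letter l), (winv u), (grp s).
split; last by right.
- exact: occurs_flip.
- have := twisted_stepl o e; rewrite -(grp_free2 z) es (grp_cons d s) grp_inv_letter.
  by rewrite mulKg.
- by move: rz; rewrite reduced_cons => /andP[ds rs]; rewrite val_grp.
Qed.

(** The mirror image of [normalize_left], at the end of the conjugating
    element. The first condition on the conjugating element, for the letter
    [m], is preserved. *)
Lemma normalize_right d u l v z p m : occurs d u l v ->
  p * z = endo w z * grp (zeta d u l) -> ohead z != Some m ->
  exists d1 u1 l1 v1 z1, [/\ occurs d1 u1 l1 v1,
    p * z1 = endo w z1 * grp (zeta d1 u1 l1), ohead z1 != Some m,
    last (inv_letter (inv_letter m)) z1 != inv_letter d1 \/ z1 = 1 &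
    d1 = d /\ u1 = u \/ d1 = inv_letter d /\ u1 = winv v].
Proof.
move=> o e hz; have [z1|zn1] := eqVneq z 1.
  by exists d, u, l, v, z; split=> //; [right|left].
have [lz|nlz] := eqVneq (last (inv_letter (inv_letter m)) z) (inv_letter d); last first.
  by exists d, u, l, v, z; split=> //; left.
have [s es] : exists s : word, free2_word z = rcons s (inv_letter d).
  case/lastP: (free2_word z) lz (@free2_inj z 1) => [_ /(_ erefl) z1|s a].
    by rewrite z1 eqxx in zn1.
  by rewrite last_rcons => -> _; exists s.
have rz := free2P z; rewrite es in rz.
have rs : reduced s by move: rz; rewrite -cats1 => /reduced_catl.
exists (inv_letter d), (winv v), (inv_letter l), (winv u), (grp s).
split; last by right.
- exact: occurs_flip.
- have := twisted_stepr o e; rewrite -(grp_free2 z) es -cats1 grp_cat grp_inv_letter.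
  by rewrite mulgVK.
- by rewrite val_grp //; move: hz; rewrite es; case: (s).
- rewrite val_grp //; case/lastP: s es rz rs => [|s a] _ rz _; first by right.
  left; rewrite last_rcons; move: rz; rewrite -!cats1 -catA => /reduced_catr /=.
  by rewrite andbT; apply: contraNneq => ->; rewrite !inv_letterK.
Qed.

(** Once both tails are normalised the conjugating element is trivial and
    [normal_zeta_separated] applies. An unwanted answer would identify a
    positive letter with a negative one. *)
Lemma occurs_separated d u l v d' u' l' v' z :
  ~~ d.2 -> ~~ d'.2 -> occurs d u l v -> occurs d' u' l' v' ->
  grp (zeta d u l) * z = endo w z * grp (zeta d' u' l') -> d = d' /\ u = u'.
Proof.
move=> pd pd' o o' e.
have [d1 [u1 [l1 [v1 [z1 [Ho1 e1 h1 c1]]]]]] := normalize_left o e.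
have [d2 [u2 [l2 [v2 [z2 [Ho2 e2 h2 t2 c2]]]]]] := normalize_right o' e1 h1.
have [] := normal_zeta_separated Ho1 Ho2 h2 t2 e2.
case: c1 => [[-> ->]|[-> ->]]; case: c2 => [[-> ->]|[-> ->]] ed eu.
- by [].
- by move: pd; rewrite ed /= pd'.
- by move: pd'; rewrite -ed /= pd.
have {}ed := inv_inj inv_letterK ed.
have {}eu := inv_inj winvK eu.
subst d' v'; split=> //; case: o => eW _; case: o' => eW' _.
have := eW; rewrite eW' => /eqP; rewrite eqseq_cat; first by case/andP => /eqP.
have := congr1 size eW; rewrite eW' !size_cat /= => /eqP.
by rewrite eqn_add2r => /eqP.
Qed.

(** The base point has the empty tail; the same argument applies, and the
    clause on position 0 in [separated] excludes a trivial conjugating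
    element. *)
Lemma base_separated d u l v z : occurs d u l v ->
  z = endo w z * grp (zeta d u l) -> False.
Proof.
move=> o e.
have hit0 d' : ~~ hit d' (W d') 0 by case: sep.
(* the empty tail is a prefix of every image, so any letter may play the part of d *)
pose m : letter := if ohead z == Some (false, false) then (true, false) else (false, false).
have hz : ohead z != Some m.
  by rewrite /m; case: ifPn => [/eqP ->|//].
have {}e : 1 * z = endo w z * grp (zeta d u l) by rewrite mul1g.
have [d1 [u1 [l1 [v1 [z1 [Ho1 e1 h1 t1 _]]]]]] := normalize_right o e hz.
have [z11|zn1] := eqVneq z1 1.
  move: e1; rewrite z11 !mul1g => /(congr1 free2_word).
  rewrite (val_grp (reduced_zeta Ho1)) => e1.
  by have := zeta_hit Ho1; rewrite -e1 (negPf (hit0 _)).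
case: t1 => [lz|/eqP]; last by rewrite (negPf zn1).
have zn : free2_word z1 != [::].
  by apply: contraNneq zn1 => e'; apply/eqP/free2_inj.
rewrite inv_letterK in lz.
have := not_twisted_conjugate (free2P z1) zn h1 lz (prefix0s _) (zeta_prefix Ho1).
by rewrite grp_free2 e1 eqxx.
Qed.

End Separation.

Local Open Scope classical_set_scope.
Local Open Scope ring_scope.

(** * Counting tricoloured squares *)

Inductive color := C0 | C1 | C2.

(** The oriented boundary of a triangle with vertices 0, 1, 2: each step along
    it counts 1, so that a full turn counts 3. *)
Definition turn (a b : color) : int :=
  match a, b with
  | C0, C1 | C1, C2 | C2, C0 => 1
  | C1, C0 | C2, C1 | C0, C2 => -1
  | _, _ => 0
  end.

Lemma turnN a b : turn b a = - turn a b.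
Proof. by case: a; case: b. Qed.

Definition quad (a b c d : color) : int := turn a b + turn b c + turn c d + turn d a.

(** Away from the colour [x] a path of colours cannot wind, and [turn] has a
    primitive. *)
Definition potential (x c : color) : int :=
  match x, c with
  | C0, C2 | C1, C0 | C2, C1 => 1
  | _, _ => 0
  end.

Lemma turn_potential x a b :
  a <> x -> b <> x -> turn a b = potential x b - potential x a.
Proof. by case: x; case: a; case: b. Qed.

(** A loop of four colours that avoids one of the three cannot turn. *)
Lemma quad_tricolor a b c d : quad a b c d != 0 ->
  forall x, [\/ a = x, b = x, c = x | d = x].
Proof.
have eqc (y z : color) : y = z \/ y <> z by case: y; case: z; first [by left | by right].
move=> q x; case: (eqc a x) => [?|na]; first by constructor 1.
case: (eqc b x) => [?|nb]; first by constructor 2.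
case: (eqc c x) => [?|nc]; first by constructor 3.
case: (eqc d x) => [?|nd]; first by constructor 4.
case/eqP: q.
rewrite /quad (turn_potential na nb) (turn_potential nb nc) (turn_potential nc nd).
rewrite (turn_potential nd na); ring.
Qed.

Lemma turn_path (c : nat -> color) x a b : (a <= b)%N ->
  (forall i, (a <= i <= b)%N -> c i <> x) ->
  \sum_(a <= i < b) turn (c i) (c i.+1) = potential x (c b) - potential x (c a).
Proof.
move=> ab nx; rewrite -(telescope_sumr (fun i => potential x (c i)) ab).
apply: eq_big_nat => i /andP[ai ib]; apply: turn_potential; apply: nx; lia.
Qed.

Section Grid.
Variable col : nat -> nat -> color.

Definition square i j : int :=
  quad (col i j) (col i.+1 j) (col i.+1 j.+1) (col i j.+1).

(** Discrete Stokes formula: inner edges are run twice in opposite directions. *)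
Lemma sum_squares i0 i1 j0 j1 : (i0 <= i1)%N -> (j0 <= j1)%N ->
  \sum_(i0 <= i < i1) \sum_(j0 <= j < j1) square i j =
  \sum_(i0 <= i < i1) turn (col i j0) (col i.+1 j0) +
  \sum_(j0 <= j < j1) turn (col i1 j) (col i1 j.+1) -
  \sum_(i0 <= i < i1) turn (col i j1) (col i.+1 j1) -
  \sum_(j0 <= j < j1) turn (col i0 j) (col i0 j.+1).
Proof.
move=> i01 j01.
pose h i j := turn (col i j) (col i.+1 j).
pose v i j := turn (col i j) (col i j.+1).
have squareE i j : square i j = (v i.+1 j - v i j) - (h i j.+1 - h i j).
  rewrite /square /quad /h /v (turnN (col i j.+1)) (turnN (col i j) (col i j.+1)); ring.
transitivity (\sum_(i0 <= i < i1) (\sum_(j0 <= j < j1) (v i.+1 j - v i j) -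
    (h i j1 - h i j0))).
  apply: eq_bigr => i _; rewrite -(telescope_sumr (h i) j01) -sumrB.
  by apply: eq_bigr => j _; rewrite squareE.
rewrite sumrB exchange_big /= sumrB.
rewrite (eq_bigr (fun j => v i1 j - v i0 j)); last first.
  by move=> j _; rewrite (telescope_sumr (v ^~ j) i01).
rewrite sumrB /h /v; ring.
Qed.

(** The colours met along the boundary of the rectangle make one full turn. *)
Lemma sum_squares_box (s : bool) i0 i1 j0 j1 : (i0 <= i1)%N -> (j0 <= j1)%N ->
  (forall i, (i0 <= i <= i1)%N ->
     if s then col i j0 = C0 /\ col i j1 <> C0 else col i j0 <> C0 /\ col i j1 = C0) ->
  (forall j, (j0 <= j <= j1)%N -> col i0 j <> C1 /\ col i1 j <> C2) ->
  \sum_(i0 <= i < i1) \sum_(j0 <= j < j1) square i j = if s then 3 else - 3.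
Proof.
move=> i01 j01 hi hj; rewrite sum_squares //.
have i0i : (i0 <= i0 <= i1)%N by rewrite leqnn.
have i1i : (i0 <= i1 <= i1)%N by rewrite leqnn andbT.
have j0j : (j0 <= j0 <= j1)%N by rewrite leqnn.
have j1j : (j0 <= j1 <= j1)%N by rewrite leqnn andbT.
rewrite (turn_path (c := col i1) (x := C2) j01); last by move=> j /hj[].
rewrite (turn_path (c := col i0) (x := C1) j01); last by move=> j /hj[].
have [[a0 a1] [b0 b1]] := (hj _ j0j, hj _ j1j).
have := hi _ i0i; have := hi _ i1i; case: s hi => hi [e1 e2] [e3 e4].
- rewrite (turn_path (c := col ^~ j0) (x := C1) i01); last by move=> i /hi[-> _].
  rewrite (turn_path (c := col ^~ j1) (x := C0) i01); last by move=> i /hi[].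
  by rewrite e1 e3; case: (col i0 j1) e4 b0 => //; case: (col i1 j1) e2 b1.
- rewrite (turn_path (c := col ^~ j0) (x := C0) i01); last by move=> i /hi[].
  rewrite (turn_path (c := col ^~ j1) (x := C1) i01); last by move=> i /hi[_ ->].
  by rewrite e2 e4; case: (col i0 j0) e3 a0 => //; case: (col i1 j0) e1 a1.
Qed.

End Grid.

Section Continuation.
Variables (col : nat -> nat -> nat -> color) (chi : nat -> nat -> nat -> bool) (N n : nat).

Definition flux_h k i j :=
  quad (col k i j) (col k i.+1 j) (col k.+1 i.+1 j) (col k.+1 i j).

Definition flux_v k i j :=
  quad (col k i j) (col k i j.+1) (col k.+1 i j.+1) (col k.+1 i j).

Hypothesis chi_square : forall k i j, (k < n)%N ->
  square (col k) i j != 0 \/ square (col k.+1) i j != 0 -> chi k i j = chi k.+1 i j.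
Hypothesis chi_flux_h : forall k i j, (k < n)%N ->
  flux_h k i j.+1 != 0 -> chi k i j = chi k i j.+1.
Hypothesis chi_flux_v : forall k i j, (k < n)%N ->
  flux_v k i.+1 j != 0 -> chi k i j = chi k i.+1 j.
Hypothesis chi_border : forall k i,
  [/\ chi k i 0 = false, chi k i N = false, chi k 0 i = false & chi k N i = false].

Definition class_count k : int :=
  \sum_(0 <= i < N) \sum_(0 <= j < N) square (col k) i j *+ chi k i j.

Lemma square_step k i j : square (col k) i j - square (col k.+1) i j =
  flux_h k i j + flux_v k i.+1 j - flux_h k i j.+1 - flux_v k i j.
Proof.
rewrite /square /flux_h /flux_v /quad.
set a := col k i j; set b := col k i.+1 j; set c := col k i.+1 j.+1.
set d := col k i j.+1; set a' := col k.+1 i j; set b' := col k.+1 i.+1 j.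
set c' := col k.+1 i.+1 j.+1; set d' := col k.+1 i j.+1.
rewrite (turnN a' b') (turnN b' c') (turnN b b') (turnN d d') (turnN c d) (turnN d a).
ring.
Qed.

Lemma telescope_chi (phi : nat -> int) (x : nat -> bool) :
  (forall j, phi j.+1 != 0 -> x j = x j.+1) -> x 0%N = false -> x N = false ->
  \sum_(0 <= j < N) (phi j *+ x j - phi j.+1 *+ x j) = 0.
Proof.
move=> h x0 xN; pose psi j := phi j *+ x j.
have e : - (psi N - psi 0%N) = 0 by rewrite /psi x0 xN !mulr0n subr0 oppr0.
rewrite -(telescope_sumr psi (leq0n N)) -sumrN in e; rewrite -[RHS]e.
apply: eq_bigr => j _; rewrite opprB /psi.
by have [->|/h <-//] := eqVneq (phi j.+1) 0; rewrite !mul0rn.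
Qed.

Lemma class_count_step k : (k < n)%N -> class_count k = class_count k.+1.
Proof.
move=> kn; apply/eqP; rewrite -subr_eq0 /class_count -sumrB; apply/eqP.
transitivity (\sum_(0 <= i < N) \sum_(0 <= j < N)
  (((flux_h k i j *+ chi k i j - flux_h k i j.+1 *+ chi k i j)) +
   (flux_v k i.+1 j *+ chi k i j - flux_v k i j *+ chi k i j))).
  apply: eq_bigr => i _; rewrite -sumrB; apply: eq_bigr => j _.
  transitivity ((square (col k) i j - square (col k.+1) i j) *+ chi k i j).
    rewrite mulrnBl; congr (_ - _).
    have [->|nz] := eqVneq (square (col k.+1) i j) 0; first by rewrite !mul0rn.
    by rewrite (chi_square kn (or_intror nz)).
  by rewrite square_step; case: (chi k i j); rewrite ?mulr0n ?mulr1n; ring.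
transitivity (\sum_(0 <= i < N)
    \sum_(0 <= j < N) (flux_h k i j *+ chi k i j - flux_h k i j.+1 *+ chi k i j) +
  \sum_(0 <= j < N) - \sum_(0 <= i < N)
    (flux_v k i j *+ chi k i j - flux_v k i.+1 j *+ chi k i j)).
  under eq_bigr => i _ do rewrite big_split /=.
  rewrite big_split /=; congr (_ + _); rewrite exchange_big /=; apply: eq_bigr => j _.
  by rewrite -sumrN; apply: eq_bigr => i _; rewrite opprB.
rewrite big1 => [|i _]; last first.
  apply: (@telescope_chi (flux_h k i) (chi k i)); try by case: (chi_border k i).
  by move=> j; exact: chi_flux_h.
rewrite add0r big1 // => j _; apply/eqP; rewrite oppr_eq0; apply/eqP.
apply: (@telescope_chi (flux_v k ^~ j) (chi k ^~ j)); try by case: (chi_border k j).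
by move=> i; exact: chi_flux_v.
Qed.

(** The family of colourings is a colouring of a three-dimensional grid. The
    change of a square between two times is the sum of the fluxes through its
    four vertical faces ([square_step]). A flux that is not zero forces the
    labels on both sides of the face to agree, so the labelled fluxes
    telescope, and vanish at the border. *)
Lemma class_count_const : class_count 0 = class_count n.
Proof.
have h k : (k <= n)%N -> class_count 0 = class_count k.
  by elim: k => // k IH kn; rewrite IH ?(ltnW kn) // class_count_step.
exact: h.
Qed.

Lemma class_count_box k i0 i1 j0 j1 : (i0 <= i1 <= N)%N -> (j0 <= j1 <= N)%N ->
  (forall i j, square (col k) i j != 0 ->
     chi k i j = (i0 <= i < i1)%N && (j0 <= j < j1)%N) ->
  class_count k = \sum_(i0 <= i < i1) \sum_(j0 <= j < j1) square (col k) i j.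
Proof.
move=> /andP[i01 i1N] /andP[j01 j1N] h.
have restrict a b (G : nat -> int) : (a <= b <= N)%N ->
    \sum_(a <= i < b) G i = \sum_(0 <= i < N) (G i *+ (a <= i < b)%N).
  move=> /andP[ab bN]; rewrite (big_nat_widen _ _ _ _ _ bN) (big_nat_widenl _ _ _ _ _ (leq0n a)).
  rewrite big_mkcond /=; apply: eq_bigr => i _.
  by rewrite mulrb andbC.
rewrite restrict ?i01 // /class_count; apply: eq_bigr => i _.
rewrite restrict ?j01 // -sumrMnl; apply: eq_bigr => j _.
have [->|nz] := eqVneq (square (col k) i j) 0; first by rewrite !mul0rn.
by rewrite (h _ _ nz) -mulrnA mulnb andbC.
Qed.

End Continuation.

(** * Uniform continuity on compact sets *)

Section Plane.
Variable R : realType.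
Local Notation E := 'rV[R]_2.

Definition vec2 (a b : R) : E := \row_j (if j == 0 then a else b).

Lemma vec2_0 a b : vec2 a b 0 0 = a. Proof. by rewrite mxE. Qed.
Lemma vec2_1 a b : vec2 a b 0 1 = b. Proof. by rewrite mxE. Qed.

Lemma row2P (x y : E) : x 0 0 = y 0 0 -> x 0 1 = y 0 1 -> x = y.
Proof.
move=> e0 e1; apply/rowP => i; case: (unliftP 0 i) => [j ->|-> //].
by rewrite (_ : lift 0 j = 1) //; apply/val_inj; case: j => [[]].
Qed.

Lemma norm2_lt (x : E) e : (`|x| < e) <-> (`|x 0 0| < e /\ `|x 0 1| < e).
Proof.
rewrite (_ : `|x| = mx_norm x) // mx_normrE; split.
  by case/bigmax_ltP => e0 h; split; [exact: (h (0, 0) isT) | exact: (h (0, 1) isT)].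
case=> h0 h1; apply/bigmax_ltP; split; first exact: le_lt_trans h0.
move=> [i j] _ /=; rewrite ord1.
case: (unliftP 0 j) => [k ->|-> //].
by rewrite (_ : lift 0 k = 1) //; apply/val_inj; case: k => [[]].
Qed.

Lemma norm2_le (x : E) e : (`|x| <= e) <-> (`|x 0 0| <= e /\ `|x 0 1| <= e).
Proof.
rewrite (_ : `|x| = mx_norm x) // mx_normrE; split.
  by case/bigmax_leP => e0 h; split; [exact: (h (0, 0) isT) | exact: (h (0, 1) isT)].
case=> h0 h1; apply/bigmax_leP; split; first exact: le_trans h0.
move=> [i j] _ /=; rewrite ord1.
case: (unliftP 0 j) => [k ->|-> //].
by rewrite (_ : lift 0 k = 1) //; apply/val_inj; case: k => [[]].
Qed.

Lemma ball2E (x y : E) e : ball x e y <-> `|x - y| < e.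
Proof. by rewrite mx_norm_ball. Qed.

End Plane.

Section UniformContinuity.
Variables (R : realType) (T : pseudoMetricType R) (V : normedModType R).
Implicit Types (K : set T) (u : T -> V).

Lemma within_continuousP K u : {within K, continuous u} <->
  (forall x, K x -> forall e : R, 0 < e -> exists2 d : R, 0 < d &
    forall y, K y -> ball x d y -> `|u x - u y| < e).
Proof.
split.
  move=> /subspace_continuousP cu x Kx e e0.
  have /cvgrPdist_lt/(_ e e0) := cu x Kx.
  rewrite near_withinE => /nbhs_ballP[d /= d0 h].
  by exists d => // y Ky xy; exact: h.
move=> h; apply/subspace_continuousP => x Kx; apply/cvgrPdist_lt => e e0.
have [d d0 hd] := h x Kx e e0.
rewrite near_withinE; apply/nbhs_ballP; exists d => //= y xy Ky.
exact: hd.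
Qed.

Lemma compact_unif_continuous K u : compact K -> {within K, continuous u} ->
  forall e : R, 0 < e -> exists2 d : R, 0 < d &
    forall x y, K x -> K y -> ball x d y -> `|u x - u y| < e.
Proof.
move=> cK /within_continuousP cu e e0.
have ncK := (near_covering_withinP K).2 ((compact_near_coveringP K).1 cK).
pose P (d : R) x := forall y, K y -> ball x d y -> `|u x - u y| < e.
suff [d /= d0 hd] : \forall d \near (0 : R)^'+, K `<=` P d.
  exists (d / 2); first by rewrite divr_gt0.
  move=> x y Kx Ky xy; apply: (hd (d / 2)) => //=.
  - by rewrite sub0r normrN gtr0_norm ?divr_gt0 // ltr_pdivrMr // ltr_pMr // ltr1n.
  - by rewrite divr_gt0.
apply: ncK => x Kx.
have e2 : 0 < e / 2 by rewrite divr_gt0.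
have [d d0 hd] := cu x Kx _ e2.
have d2 : 0 < d / 2 by rewrite divr_gt0.
exists (ball x (d / 2), [set d' | d' < d / 2]) => /=.
  split; first exact: nbhsx_ballx.
  exact: nbhs_right_lt.
case=> x' d' /= [xx' dd'] Kx' y Ky xy.
have h1 : `|u x - u x'| < e / 2.
  by apply: hd => //; apply: le_ball xx'; rewrite ler_pdivrMr // ler_pMr // ler1n.
have h2 : `|u x - u y| < e / 2.
  apply: hd => //; rewrite (splitr d); apply: ball_triangle xx' _.
  by apply: le_ball xy; exact: ltW.
rewrite (splitr e) (_ : u x' - u y = (u x - u y) - (u x - u x')).
  by apply: le_lt_trans (ler_normB _ _) _; rewrite ltrD.
by rewrite opprB [RHS]addrC addrA subrK.
Qed.

End UniformContinuity.

(** By compactness. This turns the almost fixed points found on a grid into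
    fixed points. *)
Lemma near_fixed_points (R : realType) (V : normedModType R) (K : set V) (f : V -> V) :
  compact K -> {within K, continuous f} -> forall e : R, 0 < e ->
  exists2 d : R, 0 < d & forall x, K x -> `|x - f x| < d ->
    exists y, [/\ K y, f y = y & `|x - y| < e].
Proof.
move=> cK /within_continuousP cf e e0.
have ncK := (near_covering_withinP K).2 ((compact_near_coveringP K).1 cK).
pose P (d : R) x := `|x - f x| < d -> exists y, [/\ K y, f y = y & `|x - y| < e].
suff [d /= d0 hd] : \forall d \near (0 : R)^'+, K `<=` P d.
  exists (d / 2); first by rewrite divr_gt0.
  move=> x Kx xfx; apply: (hd (d / 2)) => //=.
  - by rewrite sub0r normrN gtr0_norm ?divr_gt0 // ltr_pdivrMr // ltr_pMr // ltr1n.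
  - by rewrite divr_gt0.
apply: ncK => x Kx.
have [fx|fx] := eqVneq (f x) x.
  exists (ball x e, setT) => /=; first by split; [exact: nbhsx_ballx|exact: filterT].
  case=> x' d' /= [xx' _] Kx' _; exists x; split=> //.
  by move: xx'; rewrite -ball_normE /= distrC.
have c0 : 0 < `|x - f x| by rewrite normr_gt0 subr_eq0 eq_sym.
set c := `|x - f x| in c0.
have c4 : 0 < c / 4 by rewrite divr_gt0.
have [d d0 hd] := cf x Kx _ c4.
have m0 : 0 < Num.min d (c / 4) by rewrite lt_min d0.
exists (ball x (Num.min d (c / 4)), [set d' | d' < c / 2]) => /=.
  split; first exact: nbhsx_ballx.
  by apply: nbhs_right_lt; rewrite divr_gt0.
case=> x' d' /= [xx' dd'] Kx' x'f; exfalso.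
have h1 : `|f x - f x'| < c / 4.
  by apply: hd => //; apply: le_ball xx'; rewrite ge_min lexx.
have h2 : `|x - x'| < c / 4.
  by move: xx'; rewrite -ball_normE /= lt_min => /andP[].
have : c <= `|x - x'| + `|x' - f x'| + `|f x - f x'|.
  rewrite /c (_ : x - f x = (x - x') + (x' - f x') - (f x - f x')).
    apply: le_trans (ler_normB _ _) _; rewrite lerD2r; exact: ler_normD.
  by rewrite addrA subrK opprB addrA subrK.
lra.
Qed.

(** * A fixed point class of nonzero index persists *)

Section Sector.
Variable R : realType.
Local Notation E := 'rV[R]_2.

(** A cover of the plane by three sectors with apex 0, as a colouring. A point
    close to points of all three colours is close to 0 ([three_sectors]). *)
Definition sector (x : E) : color :=
  if 0 < x 0 1 then C0 else if 0 < x 0 0 then C1 else C2.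

Lemma sector_C0 x : sector x = C0 -> 0 < x 0 1.
Proof. by rewrite /sector; case: ifP => //; case: ifP. Qed.

Lemma sector_C1 x : sector x = C1 -> x 0 1 <= 0 /\ 0 < x 0 0.
Proof. by rewrite /sector; case: ltP => // h; case: ltP. Qed.

Lemma sector_C2 x : sector x = C2 -> x 0 1 <= 0 /\ x 0 0 <= 0.
Proof. by rewrite /sector; case: ltP => // h; case: ltP. Qed.

Lemma norm2_coord (x : E) e : `|x| <= e -> `|x 0 0| <= e /\ `|x 0 1| <= e.
Proof. by move/norm2_le. Qed.

Lemma three_sectors (x0 x1 x2 y : E) e :
  sector x0 = C0 -> sector x1 = C1 -> sector x2 = C2 ->
  `|x0 - y| <= e -> `|x1 - y| <= e -> `|x2 - y| <= e -> `|y| <= e.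
Proof.
move=> /sector_C0 a /sector_C1[b b'] /sector_C2[c c'].
move=> /norm2_coord; rewrite !mxE => -[_ h0] /norm2_coord; rewrite !mxE => -[h1 h1'].
move=> /norm2_coord; rewrite !mxE => -[h2 h2']; apply/norm2_le.
by rewrite !ler_norml in h0 h1 h1' h2 h2' *; split; lra.
Qed.

Lemma quad_near0 (x1 x2 x3 x4 y : E) e :
  quad (sector x1) (sector x2) (sector x3) (sector x4) != 0 ->
  `|x1 - y| <= e -> `|x2 - y| <= e -> `|x3 - y| <= e -> `|x4 - y| <= e ->
  `|y| <= e.
Proof.
move=> /quad_tricolor h h1 h2 h3 h4.
have wit c : exists2 x, sector x = c & `|x - y| <= e.
  by case: (h c) => ec; [exists x1|exists x2|exists x3|exists x4].
have [[a ea ha] [b eb hb] [c ec hc]] := And3 (wit C0) (wit C1) (wit C2).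
exact: three_sectors ea eb ec ha hb hc.
Qed.

End Sector.

Lemma leq_next i i' : i' = i \/ i' = i.+1 -> (i <= i' <= i.+1)%N.
Proof. by case=> ->; rewrite leqnn leqnSn. Qed.

Lemma leq_next_inv i i' : (i <= i' <= i.+1)%N -> i' = i \/ i' = i.+1.
Proof. lia. Qed.

Lemma leq_next_range a b i i' : (a <= i)%N -> (i < b)%N -> (i <= i' <= i.+1)%N ->
  (a <= i' <= b)%N.
Proof. lia. Qed.

Section GridArgument.
Variable R : realType.
Local Notation E := 'rV[R]_2.

(** The local form of id - f at the fixed points considered below: an affine
    map of determinant [m]. *)
Definition saddle (a m : R) (p v : E) : E :=
  vec2 ((v 0 0 - p 0 0) - a * (v 0 1 - p 0 1)) (m * (v 0 1 - p 0 1)).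

Variables (K : set E) (disp : nat -> E -> E) (lab : nat -> E -> Prop) (n : nat).
Variables (ep eta B rho a m sigma : R) (p : E).

Hypothesis ep0 : 0 < ep.
Hypothesis eta0 : 0 < eta.
Hypothesis disp_space : forall k v v', (k <= n)%N -> K v -> K v' -> `|v - v'| <= eta ->
  `|disp k v - disp k v'| <= ep / 4.
Hypothesis disp_time : forall k v, (k < n)%N -> K v -> `|disp k.+1 v - disp k v| <= ep / 4.
Hypothesis near_inside : forall k v v', (k <= n)%N -> K v -> `|disp k v| <= ep ->
  `|v' - v| <= 2 * eta -> K v'.
Hypothesis lab_space : forall k v v', (k <= n)%N -> K v -> K v' -> `|v - v'| <= eta ->
  `|disp k v| <= ep -> `|disp k v'| <= ep -> lab k v -> lab k v'.
Hypothesis lab_time : forall k v, (k < n)%N -> K v ->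
  `|disp k v| <= ep -> `|disp k.+1 v| <= ep -> lab k v <-> lab k.+1 v.
Hypothesis K_bounded : forall v, K v -> `|v| <= B.

Local Notation rho' := (rho / (2 * (1 + `|a|))).
Hypothesis rho0 : 0 < rho.
Hypothesis m0 : m != 0.
Hypothesis sigma0 : 0 <= sigma.
Hypothesis sigma_eta : sigma + 2 * eta < rho'.
Hypothesis lab_near : forall v, K v -> `|disp 0 v| <= ep -> lab 0 v -> `|v - p| <= sigma.
Hypothesis near_lab : forall v, `|v - p| <= rho ->
  [/\ K v, disp 0 v = saddle a m p v & `|disp 0 v| <= ep -> lab 0 v].

Let C := B + eta.
Let coord (i : nat) : R := - C + i%:R * eta.
Let pt i j : E := vec2 (coord i) (coord j).
Let col k i j := sector (disp k (pt i j)).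
Let chi k i j : bool := `[< [/\ K (pt i j), `|disp k (pt i j)| <= ep & lab k (pt i j)] >].

Let coordS i : coord i.+1 = coord i + eta.
Proof. by rewrite /coord -natr1 mulrDl mul1r addrA. Qed.

Let pt_close i j i' j' : (i <= i' <= i.+1)%N -> (j <= j' <= j.+1)%N ->
  `|pt i' j' - pt i j| <= eta.
Proof.
have h u u' : (u <= u' <= u.+1)%N -> 0 <= coord u' - coord u <= eta.
  move=> uu; have [->|->] := leq_next_inv uu.
    by rewrite subrr lexx ltW.
  by rewrite coordS addrC addKr ltW ?lexx.
move=> /h hi /h hj; apply/norm2_le; rewrite !mxE /= !ler_norml.
split; lra.
Qed.

Let chi_out k i j : ~ K (pt i j) -> chi k i j = false.
Proof. by move=> nK; apply/asboolP => -[]. Qed.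

Let near_K k i j i' j' : (k <= n)%N -> K (pt i j) -> `|disp k (pt i j)| <= ep ->
  `|pt i' j' - pt i j| <= 2 * eta -> K (pt i' j').
Proof. by move=> kn Kv nv; exact: near_inside kn Kv nv. Qed.

Let chi_near k i j i' j' : (k <= n)%N -> `|pt i' j' - pt i j| <= 2 * eta ->
  ~ K (pt i' j') -> chi k i j = false.
Proof.
move=> kn d nK; apply/asboolP => -[Kv nv _]; apply: nK; exact: near_K kn Kv nv d.
Qed.

Let eta2 : eta <= 2 * eta. Proof. have := eta0; lra. Qed.

Let square_near k i j : (k <= n)%N -> square (col k) i j != 0 ->
  K (pt i j) -> K (pt i.+1 j) -> K (pt i.+1 j.+1) -> K (pt i j.+1) ->
  `|disp k (pt i j)| <= ep / 4.
Proof.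
move=> kn /quad_near0 h K1 K2 K3 K4; apply: h.
- by rewrite subrr normr0 divr_ge0 // ltW.
- by apply: disp_space => //; apply: pt_close; apply: leq_next; auto.
- by apply: disp_space => //; apply: pt_close; apply: leq_next; auto.
- by apply: disp_space => //; apply: pt_close; apply: leq_next; auto.
Qed.

Let close_corners i j i' j' : (i <= i' <= i.+1)%N -> (j <= j' <= j.+1)%N ->
  `|pt i' j' - pt i j| <= 2 * eta.
Proof. by move=> hi hj; apply: le_trans (pt_close hi hj) eta2. Qed.

Let chi_square k i j : (k < n)%N ->
  square (col k) i j != 0 \/ square (col k.+1) i j != 0 -> chi k i j = chi k.+1 i j.
Proof.
move=> kn sq.
have [[K1 K2 K3 K4]|nK] := pselect [/\ K (pt i j), K (pt i.+1 j), K (pt i.+1 j.+1) & K (pt i j.+1)]; last first.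
  have [i' [j' [hi hj nK']]] : exists i' j', [/\ (i <= i' <= i.+1)%N, (j <= j' <= j.+1)%N & ~ K (pt i' j')].
    apply: contrapT => h; apply: nK; split; apply: contrapT => nK; apply: h.
    - by exists i, j; split=> //; apply: leq_next; auto.
    - by exists i.+1, j; split=> //; apply: leq_next; auto.
    - by exists i.+1, j.+1; split=> //; apply: leq_next; auto.
    - by exists i, j.+1; split=> //; apply: leq_next; auto.
  rewrite (chi_near (ltnW kn) (close_corners hi hj) nK').
  by rewrite (chi_near kn (close_corners hi hj) nK').
have dt := disp_time kn K1.
have nn : `|disp k (pt i j)| <= ep /\ `|disp k.+1 (pt i j)| <= ep.
  case: sq => sq.
    have h := square_near (ltnW kn) sq K1 K2 K3 K4.
    split; first by have := ep0; lra.
    have := ler_normD (disp k.+1 (pt i j) - disp k (pt i j)) (disp k (pt i j)).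
    rewrite subrK; have := ep0; have := eta0; lra.
  have h := square_near kn sq K1 K2 K3 K4.
  split; last by have := ep0; lra.
  have := ler_normB (disp k.+1 (pt i j)) (disp k.+1 (pt i j) - disp k (pt i j)).
  rewrite opprB addrC subrK; have := ep0; have := eta0; lra.
case: nn => n1 n2; have ll := lab_time kn K1 n1 n2.
by apply: asbool_equiv_eq; split=> -[_ _ /ll].
Qed.

Let flux_near k i j i' j' : (k < n)%N -> K (pt i j) -> K (pt i' j') ->
  `|pt i' j' - pt i j| <= eta ->
  quad (col k i j) (col k i' j') (col k.+1 i' j') (col k.+1 i j) != 0 ->
  `|disp k (pt i j)| <= ep / 2.
Proof.
move=> kn K1 K2 d /quad_near0 h.
have d1 := disp_space (ltnW kn) K2 K1 d.
have d2 := disp_time kn K2.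
have d3 := disp_time kn K1.
apply: h; rewrite ?subrr ?normr0; try (have := ep0; lra).
have := ler_normD (disp k.+1 (pt i' j') - disp k (pt i' j')) (disp k (pt i' j') - disp k (pt i j)).
rewrite addrA subrK; have := ep0; have := eta0; lra.
Qed.

Let chi_step k i j i' j' : (k < n)%N -> `|pt i j - pt i' j'| <= eta ->
  K (pt i' j') -> `|disp k (pt i' j')| <= ep / 2 -> chi k i j = chi k i' j'.
Proof.
move=> kn d K' nn.
have d' : `|pt i j - pt i' j'| <= 2 * eta by apply: le_trans d eta2.
have K1 : K (pt i j) by apply: near_K (ltnW kn) K' _ d'; have := ep0; have := eta0; lra.
have dd := disp_space (ltnW kn) K1 K' d.
have nn1 : `|disp k (pt i j)| <= ep.
  have := ler_normD (disp k (pt i j) - disp k (pt i' j')) (disp k (pt i' j')).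
  rewrite subrK; have := ep0; have := eta0; lra.
have nn2 : `|disp k (pt i' j')| <= ep by have := ep0; lra.
have dC : `|pt i' j' - pt i j| <= eta by rewrite distrC.
apply: asbool_equiv_eq; split=> -[_ _ l]; split=> //.
  exact: lab_space (ltnW kn) K1 K' d nn1 nn2 l.
exact: lab_space (ltnW kn) K' K1 dC nn2 nn1 l.
Qed.

Let dist2 i j i' j' i'' j'' : `|pt i' j' - pt i j| <= eta -> `|pt i'' j'' - pt i' j'| <= eta ->
  `|pt i'' j'' - pt i j| <= 2 * eta.
Proof.
move=> h1 h2; have := ler_normD (pt i'' j'' - pt i' j') (pt i' j' - pt i j).
by rewrite addrA subrK; have := ep0; have := eta0; lra.
Qed.

Let chi_flux k i j i' j' i'' j'' : (k < n)%N -> `|pt i' j' - pt i j| <= eta ->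
  `|pt i'' j'' - pt i' j'| <= eta ->
  quad (col k i' j') (col k i'' j'') (col k.+1 i'' j'') (col k.+1 i' j') != 0 ->
  chi k i j = chi k i' j'.
Proof.
move=> kn d1 d2 q.
have d1' : `|pt i j - pt i' j'| <= eta by rewrite distrC.
have d12 := dist2 d1 d2.
have [K1|nK1] := pselect (K (pt i' j')); last first.
  by rewrite (chi_out _ nK1) (chi_near (ltnW kn) _ nK1) //; apply: le_trans d1 eta2.
have [K2|nK2] := pselect (K (pt i'' j'')); last first.
  rewrite (chi_near (ltnW kn) d12 nK2) (chi_near (ltnW kn) _ nK2) //.
  exact: le_trans d2 eta2.
exact: chi_step kn d1' K1 (flux_near kn K1 K2 d2 q).
Qed.

Let K_coord i j : K (pt i j) -> - B <= coord i <= B /\ - B <= coord j <= B.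
Proof. by move=> /K_bounded/norm2_coord; rewrite !mxE /= -!ler_norml. Qed.

Let coord_index x : - C <= x -> exists i, x < coord i <= x + eta.
Proof.
move=> xC; exists (Num.trunc ((x + C) / eta)).+1.
have h0 : 0 <= (x + C) / eta by rewrite divr_ge0 ?(ltW eta0) //; have := ep0; have := eta0; lra.
have := truncn_itv h0; rewrite ler_pdivlMr // ltr_pdivrMr // => /andP[h1 h2].
by rewrite coordS /coord in h2 *; move: h2; rewrite -natr1 mulrDl mul1r => h2; have := ep0; have := eta0; lra.
Qed.

Let coord_lt i j : coord i < coord j -> (i < j)%N.
Proof. by rewrite ltrD2l ltr_pM2r // ltr_nat. Qed.

(** [disp k] is the displacement of the map at time k, extended to a
    neighbourhood [K] of the space, and [lab k v] says that [v] carries the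
    class of the fixed point [p] at that time. At time 0 the labelled squares
    form a box around [p], where the displacement is affine, and the labelled
    count is 3 or -3. If no vertex were labelled at time n, the count would be
    0. *)
Lemma class_persists : exists v, [/\ K v, `|disp n v| <= ep & lab n v].
Proof.
have [N hN] : exists N : nat, B < coord N.
  exists (Num.bound ((B + C) / eta)).
  have B0 : 0 <= B.
    have [Kp _ _] : [/\ K p, disp 0 p = saddle a m p p & `|disp 0 p| <= ep -> lab 0 p].
      by apply: near_lab; rewrite subrr normr0 ltW.
    by apply: le_trans (K_bounded Kp).
  have h0 : 0 <= (B + C) / eta by rewrite divr_ge0 ?(ltW eta0) // /C; have := ep0; have := eta0; lra.
  by have := archi_boundP h0; rewrite ltr_pdivrMr // /coord; have := ep0; have := eta0; lra.
(* C exceeds the bound B on K by eta, so the outermost vertices lie outside K *)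
have border k i : [/\ chi k i 0 = false, chi k i N = false, chi k 0 i = false & chi k N i = false].
  have c0 : coord 0 < - B by rewrite /coord mul0r /C; have := ep0; have := eta0; lra.
  by split; apply: chi_out => /K_coord; have := ep0; have := eta0; lra.
have count0n : class_count col chi N 0 = class_count col chi N n.
  apply: class_count_const border => // k i j kn.
    by apply: chi_flux => //; apply: pt_close; apply: leq_next; auto.
  by apply: chi_flux => //; apply: pt_close; apply: leq_next; auto.
apply: contrapT => none; suff : class_count col chi N 0 != 0.
  rewrite count0n /class_count big1 ?eqxx // => i _; rewrite big1 // => j _.
  rewrite (_ : chi n i j = false) ?mulr0n //.
  by apply/asboolP => h; apply: none; exists (pt i j).
have a1 : 0 < 1 + `|a| by have := normr_ge0 a; lra.
have rho'_gt0 : 0 < rho' by rewrite divr_gt0 // mulr_gt0.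
have rho'E : rho' * (1 + `|a|) = rho / 2.
  by rewrite invfM mulrA divfK ?gt_eqF.
have a_rho' : `|a| * rho' < rho / 2 by rewrite -rho'E; lra.
have rho'_rho : rho' <= rho / 2.
  by rewrite -rho'E ler_peMr ?(ltW rho'_gt0) //; have := normr_ge0 a; lra.
have et := eta0; have sg := sigma0; have sge := sigma_eta; have r0 := rho0.
(* half the height of the box around p on which the labelled squares are counted *)
set width := rho' in rho'_gt0 a_rho' rho'_rho sge; clearbody width.
have inbox (v : E) : `|v 0 0 - p 0 0| <= rho -> `|v 0 1 - p 0 1| <= width -> `|v - p| <= rho.
  by move=> h0 h1; apply/norm2_le; rewrite !mxE; split=> //; lra.
have box_K x0 x1 : `|x0| <= rho -> `|x1| <= width ->
    (- B <= p 0 0 + x0 <= B) /\ (- B <= p 0 1 + x1 <= B).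
  move=> h0 h1.
  have h : `|vec2 (p 0 0 + x0) (p 0 1 + x1) - p| <= rho.
    by apply: inbox; rewrite !mxE /= [X in `|X|]addrC addKr.
  have [/K_bounded/norm2_coord] := near_lab h.
  by rewrite !mxE /= !ler_norml.
have nrho : `|rho| <= rho by rewrite ger0_norm ?(ltW r0).
have nrho' : `|width| <= width by rewrite ger0_norm ?(ltW rho'_gt0).
have z : `|0 : R| <= width by rewrite normr0 ltW.
have [bx0 by0] : (- B <= p 0 0 - rho <= B) /\ (- B <= p 0 1 - width <= B).
  by apply: box_K; rewrite normrN.
have [bx1 by1] := box_K rho width nrho nrho'.
have cidx x : - (B + eta) <= x -> exists i, x < coord i <= x + eta by exact: coord_index.
(* grid lines just inside the box of half sides rho and width around p; width is so
   small that on the vertical sides the shear does not change the sign of the first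
   coordinate of the displacement *)
have [i0 /andP[i0l i0r]] : exists i, p 0 0 - rho < coord i <= p 0 0 - rho + eta.
  by apply: cidx; lra.
have [i1 /andP[i1l i1r]] : exists i, p 0 0 + rho - eta < coord i <= p 0 0 + rho - eta + eta.
  by apply: cidx; lra.
have [j0 /andP[j0l j0r]] : exists j, p 0 1 - width < coord j <= p 0 1 - width + eta.
  by apply: cidx; lra.
have [j1 /andP[j1l j1r]] : exists j, p 0 1 + width - eta < coord j <= p 0 1 + width - eta + eta.
  by apply: cidx; lra.
have i01 : (i0 <= i1 <= N)%N by apply/andP; split; apply/ltnW/coord_lt; lra.
have j01 : (j0 <= j1 <= N)%N by apply/andP; split; apply/ltnW/coord_lt; lra.
have coord_le i j : (i <= j)%N -> coord i <= coord j.
  by move=> ij; rewrite lerD2l ler_pM2r // ler_nat.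
have in_rect i j : (i0 <= i <= i1)%N -> (j0 <= j <= j1)%N ->
    [/\ `|coord i - p 0 0| <= rho, `|coord j - p 0 1| <= width & `|pt i j - p| <= rho].
  move=> /andP[/coord_le h1 /coord_le h2] /andP[/coord_le h3 /coord_le h4].
  have hx : `|coord i - p 0 0| <= rho by rewrite ler_norml; lra.
  have hy : `|coord j - p 0 1| <= width by rewrite ler_norml; lra.
  by split=> //; apply: inbox; rewrite !mxE.
have dispE i j : (i0 <= i <= i1)%N -> (j0 <= j <= j1)%N ->
    disp 0 (pt i j) 0 0 = (coord i - p 0 0) - a * (coord j - p 0 1) /\
    disp 0 (pt i j) 0 1 = m * (coord j - p 0 1).
  by move=> hi hj; have [_ _ /near_lab[_ -> _]] := in_rect i j hi hj; rewrite !mxE.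
rewrite (class_count_box i01 j01); last first.
  move=> i j sq.
  have [inR|outR] := boolP ((i0 <= i < i1)%N && (j0 <= j < j1)%N).
    move/andP: inR => [/andP[h1 h2] /andP[h3 h4]].
    have corner i' j' : (i <= i' <= i.+1)%N -> (j <= j' <= j.+1)%N -> K (pt i' j').
      move=> hi hj; have hi' := leq_next_range h1 h2 hi.
      have hj' := leq_next_range h3 h4 hj.
      by have [_ _ /near_lab[]] := in_rect i' j' hi' hj'.
    have nn : `|disp 0 (pt i j)| <= ep / 4.
      by apply: square_near => //; apply: corner; apply: leq_next; auto.
    have nn' : `|disp 0 (pt i j)| <= ep by have := ep0; lra.
    have hi : (i0 <= i <= i1)%N by rewrite h1 ltnW.
    have hj : (j0 <= j <= j1)%N by rewrite h3 ltnW.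
    have [_ _ /near_lab[Kp _ lp]] := in_rect i j hi hj.
    by apply/asboolP; split=> //; exact: lp.
  apply: contraNF outR => /asboolP[Kp nn lp].
  have /norm2_coord := lab_near Kp nn lp; rewrite !mxE /= !ler_norml => -[h0 h1].
  have -> : (i0 <= i)%N by apply/ltnW/coord_lt; lra.
  have -> : (i < i1)%N by apply/coord_lt; lra.
  have -> : (j0 <= j)%N by apply/ltnW/coord_lt; lra.
  by apply/coord_lt; lra.
have [i0i1 _] := andP i01; have [j0j1 _] := andP j01.
have i0r' : (i0 <= i0 <= i1)%N by rewrite leqnn.
have i1r' : (i0 <= i1 <= i1)%N by rewrite leqnn andbT.
have j0r' : (j0 <= j0 <= j1)%N by rewrite leqnn.
have j1r' : (j0 <= j1 <= j1)%N by rewrite leqnn andbT.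
rewrite (@sum_squares_box (col 0%N) (m < 0)) //; first by case: ifP.
- move=> i hi; have [_ e0] := dispE i j0 hi j0r'; have [_ e1] := dispE i j1 hi j1r'.
  have y0 : coord j0 - p 0 1 < 0 by lra.
  have y1 : 0 < coord j1 - p 0 1 by lra.
  rewrite /col /sector e0 e1; case: ltgtP m0 => // ms _.
    by rewrite nmulr_rgt0 // y0 nmulr_rgt0 // ltNge (ltW y1) /=; case: ifP.
  by rewrite !pmulr_rgt0 // y1 ltNge (ltW y0) /=; case: ifP.
move=> j hj; have [_ hy _] := in_rect i0 j i0r' hj.
have ay : `|a * (coord j - p 0 1)| <= `|a| * width by rewrite normrM ler_wpM2l.
move: ay; rewrite ler_norml => ay.
have [e0 _] := dispE i0 j i0r' hj; have [e1 _] := dispE i1 j i1r' hj.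
rewrite /col /sector e0 e1; split.
  case: ifP => // _; rewrite ltNge (_ : _ <= 0) //; lra.
case: ifP => // _; rewrite (_ : 0 < _) //; lra.
Qed.

End GridArgument.

(** * Nielsen theory with values in a group *)

Section Arithmetic.
Variable R : realType.
Implicit Types a b c e s : R.

Lemma half_lt c : 0 < c -> c / 2 < c. Proof. lra. Qed.

Lemma add_eighths a b c e : a <= c -> b < e / 8 -> c <= e / 8 -> a + b <= e / 4.
Proof. lra. Qed.

Lemma eighth_le_quarter b e : b < e / 8 -> 0 < e -> b <= e / 4.
Proof. lra. Qed.

Lemma add_quarters a b c e s : a <= 2 * s -> b <= e -> e <= c / 2 -> s <= c / 4 -> a + b <= c.
Proof. lra. Qed.

Lemma quarter_lt_double s e : e <= s / 4 -> 0 < s -> s + 2 * e < 2 * s.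
Proof. lra. Qed.

Lemma two_quarters_lt a b e c s : a <= b + e -> b <= c -> c <= s / 4 -> e < s / 4 -> a < s / 2.
Proof. lra. Qed.

Lemma add_half_quarter a b s : a < s / 4 -> b < s / 2 -> 0 < s -> b + a <= s.
Proof. lra. Qed.

End Arithmetic.

Section Transport.
Variables (R : realType) (G : groupType).
Local Notation E := 'rV[R]_2.
Local Notation "x ** y" := (monoid.mul x y) (at level 40, left associativity).
Local Notation I01 := (`[0, 1]%classic : set R).

Variables (X : set E) (trans : E -> E -> G) (delta : R).

(** A local cocycle with values in [G]: a discrete substitute for the
    homomorphism from the fundamental groupoid of [X] to [G]. *)
Definition transport := 0 < delta /\ forall x y z, X x -> X y -> X z ->
  `|x - y| < delta -> `|y - z| < delta -> `|x - z| < delta ->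
  trans x y ** trans y z = trans x z.

Hypothesis tr : transport.

Lemma transE x y z : X x -> X y -> X z ->
  `|x - y| < delta -> `|y - z| < delta -> `|x - z| < delta ->
  trans x y ** trans y z = trans x z.
Proof. by case: tr => _; exact. Qed.

Lemma trans1 x : X x -> trans x x = monoid.one.
Proof.
move=> Xx; have d0 : `|x - x| < delta by rewrite subrr normr0; case: tr.
by apply/(@mulgI _ (trans x x)); rewrite mulg1 (transE Xx Xx Xx).
Qed.

Fixpoint chain (u : nat -> E) (k : nat) : G :=
  if k is k'.+1 then chain u k' ** trans (u k') (u k) else monoid.one.

(** Homotopy invariance: the two sides of a thin ladder have the same
    transport, up to the rungs at the two ends. *)
Lemma chain_ladder (u v : nat -> E) n :
  (forall k, (k <= n)%N -> [/\ X (u k), X (v k) & `|u k - v k| < delta]) ->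
  (forall k, (k < n)%N -> [/\ `|u k - u k.+1| < delta, `|v k - v k.+1| < delta &
     `|u k - v k.+1| < delta]) ->
  chain u n ** trans (u n) (v n) = trans (u 0%N) (v 0%N) ** chain v n.
Proof.
elim: n => [|n IH] hX hd /=; first by rewrite mul1g mulg1.
have {}IH : chain u n ** trans (u n) (v n) = trans (u 0%N) (v 0%N) ** chain v n.
  by apply: IH => k kn; [apply: hX|apply: hd]; lia.
have [Xu Xv uv] := hX n (leqnSn n); have [Xu1 Xv1 uv1] := hX n.+1 (leqnn _).
have [uu vv uv'] := hd n (leqnn _).
by rewrite -mulgA (transE Xu Xu1 Xv1) // mulgA -IH -mulgA (transE Xu Xv Xv1).
Qed.

Lemma eq_chain (u v : nat -> E) n : (forall k, (k <= n)%N -> u k = v k) -> chain u n = chain v n.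
Proof.
elim: n => //= n IH h; rewrite IH => [|k kn]; last by apply: h; exact: leqW.
by rewrite !h.
Qed.

Definition twisted_equiv (phi : G -> G) (u v : G) := exists z, u ** z = phi z ** v.

Variables (f : E -> E) (theta : E -> G) (phi : G -> G) (dtheta : R).

(** [theta] is a lift of [f], in the cover defined by the cocycle, that is
    equivariant for the endomorphism [phi]. *)
Definition lifts := [/\ 0 < dtheta, {morph phi : a b / a ** b} &
  forall x y, X x -> X y -> `|x - y| < dtheta ->
    theta x ** trans (f x) (f y) = phi (trans x y) ** theta y].

Hypothesis lf : lifts.

Lemma phi1 : phi monoid.one = monoid.one.
Proof.
case: lf => _ phiM _; apply/(@mulgI _ (phi monoid.one)).
by rewrite -phiM !mulg1.
Qed.

Section Track.
Variables (H : R -> E -> E) (g : E -> E) (n : nat) (d : R).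

Hypothesis H_X : forall t x, I01 t -> X x -> X (H t x).
Hypothesis H0 : forall x, X x -> H 0 x = f x.
Hypothesis H1 : forall x, X x -> H 1 x = g x.
Hypothesis n0 : (0 < n)%N.
Hypothesis d_delta : d <= delta / 4.
Hypothesis d_theta : d <= dtheta.
Hypothesis dn : n%:R^-1 < d.
Hypothesis H_unif : forall s t x y, I01 s -> I01 t -> X x -> X y -> `|s - t| < d ->
  `|x - y| < d -> `|H s x - H t y| < delta / 4.

Definition time (k : nat) : R := k%:R / n%:R.

Lemma time_I k : (k <= n)%N -> I01 (time k).
Proof.
move=> kn; rewrite /= in_itv /= divr_ge0 ?ler0n //=.
by rewrite ler_pdivrMr ?ltr0n // mul1r ler_nat.
Qed.

Lemma time_step k : `|time k - time k.+1| < d.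
Proof.
by rewrite /time -mulrBl -natr1 opprD addrA subrr sub0r mulN1r normrN ger0_norm ?invr_ge0.
Qed.

Lemma d_gt0 : 0 < d.
Proof. by apply: lt_trans dn; rewrite invr_gt0 ltr0n. Qed.

Lemma delta_gt0 : 0 < delta. Proof. by case: tr. Qed.

Definition track (k : nat) (x : E) : G := chain (fun j => H (time j) x) k.

(** The lift at the point [x], carried along the track of [x] under the
    homotopy up to time k. At points that are moved little, this is locally
    constant in space up to twisted conjugacy, and constant in time. *)
Definition label (k : nat) (x : E) : G := theta x ** track k x ** trans (H (time k) x) x.

Lemma track_space k x y : (k <= n)%N -> X x -> X y -> `|x - y| < d ->
  track k x ** trans (H (time k) x) (H (time k) y) = trans (f x) (f y) ** track k y.
Proof.
move=> kn Xx Xy xy; have dd := d_gt0; have de := delta_gt0.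
have small s t u v : I01 s -> I01 t -> X u -> X v -> `|s - t| < d -> `|u - v| < d ->
    `|H s u - H t v| < delta.
  move=> Is It Xu Xv st uv; have h := H_unif Is It Xu Xv st uv.
  by apply: lt_le_trans h _; lra.
have r0 u : `|u - u : E| < d by rewrite subrr normr0.
have s0 u : `|u - u : R| < d by rewrite subrr normr0.
have -> : trans (f x) (f y) = trans (H (time 0) x) (H (time 0) y).
  by rewrite /time mul0r !H0.
apply: chain_ladder => j jk.
  have Ij : I01 (time j) by apply: time_I; exact: leq_trans kn.
  by split; [exact: H_X|exact: H_X|exact: small].
have Ij : I01 (time j) by apply: time_I; apply: leq_trans kn; exact: ltnW.
have Ij1 : I01 (time j.+1) by apply: time_I; exact: leq_trans kn.
by have sj := time_step j; split; exact: small.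
Qed.

Lemma label_space k x y : (k <= n)%N -> X x -> X y -> `|x - y| < d ->
  `|H (time k) x - x| < delta / 4 -> `|H (time k) y - y| < delta / 4 ->
  label k x ** trans x y = phi (trans x y) ** label k y.
Proof.
move=> kn Xx Xy xy hx hy; rewrite /label.
have Ik := time_I kn; have dd := d_gt0; have de := delta_gt0.
have xyd : `|x - y| < delta / 4 by apply: lt_le_trans d_delta.
have hxy : `|H (time k) x - H (time k) y| < delta / 4.
  by apply: H_unif; rewrite // subrr normr0.
have hx_y : `|H (time k) x - y| < delta.
  have := ler_normD (H (time k) x - x) (x - y); rewrite addrA subrK; lra.
have e1 : trans (H (time k) x) x ** trans x y = trans (H (time k) x) y.
  by apply: transE; rewrite //; try exact: H_X; lra.
have e2 : trans (H (time k) x) (H (time k) y) ** trans (H (time k) y) y = trans (H (time k) x) y.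
  by apply: transE; rewrite //; try exact: H_X; lra.
have xyt : `|x - y| < dtheta by apply: lt_le_trans d_theta.
case: lf => _ phiM /(_ x y Xx Xy xyt) e3.
rewrite -!mulgA e1 -e2 [track k x ** _]mulgA track_space // !mulgA e3.
by rewrite -!mulgA.
Qed.

Lemma label_time k x : (k < n)%N -> X x ->
  `|H (time k) x - x| < delta / 4 -> `|H (time k.+1) x - x| < delta / 4 ->
  label k.+1 x = label k x.
Proof.
move=> kn Xx h1 h2; rewrite /label /= -!mulgA; congr (_ ** (_ ** _)).
have Ik := time_I (ltnW kn); have Ik1 := time_I kn; have dd := d_gt0; have de := delta_gt0.
have h3 : `|H (time k) x - H (time k.+1) x| < delta / 4.
  by apply: H_unif; rewrite ?time_step // subrr normr0.
by apply: transE; rewrite //; try exact: H_X; lra.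
Qed.

Lemma twisted_step u v w t : twisted_equiv phi w u -> u ** t = phi t ** v ->
  twisted_equiv phi w v.
Proof.
case: lf => _ phiM _ [z e] e'; exists (z ** t).
by rewrite phiM mulgA e -mulgA e' mulgA.
Qed.

Lemma label0 x : X x -> f x = x -> label 0 x = theta x.
Proof. by move=> Xx fx; rewrite /label /= mulg1 /time mul0r H0 // fx trans1 // mulg1. Qed.

Lemma labeln x : X x -> g x = x -> label n x = theta x ** track n x.
Proof.
move=> Xx gx; rewrite /label /= /time divff ?pnatr_eq0 -?lt0n //.
by rewrite H1 // gx trans1 // mulg1.
Qed.

End Track.

Variables (K : set E) (r : E -> E) (kappa : R).

(** A compact neighbourhood of [X] of uniform thickness [kappa], with a
    retraction; displacements are extended to it so that no boundary effect
    occurs. *)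
Definition retract_nbhd :=
  [/\ compact K, X `<=` K, 0 < kappa &
      [/\ forall x v, X x -> `|v - x| <= kappa -> K v,
          {within K, continuous r}, forall v, K v -> X (r v) &
          forall x, X x -> r x = x]].

Hypothesis nb : retract_nbhd.
Hypothesis Xcompact : compact X.

Definition affine_fixed_point (p : E) (rho a m : R) :=
  [/\ 0 < rho, m != 0 &
   forall v, `|v - p| <= rho -> X v /\ v - f v = saddle a m p v].

Lemma affine_fixed p rho a m : affine_fixed_point p rho a m -> X p /\ f p = p.
Proof.
case=> rho0 _ /(_ p); rewrite subrr normr0 => /(_ (ltW rho0))[Xp e]; split=> //.
apply/esym/eqP; rewrite -subr_eq0 e /saddle !subrr !mulr0 subrr; apply/eqP.
by apply: row2P; rewrite !mxE.
Qed.

Lemma affine_fixed_smaller p rho rho' a m : 0 < rho' <= rho ->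
  affine_fixed_point p rho a m -> affine_fixed_point p rho' a m.
Proof.
by move=> /andP[r0 rr] [_ m0 h]; split=> // v vp; apply: h; apply: le_trans rr.
Qed.

(** The homotopy is cut into n steps and [class_persists] is applied to the
    displacement v - H t (r v), the labelled points being those whose [label]
    is twisted equivalent to [theta p]. This yields a point that is almost
    fixed by [g] and carries that label, and near it lies a fixed point of [g]
    with the same label. *)
Lemma fixed_class_persists (H : R -> E -> E) (g : E -> E) p rho a m :
  {within I01 `*` X, continuous (fun z : R * E => H z.1 z.2)} ->
  (forall t x, I01 t -> X x -> X (H t x)) ->
  (forall x, X x -> H 0 x = f x) -> (forall x, X x -> H 1 x = g x) ->
  {within X, continuous f} -> {within X, continuous g} ->
  affine_fixed_point p rho a m ->
  (forall y, X y -> f y = y -> twisted_equiv phi (theta p) (theta y) -> y = p) ->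
  exists n0, forall n, (n0 <= n)%N -> exists y,
    [/\ X y, g y = y & twisted_equiv phi (theta p) (theta y ** track H n n y)].
Proof.
move=> cH HX H0 H1 cf cg afp sep.
case: (nb) => Kc XK kappa0 [Kkappa cr rX rid].
have [delta0 _] := tr; have [dtheta0 _ _] := lf.
have I01c : compact I01 by exact: segment_compact.
have IXc := compact_setX I01c Xcompact.
have d4 : 0 < delta / 4 by lra.
have [dH dH0 unifH] := compact_unif_continuous IXc cH d4.
have {}unifH s t x y : I01 s -> I01 t -> X x -> X y -> `|s - t| < dH -> `|x - y| < dH ->
    `|H s x - H t y| < delta / 4.
  move=> Is It Xx Xy st xy; apply: (unifH (s, x) (t, y)) => //.
  by split=> //=; rewrite -ball_normE.
pose d1 := Num.min dH (Num.min (delta / 4) dtheta).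
have d10 : 0 < d1 by rewrite !lt_min dH0 d4.
have d1H : d1 <= dH by rewrite ge_min lexx.
have d1d : d1 <= delta / 4 by rewrite !ge_min lexx orbT.
have d1t : d1 <= dtheta by rewrite !ge_min lexx !orbT.
have [B KB] : exists B, forall v, K v -> `|v| <= B.
  have [M [_ hM]] := compact_bounded Kc; exists (M + 1) => v Kv.
  by apply: hM => //; rewrite ltrDl.
(* the affine model is only used on a box where a single transport step is allowed *)
pose rho1 := Num.min rho (d1 / 2).
have rho0 : 0 < rho by case: afp.
have rho10 : 0 < rho1 by rewrite lt_min rho0 divr_gt0.
have afp1 : affine_fixed_point p rho1 a m.
  by apply: affine_fixed_smaller afp; rewrite rho10 ge_min lexx.
have rho1d : rho1 <= d1 / 2 by rewrite ge_min lexx orbT.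
clearbody rho1.
pose rho' := rho1 / (2 * (1 + `|a|)); pose sigma := rho' / 2.
have rho'0 : 0 < rho' by rewrite divr_gt0 // mulr_gt0 // ltr_pwDl.
have sigma0 : 0 < sigma by rewrite divr_gt0.
have rho'E : rho' = 2 * sigma by rewrite /sigma mulrC divfK.
have sigma4 : 0 < sigma / 4 by rewrite divr_gt0.
have ef0 : 0 < Num.min (sigma / 4) d1 by rewrite lt_min sigma4.
have [zf zf0 nearf] := near_fixed_points Xcompact cf ef0.
have [zg zg0 nearg] := near_fixed_points Xcompact cg d10.
(* a point moved by less than e3 is close to a fixed point, for f and for g *)
pose e3 := Num.min (Num.min zf zg) (Num.min (delta / 4) (sigma / 4)).
have e30 : 0 < e3 by rewrite !lt_min zf0 zg0 d4.
have e3zf : e3 <= zf by rewrite !ge_min lexx.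
have e3zg : e3 <= zg by rewrite !ge_min lexx orbT.
have e3d : e3 <= delta / 4 by rewrite !ge_min lexx !orbT.
have e3s : e3 <= sigma / 4 by rewrite !ge_min lexx !orbT.
clearbody e3.
have [c1 c10 unifr] := compact_unif_continuous Kc cr e30.
(* if the displacement at v is at most ep, then r v is moved by less than e3 *)
pose ep := Num.min (c1 / 2) (Num.min (kappa / 2) (sigma / 4)).
have ep0 : 0 < ep by rewrite !lt_min sigma4 !divr_gt0.
have epc : ep < c1.
  by apply: (@le_lt_trans _ _ (c1 / 2)); [rewrite ge_min lexx | exact: half_lt].
have epk : ep <= kappa / 2 by rewrite !ge_min lexx orbT.
have eps : ep <= sigma / 4 by rewrite !ge_min lexx !orbT.
clearbody ep.
have ep8 : 0 < ep / 8 by rewrite divr_gt0.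
have [d2 d20 unifH2] := compact_unif_continuous IXc cH ep8.
have {}unifH2 s t x y : I01 s -> I01 t -> X x -> X y -> `|s - t| < d2 -> `|x - y| < d2 ->
    `|H s x - H t y| < ep / 8.
  move=> Is It Xx Xy st xy; apply: (unifH2 (s, x) (t, y)) => //.
  by split=> //=; rewrite -ball_normE.
have d120 : 0 < Num.min d1 d2 by rewrite lt_min d10.
have [c2 c20 unifr2] := compact_unif_continuous Kc cr d120.
(* the mesh of the grid *)
pose eta := Num.min (ep / 8) (Num.min (c2 / 2) (Num.min (kappa / 4) (sigma / 4))).
have eta0 : 0 < eta by rewrite !lt_min ep8 sigma4 !divr_gt0.
have eta_ep : eta <= ep / 8 by rewrite ge_min lexx.
have eta_c : eta < c2.
  by apply: (@le_lt_trans _ _ (c2 / 2)); [rewrite !ge_min lexx orbT | exact: half_lt].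
have eta_k : eta <= kappa / 4 by rewrite !ge_min lexx !orbT.
have eta_s : eta <= sigma / 4 by rewrite !ge_min lexx !orbT.
clearbody eta.
have near_r v y : K v -> X y -> `|v - y| <= ep -> `|r v - y| < e3.
  move=> Kv Xy vy; rewrite -{1}(rid y Xy); apply: unifr => //; first exact: XK.
  by rewrite ball2E; apply: le_lt_trans vy epc.
have close_r v v' : K v -> K v' -> `|v - v'| <= eta -> `|r v - r v'| < Num.min d1 d2.
  by move=> Kv Kv' vv; apply: unifr2 => //; rewrite ball2E; apply: le_lt_trans vv eta_c.
exists (Num.bound (Num.min d1 d2)^-1).+1 => n nn.
have n0 : (0 < n)%N by apply: leq_trans nn.
have ndd : n%:R^-1 < Num.min d1 d2.
  rewrite invf_plt ?posrE ?ltr0n //; apply: lt_le_trans (archi_boundP _) _.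
    by rewrite invr_ge0 ltW.
  by rewrite ler_nat ltnW.
have nd1 : n%:R^-1 < d1 by move: ndd; rewrite lt_min => /andP[].
have nd2 : n%:R^-1 < d2 by move: ndd; rewrite lt_min => /andP[].
have unifH1 s t x y : I01 s -> I01 t -> X x -> X y -> `|s - t| < d1 -> `|x - y| < d1 ->
    `|H s x - H t y| < delta / 4.
  by move=> Is It Xx Xy st xy; apply: unifH => //; apply: lt_le_trans d1H.
pose T k := time n k.
pose disp k v : E := v - H (T k) (r v).
pose lab k v := twisted_equiv phi (theta p) (label H n k (r v)).
have IT k : (k <= n)%N -> I01 (T k) by exact: time_I.
have near_disp k v : (k <= n)%N -> K v -> `|disp k v| <= ep ->
    `|H (T k) (r v) - r v| < e3 /\ `|v - r v| < sigma / 2.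
  move=> kn Kv dv; have h : `|r v - H (T k) (r v)| < e3.
    by apply: near_r => //; apply: HX; [exact: IT | exact: rX].
  split; first by rewrite distrC.
  have := ler_normB (disp k v) (r v - H (T k) (r v)).
  rewrite /disp opprB addrA subrK => h'.
  exact: two_quarters_lt h' dv eps (lt_le_trans h e3s).
have trace_d1 v v' : K v -> K v' -> `|v - v'| <= eta -> `|r v - r v'| < d1.
  by move=> Kv Kv' /(close_r _ _ Kv Kv'); rewrite lt_min => /andP[].
have trace_d2 v v' : K v -> K v' -> `|v - v'| <= eta -> `|r v - r v'| < d2.
  by move=> Kv Kv' /(close_r _ _ Kv Kv'); rewrite lt_min => /andP[].
have near_delta k v : (k <= n)%N -> K v -> `|disp k v| <= ep ->
    `|H (T k) (r v) - r v| < delta / 4.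
  by move=> kn Kv /(near_disp _ _ kn Kv)[h _]; apply: lt_le_trans h e3d.
have step_space k x y : (k <= n)%N -> X x -> X y -> `|x - y| < d1 ->
    `|H (T k) x - x| < delta / 4 -> `|H (T k) y - y| < delta / 4 ->
    twisted_equiv phi (theta p) (label H n k x) -> twisted_equiv phi (theta p) (label H n k y).
  move=> kn Xx Xy xy hx hy l; apply: twisted_step l _.
  exact: (label_space HX H0 n0 d1d d1t nd1 unifH1 kn Xx Xy xy hx hy).
have fixed_delta k x : H (T k) x = x -> `|H (T k) x - x| < delta / 4.
  by move=> ->; rewrite subrr normr0.
have T0 : T 0%N = 0 by rewrite /T /time mul0r.
have Tn : T n = 1 by rewrite /T /time divff // pnatr_eq0 -lt0n.
have [v [Kv dv lv]] : exists v, [/\ K v, `|disp n v| <= ep & lab n v].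
  apply: (@class_persists R K disp lab n ep eta B rho1 a m sigma p) => //.
  - move=> k v v' kn Kv Kv' vv; have Ik := IT k kn.
    have h : `|H (T k) (r v) - H (T k) (r v')| < ep / 8.
      by apply: unifH2; [| |exact: rX|exact: rX|rewrite subrr normr0|exact: trace_d2].
    rewrite /disp (_ : v - _ - _ = (v - v') - (H (T k) (r v) - H (T k) (r v'))); last first.
      by rewrite !opprB addrACA [RHS]addrACA [- v' - _]addrC.
    by apply: le_trans (ler_normB _ _) _; exact: add_eighths vv h eta_ep.
  - move=> k v kn Kv; have Ik := IT k (ltnW kn); have Ik1 := IT k.+1 kn.
    have h : `|H (T k) (r v) - H (T k.+1) (r v)| < ep / 8.
      apply: unifH2; [| |exact: rX|exact: rX| |rewrite subrr normr0] => //.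
      exact: (time_step nd2).
    rewrite /disp (_ : v - _ - _ = H (T k) (r v) - H (T k.+1) (r v)); last first.
      by rewrite opprB addrC addrA subrK.
    exact: eighth_le_quarter h ep0.
  - move=> k v v' kn Kv dv vv.
    apply: (Kkappa (H (T k) (r v))); first by apply: HX; [exact: IT | exact: rX].
    rewrite (_ : v' - _ = (v' - v) + disp k v); last by rewrite /disp addrA subrK.
    by apply: le_trans (ler_normD _ _) _; exact: add_quarters vv dv epk eta_k.
  - move=> k v v' kn Kv Kv' vv dv dv' l.
    by apply: step_space l => //; [exact: rX|exact: rX|exact: trace_d1|
      exact: near_delta|exact: near_delta].
  - move=> k v kn Kv dv dv'; rewrite /lab.
    have hk := near_delta k v (ltnW kn) Kv dv.
    have hk1 := near_delta k.+1 v kn Kv dv'.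
    by rewrite (label_time HX n0 nd1 unifH1 kn (rX _ Kv) hk hk1).
  - by case: afp.
  - exact: ltW.
  - by rewrite -/rho' rho'E; exact: quarter_lt_double.
  - move=> v Kv dv lv; have [h1 h2] := near_disp 0%N v (leq0n n) Kv dv.
    have fr : `|r v - f (r v)| < zf.
      have e : H (T 0%N) (r v) = f (r v) by rewrite T0; apply: H0; exact: rX.
      by rewrite -e distrC; exact: lt_le_trans h1 e3zf.
    have [y [Xy fy]] := nearf _ (rX _ Kv) fr; rewrite lt_min => /andP[ry1 ry2].
    have yp : y = p.
      apply: sep => //; rewrite -(label0 n H0 Xy fy).
      apply: step_space lv => //; [exact: rX|exact: near_delta|].
      by apply: fixed_delta; rewrite T0 H0.
    move: ry1; rewrite yp => ry1; rewrite -(subrK (r v) v) -addrA.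
    by apply: le_trans (ler_normD _ _) _; exact: add_half_quarter.
  - case: (afp1) => _ _ aff v vp; have [Xv ev] := aff v vp; split.
    + exact: XK.
    + by rewrite /disp T0 rid // H0.
    + move=> dv; have [Xp fp] := affine_fixed afp.
      rewrite /lab rid //; apply: (step_space 0%N p v) => //.
      * rewrite distrC; exact: le_lt_trans vp (le_lt_trans rho1d (half_lt d10)).
      * by apply: fixed_delta; rewrite T0 H0.
      * by rewrite -{2}(rid v Xv) -{1}(rid v Xv); apply: near_delta => //; exact: XK.
      * exists monoid.one; rewrite (label0 n H0 Xp fp) phi1 mul1g.
        by rewrite mulg1.
have [h1 h2] := near_disp n v (leqnn n) Kv dv.
have gr : `|r v - g (r v)| < zg.
  have e : H (T n) (r v) = g (r v) by rewrite Tn; apply: H1; exact: rX.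
  by rewrite -e distrC; exact: lt_le_trans h1 e3zg.
have [y [Xy gy ry]] := nearg _ (rX _ Kv) gr.
exists y; split=> //; rewrite -(labeln H1 n0 Xy gy).
apply: step_space lv => //; [exact: rX|exact: near_delta|].
by apply: fixed_delta; rewrite Tn H1.
Qed.

End Transport.

(** * The index of an affine fixed point *)

Section AffineIndex.
Variable R : realType.
Local Notation E := 'rV[R]_2.

Definition saddle_mx (a m : R) : 'M[R]_2 :=
  \matrix_(i, j) (if i == 0 then (if j == 0 then 1 else 0) else (if j == 0 then - a else m)).

Lemma saddleE a m (p v : E) : saddle a m p v = v *m saddle_mx a m - p *m saddle_mx a m.
Proof.
have l1 : lift ord0 ord0 = 1 :> 'I_2 by apply/val_inj.
rewrite -mulmxBl; apply: row2P; rewrite !mxE big_ord_recl big_ord1 !mxE /= l1.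
  by rewrite mulr1 mulrN [a * _]mulrC.
by rewrite mulr0 add0r mulrC.
Qed.

Lemma det_saddle_mx a m : \det (saddle_mx a m) = m.
Proof.
rewrite (expand_det_row _ 0) big_ord_recl big_ord1 !mxE /= mul0r addr0 mul1r.
by rewrite /cofactor /= expr0 mul1r [X in \det X]mx11_scalar det_scalar1 !mxE.
Qed.

Lemma saddle_lipschitz a m (p v w : E) :
  `|saddle a m p v - saddle a m p w| <= (1 + `|a| + `|m|) * `|v - w|.
Proof.
have [h0 h1] := norm2_coord (lexx `|v - w|); rewrite !mxE in h0 h1.
have a0 := normr_ge0 a; have m0 := normr_ge0 m; have d0 := normr_ge0 (v - w).
apply/norm2_le; rewrite !mxE /=; split.
  rewrite (_ : _ - _ = (v 0 0 - w 0 0) - a * (v 0 1 - w 0 1)); last by ring.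
  apply: le_trans (ler_normB _ _) _; rewrite normrM.
  by have := ler_wpM2l a0 h1; have := mulr_ge0 m0 d0; nra.
rewrite (_ : _ - _ = m * (v 0 1 - w 0 1)); last by ring.
by rewrite normrM; have := ler_wpM2l m0 h1; have := mulr_ge0 a0 d0; nra.
Qed.

Lemma saddle_continuous a m (p : E) : continuous (saddle a m p).
Proof.
apply/continuous_subspace_setT/within_continuousP => v _ e e0.
have c0 : 0 < 1 + `|a| + `|m| by rewrite -addrA ltr_pwDl // addr_ge0.
exists (e / (1 + `|a| + `|m|)); first by rewrite divr_gt0.
move=> w _ /ball2E vw; apply: le_lt_trans (saddle_lipschitz _ _ _ _ _) _.
by rewrite mulrC -ltr_pdivlMr.
Qed.

Lemma saddle_jacobian a m (p v : E) :
  differentiable (saddle a m p) v /\ jacobian (saddle a m p) v = saddle_mx a m.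
Proof.
pose L : {linear E -> E} := mulmxr (saddle_mx a m).
have Lc : continuous L.
  move=> x; have -> : (L : E -> E) = saddle a m 0.
    by apply/funext => y; rewrite saddleE mul0mx subr0.
  exact: saddle_continuous.
have dL : differentiable L v by apply: linear_differentiable.
have eS : saddle a m p = (L : E -> E) - cst (L p).
  by apply/funext => y; rewrite saddleE.
have dS : differentiable (saddle a m p) v.
  by rewrite eS; apply: differentiableB.
have dE : 'd (saddle a m p) v = L :> (E -> E).
  have dc : differentiable (cst (L p) : E -> E) v by apply: differentiable_cst.
  have e1 := diffB dL dc.
  have e2 := diff_lin v Lc.
  have e3 := diff_cst (L p) v.
  rewrite eS e1; apply/funext => y.
  have e2y := congr1 (fun F : E -> E => F y) e2.
  have e3y := congr1 (fun F : E -> E => F y) e3.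
  have e4 : 'd L v y - 'd (cst (L p) : E -> E) v y = L y - 0 by congr (_ - _).
  by move: e4; rewrite subr0.
split; first exact: dS.
by apply/row_matrixP => i; rewrite !rowE mul_rV_lin1 dE.
Qed.

Lemma saddle_eq0 a m (p v : E) : m != 0 -> saddle a m p v = 0 -> v = p.
Proof.
move=> m0 e; have /eqP := congr1 (fun x : E => x 0 1) e.
have /eqP := congr1 (fun x : E => x 0 0) e.
rewrite !mxE /= => h0; rewrite mulf_eq0 (negPf m0) /= subr_eq0 => /eqP h1.
by move: h0; rewrite h1 subrr mulr0 subr0 subr_eq0 => /eqP h0; apply: row2P.
Qed.

(** The bound on the boundary of the ball of radius [rho], for the maximum
    norm: either the second coordinate is large, or it is so small that the
    first one dominates the shear. *)
Lemma saddle_lower a m (p v : E) rho : 0 < rho -> `|v - p| = rho ->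
  Num.min (rho / 2) (`|m| * (rho / (2 * (1 + `|a|)))) <= `|saddle a m p v|.
Proof.
move=> r0 vp.
have a1 : 0 < 1 + `|a| by rewrite ltr_pwDl.
have /norm2_le [] := lexx `|saddle a m p v|; rewrite !mxE /= => s0 s1.
rewrite ge_min; apply/orP.
have [h|h] := leP `|v 0 1 - p 0 1| (rho / (2 * (1 + `|a|))); last first.
  right; apply: le_trans s1; rewrite normrM; apply: ler_wpM2l => //; exact: ltW.
left; apply: le_trans s0.
have aa : `|a * (v 0 1 - p 0 1)| <= rho / 2 * (`|a| / (1 + `|a|)).
  rewrite normrM; apply: le_trans (ler_wpM2l (normr_ge0 a) h) _.
  by rewrite le_eqVlt; apply/orP; left; apply/eqP; field; rewrite gt_eqF.
have v0 : `|v 0 0 - p 0 0| = rho.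
  apply/eqP; rewrite eq_le; have [] := norm2_coord (lexx `|v - p|).
  rewrite !mxE vp => -> _ /=; rewrite leNgt; apply/negP => lt0.
  suff : `|v - p| < rho by rewrite vp ltxx.
  apply/norm2_lt; rewrite !mxE; split=> //; apply: le_lt_trans h _.
  rewrite ltr_pdivrMr ?mulr_gt0 // ltr_pMr //; have := normr_ge0 a; lra.
have := lerB_dist (v 0 0 - p 0 0) (a * (v 0 1 - p 0 1)); rewrite v0.
have : rho / 2 * (`|a| / (1 + `|a|)) <= rho / 2.
  rewrite ler_piMr ?divr_ge0 ?(ltW r0) //.
  by rewrite ler_pdivrMr // mul1r lerDr.
lra.
Qed.

Lemma closed_box_closure (p : E) rho x : closure (ball p rho) x -> `|x - p| <= rho.
Proof.
have h : ball p rho `<=` [set v : E | `|p - v| <= rho].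
  by move=> v /= /ball2E /ltW.
move=> /(closureS h); rewrite distrC.
rewrite (_ : closure _ = [set v : E | `|p - v| <= rho]) //.
apply/esym/closure_id.
exact: closed_closed_ball_.
Qed.

(** The map id - f is its own smooth approximation, with a single zero in the
    ball, whose Jacobian determinant is [m]. *)
Lemma affine_has_index (X K : set E) (r f : E -> E) (kappa rho a m : R) (p : E) :
  retract_nbhd X K r kappa -> affine_fixed_point X f p rho a m ->
  has_index X f [set p] (sgz m).
Proof.
case=> Kc XK k0 [Kk cr rX rid] afp.
case: (afp) => r0 m0 aff.
have [Xp fp] := affine_fixed afp.
exists (\bigcup_(x in X) ball x kappa), r, (ball p rho).
have VK : \bigcup_(x in X) ball x kappa `<=` K.
  by move=> v [x Xx] /ball2E; rewrite distrC => /ltW; exact: Kk.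
have UX x : closure (ball p rho) x -> X x /\ x - f x = saddle a m p x.
  by move=> /closed_box_closure; exact: aff.
have sol x : closure (ball p rho) x -> x - f (r x) = saddle a m p x.
  by move=> /UX[Xx]; rewrite rid.
split.
- split; first by apply: bigcup_open => x _; exact: ball_open.
  by move=> x Xx; exists x => //; exact: ballxx.
- split=> //; first exact: continuous_subspaceW cr.
  by move=> _ [v /VK Kv <-]; exact: rX.
- by move=> x /UX[Xx _]; exists x => //; exact: ballxx.
- split; first by move=> _ ->; exact: ballxx.
  apply/seteqP; split=> [x [cx [_ fx]] | _ ->].
    have [_] := UX x cx; rewrite fx subrr => /esym e; exact: saddle_eq0 m0 e.
  by split; first by apply: subset_closure; exact: ballxx.
split.
- exact: ball_open.
- exists (`|p| + rho); split; first exact: num_real.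
  move=> M hM x /ball2E px; apply: le_trans (ltW hM).
  have := ler_normB p (p - x); rewrite opprB addrC subrK; move: px => /ltW px h.
  by apply: le_trans h _; rewrite lerD2l.
- have := continuous_subspaceT (A := closure (ball p rho)) (@saddle_continuous a m p).
  apply: subspace_eq_continuous => x; rewrite inE => cx; exact/esym/sol.
exists (saddle a m p), (Num.min (rho / 2) (`|m| * (rho / (2 * (1 + `|a|))))), [:: p].
split.
- rewrite lt_min divr_gt0 //= mulr_gt0 ?normr_gt0 // divr_gt0 // mulr_gt0 // ltr_pwDl //.
- move=> x cx nUx; rewrite sol //; apply: saddle_lower => //.
  apply/eqP; rewrite eq_le closed_box_closure //= leNgt; apply/negP => h.
  by apply: nUx; rewrite ball2E distrC.
- move=> x cx; rewrite sol // subrr normr0.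
  rewrite lt_min divr_gt0 //= mulr_gt0 ?normr_gt0 // divr_gt0 // mulr_gt0 // ltr_pwDl //.
- split; first by move=> x; case: (saddle_jacobian a m p x).
  rewrite (_ : jacobian _ = cst (saddle_mx a m)); first exact: cst_continuous.
  by apply/funext => x; case: (saddle_jacobian a m p x).
have jac x : jacobian (saddle a m p) x = saddle_mx a m.
  by case: (saddle_jacobian a m p x).
split=> //.
- move=> x; rewrite inE; split=> [/eqP ->|[_ /saddle_eq0 ->] //].
  split; first exact: ballxx.
  by apply: row2P; rewrite !mxE /= !subrr !mulr0 ?subrr.
- by move=> x _; rewrite jac det_saddle_mx.
- by rewrite big_seq1 jac det_saddle_mx.
Qed.

End AffineIndex.

Section NielsenNumber.
Local Open Scope card_scope.
Local Open Scope ring_scope.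
Variables (R : realType) (G : groupType).
Local Notation E := 'rV[R]_2.
Local Notation "x ** y" := (monoid.mul x y) (at level 40, left associativity).
Local Notation I01 := (`[0, 1]%classic : set R).
Variables (X : set E) (trans : E -> E -> G) (delta : R).
Variables (f : E -> E) (theta : E -> G) (phi : G -> G) (dtheta : R).

Hypothesis tr : transport X trans delta.
Hypothesis lf : lifts X trans f theta phi dtheta.

Lemma chain_lift (c : nat -> E) n : (forall k, (k <= n)%N -> X (c k)) ->
  (forall k, (k < n)%N -> `|c k - c k.+1| < dtheta) ->
  theta (c 0%N) ** chain trans (f \o c) n = phi (chain trans c n) ** theta (c n).
Proof.
case: (lf) => _ phiM th; elim: n => [|n IH] hX hd /=.
  by rewrite (phi1 lf) mulg1 mul1g.
have {}IH : theta (c 0%N) ** chain trans (f \o c) n = phi (chain trans c n) ** theta (c n).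
  by apply: IH => k kn; [apply: hX|apply: hd]; lia.
by rewrite mulgA IH phiM -!mulgA th //; [apply: hX; lia | apply: hX | apply: hd].
Qed.

(** Transport along a path from x to y gives the conjugating element: the
    homotopy from the path to its image identifies its transport with that of
    the image, and [lifts] turns the latter into the image under [phi]. *)
Lemma nielsen_twisted x y : nielsen_equiv X f x y ->
  twisted_equiv phi (theta x) (theta y).
Proof.
case=> c [[cc cX c0 c1] [P [Pc PX P0 P1 Pe]]].
have [delta0 _] := tr; have [dtheta0 _ _] := lf.
have I01c : compact I01 by exact: segment_compact.
have m0 : 0 < Num.min delta dtheta by rewrite lt_min delta0.
have [d d0 unifP] := compact_unif_continuous (compact_setX I01c I01c) Pc m0.
have {}unifP s t s' t' : I01 s -> I01 t -> I01 s' -> I01 t' -> `|s - s'| < d -> `|t - t'| < d ->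
    `|P s t - P s' t'| < Num.min delta dtheta.
  move=> Is It Is' It' ss tt; apply: (unifP (s, t) (s', t') (conj Is It) (conj Is' It')).
  by split; rewrite /= -ball_normE.
pose n := (Num.bound d^-1).+1.
have nd : n%:R^-1 < d.
  rewrite invf_plt ?posrE ?ltr0n //; apply: lt_le_trans (archi_boundP _) _.
    by rewrite invr_ge0 ltW.
  by rewrite ler_nat.
have n0 : (0 < n)%N by [].
clearbody n.
pose T k : R := time R n k.
have IT k : (k <= n)%N -> I01 (T k) by exact: time_I.
have Td k : `|T k - T k.+1| < d by exact: time_step.
have T0 : T 0%N = 0 by rewrite /T /time mul0r.
have Tn : T n = 1 by rewrite /T /time divff // pnatr_eq0 -lt0n.
have refl (u : R) : `|u - u| < d by rewrite subrr normr0.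
have I0 : I01 0 by rewrite /= in_itv /= lexx ler01.
have I1 : I01 1 by rewrite /= in_itv /= lexx ler01.
pose w k := chain trans (fun j => P (T k) (T j)) n.
have wS k : (k < n)%N -> w k = w k.+1.
  move=> kn; have Ik := IT k (ltnW kn); have Ik1 := IT k.+1 kn.
  have small s t s' t' : I01 s -> I01 t -> I01 s' -> I01 t' -> `|s - s'| < d ->
      `|t - t'| < d -> `|P s t - P s' t'| < delta.
    by move=> h1 h2 h3 h4 h5 h6; have := unifP s t s' t' h1 h2 h3 h4 h5 h6; rewrite lt_min => /andP[].
  have := @chain_ladder _ _ X trans delta tr (fun j => P (T k) (T j)) (fun j => P (T k.+1) (T j)) n.
  rewrite T0 Tn; case: (Pe _ Ik) => -> ->; case: (Pe _ Ik1) => -> ->.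
  have Xc0 : X (c 0) by apply: cX; exists 0.
  have Xc1 : X (c 1) by apply: cX; exists 1.
  rewrite !(trans1 tr) // mulg1 mul1g; apply.
    move=> j jn; have Ij := IT j jn.
    by split; [exact: PX|exact: PX|exact: small].
  move=> j jn; have Ij := IT j (ltnW jn); have Ij1 := IT j.+1 jn.
  by split; exact: small.
have w0n : w 0%N = w n.
  have h k : (k <= n)%N -> w 0%N = w k.
    by elim: k => // k IH kn; rewrite IH ?(ltnW kn) // wS.
  exact: h.
have e0 : w 0%N = chain trans (c \o T) n.
  by apply: eq_chain => k kn; rewrite T0 P0 //; exact: IT.
have en : w n = chain trans (f \o (c \o T)) n.
  by apply: eq_chain => k kn; rewrite Tn P1 //; exact: IT.
exists (chain trans (c \o T) n).
have := @chain_lift (c \o T) n; rewrite /= T0 Tn c0 c1 -en -w0n e0; apply.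
  by move=> k kn; apply: cX; exists (T k) => //; exact: IT.
move=> k kn; have Ik := IT k (ltnW kn); have Ik1 := IT k.+1 kn.
have := unifP 0 (T k) 0 (T k.+1) I0 Ik I0 Ik1 (refl 0) (Td k).
by rewrite !P0 // lt_min => /andP[].
Qed.

Variables (K : set E) (r : E -> E) (kappa : R) (pts : seq E).

Hypothesis nb : retract_nbhd X K r kappa.
Hypothesis Xcompact : compact X.
Hypothesis sf : selfmap X f.
Hypothesis pts_uniq : uniq pts.
Hypothesis pts_affine : forall p, p \in pts -> exists rho a m, affine_fixed_point X f p rho a m.
Hypothesis pts_all : forall x, X x -> f x = x -> x \in pts.
Hypothesis pts_sep : forall p q, p \in pts -> q \in pts ->
  twisted_equiv phi (theta p) (theta q) -> q = p.

Lemma pts_fixed p : p \in pts -> Fix X f p.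
Proof. by move=> /pts_affine[rho [a [m]]] /affine_fixed. Qed.

Let class_pts C : fixed_point_class X f C <-> exists2 p, p \in pts & C = [set p].
Proof.
have sing p : p \in pts -> [set y | Fix X f y /\ nielsen_equiv X f p y] = [set p].
  move=> pp; apply/seteqP; split=> [y [[Xy fy] /nielsen_twisted h]|_ ->].
    exact: pts_sep pp (pts_all Xy fy) h.
  have [Xp fp] := pts_fixed pp; split=> //.
  exists (cst p); split.
    by split=> //; [exact: cst_continuous | move=> _ [t _ <-]].
  exists (fun _ _ => p); split=> //=; exact: cst_continuous.
split=> [[p [Xp fp] ->]|[p pp ->]]; exists p; rewrite ?sing //; try exact: pts_all.
exact: pts_fixed.
Qed.

Let card_nth (T : Type) (F : E -> T) : {in pts &, injective F} ->
  (fun i => F (nth 0 pts i)) @` `I_(size pts) #= `I_(size pts).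
Proof.
move=> Fi; apply: inj_card_eq => i j; rewrite !inE /= => hi hj.
by move=> /Fi e; apply/eqP; rewrite -(nth_uniq 0 hi hj pts_uniq) e //; exact: mem_nth.
Qed.

Let image_nth (T : Type) (F : E -> T) :
  (fun i => F (nth 0 pts i)) @` `I_(size pts) = [set F p | p in [set p | p \in pts]].
Proof.
apply/seteqP; split=> [_ [i /= hi <-]|_ [p /= pp <-]].
  by exists (nth 0 pts i) => //=; exact: mem_nth.
by exists (index p pts); rewrite /= ?index_mem // nth_index.
Qed.

Lemma nielsen_number_pts : nielsen_number X f (size pts).
Proof.
rewrite /nielsen_number (_ : [set C | _] = [set [set p] | p in [set p | p \in pts]]).
  rewrite -image_nth; apply: card_nth => p q _ _ e.
  by have : [set p] q; [rewrite e | move=> /= ->].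
apply/seteqP; split=> [C [/class_pts[p pp ->] _]|_ [p /= pp <-]]; first by exists p.
split; first by apply/class_pts; exists p.
have [rho [a [m afp]]] := pts_affine pp.
exists (sgz m); first exact: affine_has_index nb afp.
by rewrite sgz_eq0; case: afp.
Qed.

Lemma Fix_pts : Fix X f #= `I_(size pts).
Proof.
rewrite (_ : Fix X f = [set id p | p in [set p | p \in pts]]).
  by rewrite -image_nth; apply: (@card_nth E id) => p q.
by apply/seteqP; split=> [x [Xx fx]|_ [p /= /pts_fixed h <-] //]; exists x => //; exact: pts_all.
Qed.

(** A map homotopic to [f] has, for each fixed point of [f], a fixed point in
    the same class. Distinct classes give distinct points: all classes are
    compared along the same number n of time steps, so one fixed point carries
    one class. *)
Lemma min_fix_pts : min_fix X f (size pts).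
Proof.
have [fc fX] := sf; split.
  exists f; split=> //; last exact: Fix_pts.
  exists (fun _ => f); split=> // [|t x _ Xx]; last by apply: fX; exists x.
  apply/within_continuousP => -[t x] [/= It Xx] e e0.
  have [d d0 hd] := (within_continuousP X f).1 fc x Xx e e0.
  by exists d => // -[t' y] [_ Xy] [_ xy] /=; exact: hd.
move=> g k [gc gX] [H [Hc HX H0 H1]] cg.
have per p : p \in pts -> exists n0, forall n, (n0 <= n)%N -> exists y,
    [/\ X y, g y = y & twisted_equiv phi (theta p) (theta y ** track trans H n n y)].
  move=> pp; have [rho [a [m afp]]] := pts_affine pp.
  apply: (fixed_class_persists tr lf nb Xcompact Hc HX H0 H1 fc gc afp).
  by move=> y Xy fy; exact: pts_sep pp (pts_all Xy fy).
have [n hn] : exists n, forall p, p \in pts -> exists y,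
    [/\ X y, g y = y & twisted_equiv phi (theta p) (theta y ** track trans H n n y)].
  have : forall s : seq E, {subset s <= pts} -> exists n0, forall n, (n0 <= n)%N -> forall p, p \in s -> exists y,
    [/\ X y, g y = y & twisted_equiv phi (theta p) (theta y ** track trans H n n y)].
    elim=> [|q s IH] sub; first by exists 0%N.
    have [n1 h1] := IH (fun x xs => sub x (mem_behead (s := q :: s) xs)).
    have [n2 h2] := per q (sub q (mem_head q s)).
    exists (maxn n1 n2) => n; rewrite geq_max => /andP[l1 l2] p; rewrite inE => /orP[/eqP ->|ps].
      exact: h2.
    exact: h1.
  move=> /(_ pts (fun _ => id))[n0 h]; exists n0; exact: h.
have [Y hY] : exists Y : E -> E, forall p, p \in pts ->
    [/\ X (Y p), g (Y p) = Y p & twisted_equiv phi (theta p) (theta (Y p) ** track trans H n n (Y p))].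
  have h p : exists y, p \in pts ->
     [/\ X y, g y = y & twisted_equiv phi (theta p) (theta y ** track trans H n n y)].
    by have [/hn[y hy]|_] := boolP (p \in pts); [exists y|exists p].
  by have [Y hY] := choice h; exists Y.
have Yinj : {in pts &, injective Y}.
  move=> p q pp pq e; have [_ _ [z1 e1]] := hY p pp; have [_ _ [z2 e2]] := hY q pq.
  apply/esym; apply: pts_sep pp pq _; exists (z1 ** monoid.inv z2).
  have [_ phiM _] := lf.
  have phiV u : phi (monoid.inv u) = monoid.inv (phi u).
    by apply/(@mulIg _ (phi u)); rewrite -phiM !mulVg (phi1 lf).
  rewrite phiM phiV mulgA e1 e -!mulgA; congr (_ ** _).
  by apply/(@mulgI _ (phi z2)); rewrite mulVKg [X in _ ** X]mulgA mulgA -e2 mulgK.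
have /card_eqPle[_ h1] := card_nth Yinj; have /card_eqPle[h2 _] := cg.
rewrite -card_le_II; apply: card_le_trans h1 (card_le_trans _ h2); rewrite image_nth.
apply: subset_card_le => _ [p /= pp <-].
by have [] := hY p pp.
Qed.

Theorem wecken_of_affine : wecken X f.
Proof. by exists (size pts); split; [exact: nielsen_number_pts | exact: min_fix_pts]. Qed.

End NielsenNumber.

(** * The pants as a compact neighbourhood retract *)

Section WithinReal.
Variables (R : realType) (T : pseudoMetricType R).
Implicit Types (A : set T).

Lemma within_vec2 A (u v : T -> R) : {within A, continuous u} -> {within A, continuous v} ->
  {within A, continuous (fun x => vec2 (u x) (v x))}.
Proof.
move=> /within_continuousP cu /within_continuousP cv; apply/within_continuousP => x Ax e e0.
have [d1 d10 h1] := cu x Ax e e0; have [d2 d20 h2] := cv x Ax e e0.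
exists (Num.min d1 d2); first by rewrite lt_min d10.
move=> y Ay xy; apply/norm2_lt; rewrite !mxE /=; split.
  by apply: h1 => //; apply: le_ball xy; rewrite ge_min lexx.
by apply: h2 => //; apply: le_ball xy; rewrite ge_min lexx orbT.
Qed.

End WithinReal.

Section PantsSpace.
Variable R : realType.
Local Notation E := 'rV[R]_2.

Lemma sqdist_continuous (c : R) : continuous (sqdist c : E -> R).
Proof.
have c0 : continuous (fun y : E => y 0 0) by exact: coord_continuous.
have c1 : continuous (fun y : E => y 0 1) by exact: coord_continuous.
have q0 : continuous (fun y : E => (y 0 0 - c) ^+ 2).
  move=> x; apply: (continuous_comp (f := fun y : E => y 0 0 - c) _ (@exprn_continuous _ 2 _)).
  by apply: (continuousB (c0 x)); exact: cst_continuous.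
have q1 : continuous (fun y : E => y 0 1 ^+ 2).
  by move=> x; apply: (continuous_comp (f := fun y : E => y 0 1) (c1 x) (@exprn_continuous _ 2 _)).
by move=> x; exact: continuousD (q0 x) (q1 x).
Qed.

(** The annular regions that contain the pants: [pants] is the member 5, 1. *)
Definition region (a b : R) : set E :=
  [set x | [/\ sqdist 0 x <= a, b <= sqdist 2 x & b <= sqdist (- 2) x]].

Lemma region_compact a b : compact (region a b).
Proof.
apply: bounded_closed_compact.
  exists (1 + `|a|); split; first exact: num_real.
  move=> M hM x [h _ _]; apply: le_trans (ltW hM).
  have ha := ler_norm a; have na := normr_ge0 a; move: h; rewrite /sqdist subr0 => h.
  have sq (y : R) : y ^+ 2 <= a -> `|y| <= 1 + `|a|.
    move=> hy; rewrite ler_norml; apply/andP; split; nra.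
  apply/norm2_le; split; apply: sq; apply: le_trans h; rewrite ?lerDl ?lerDr sqr_ge0 //.
rewrite (_ : region a b = [set x | sqdist 0 x <= a] `&`
    ([set x | b <= sqdist 2 x] `&` [set x | b <= sqdist (- 2) x])).
  apply: closedI; first by apply: closed_comp (@closed_le _ a) => x _; exact: sqdist_continuous.
  by apply: closedI; apply: closed_comp (@closed_ge _ b) => x _; exact: sqdist_continuous.
by apply/seteqP; split=> x [] // h1 [].
Qed.

Lemma pants_compact : compact (@pants R).
Proof. exact: region_compact. Qed.

Definition radius (c : R) (x : E) : R := Num.sqrt (sqdist c x).

Lemma sqdist_ge0 c (x : E) : 0 <= sqdist c x.
Proof. by rewrite /sqdist addr_ge0 ?sqr_ge0. Qed.

Definition push_out (c : R) (x : E) : R := (Num.min 1 (radius c x))^-1 - 1.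
Definition pull_in (x : E) : R := 5 / Num.max 5 (radius 0 x) - 1.

(** Radial projections away from the centres of the two holes and towards the
    outer circle. At most one of the three corrections is active at a point of
    the neighbourhood, so they can be added. *)
Definition retract (x : E) : E :=
  vec2 (x 0 0 + push_out 2 x * (x 0 0 - 2) + push_out (- 2) x * (x 0 0 + 2) + pull_in x * x 0 0)
       (x 0 1 + push_out 2 x * x 0 1 + push_out (- 2) x * x 0 1 + pull_in x * x 0 1).

Lemma radius_continuous c : continuous (radius c).
Proof.
move=> x; apply: (@continuous_comp _ _ _ (sqdist c) Num.sqrt); first exact: sqdist_continuous.
exact: sqrt_continuous.
Qed.

Lemma radius_ge1 c (x : E) : (1 <= radius c x) = (1 <= sqdist c x).
Proof.
by rewrite -ler_sqr ?nnegrE ?sqrtr_ge0 // expr1n sqr_sqrtr ?sqdist_ge0.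
Qed.

Lemma radius_le5 (x : E) : (radius 0 x <= 5) = (sqdist 0 x <= 5 ^+ 2).
Proof.
by rewrite -ler_sqr ?nnegrE ?sqrtr_ge0 // sqr_sqrtr ?sqdist_ge0.
Qed.

Lemma retract_id x : @pants R x -> retract x = x.
Proof.
case=> h0 h1 h2; rewrite /retract /push_out /pull_in.
rewrite !min_l ?radius_ge1 // max_l ?radius_le5 // invr1 divff // subrr !mul0r !addr0.
by apply: row2P; rewrite mxE.
Qed.

Lemma unit_vector (a b n : R) : n ^+ 2 = a ^+ 2 + b ^+ 2 -> n != 0 ->
  (a / n) ^+ 2 + (b / n) ^+ 2 = 1.
Proof.
by move=> e n0; rewrite !exprMn -mulrDl -e exprVn mulfV // expf_neq0.
Qed.

Lemma radius_sqr c (x : E) : radius c x ^+ 2 = (x 0 0 - c) ^+ 2 + x 0 1 ^+ 2.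
Proof. by rewrite sqr_sqrtr ?sqdist_ge0. Qed.

Lemma sqdist_vec2 c (a b : R) : sqdist c (vec2 a b) = (a - c) ^+ 2 + b ^+ 2.
Proof. by rewrite /sqdist !mxE. Qed.

Lemma retract_pants x : region (6 ^+ 2) 4^-1 x -> @pants R (retract x).
Proof.
case=> [h0 h1 h2].
have pos c : 4^-1 <= sqdist c x -> radius c x != 0.
  move=> hc; rewrite gt_eqF // sqrtr_gt0; apply: lt_le_trans hc.
  by rewrite invr_gt0.
have [n2 n2'] := (radius_ge1 2 x, radius_ge1 (- 2) x); have n0 := radius_le5 x.
rewrite /pants /= /retract /push_out /pull_in.
have sq0 : sqdist 0 x = x 0 0 ^+ 2 + x 0 1 ^+ 2 by rewrite /sqdist subr0.
have sq2 : sqdist 2 x = (x 0 0 - 2) ^+ 2 + x 0 1 ^+ 2 by [].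
have sq2' : sqdist (- 2) x = (x 0 0 + 2) ^+ 2 + x 0 1 ^+ 2 by rewrite /sqdist opprK.
have [l2|] := boolP (radius 2 x < 1).
  have s2 : sqdist 2 x < 1 by rewrite ltNge -n2 -ltNge.
  have s2' : 1 <= sqdist (- 2) x by nra.
  have s0 : sqdist 0 x <= 5 ^+ 2 by nra.
  rewrite (min_r (ltW l2)) min_l ?n2' // max_l ?n0 // invr1 divff // subrr !mul0r !addr0.
  have := unit_vector (radius_sqr 2 x) (pos _ h1).
  set p := _ / _; set q := _ / _ => pq.
  rewrite (_ : vec2 _ _ = vec2 (2 + p) q); last by congr vec2; rewrite /p /q; ring.
  by rewrite !sqdist_vec2; split; nra.
rewrite -leNgt => g2; have [l2'|] := boolP (radius (- 2) x < 1).
  have s2' : sqdist (- 2) x < 1 by rewrite ltNge -n2' -ltNge.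
  have s0 : sqdist 0 x <= 5 ^+ 2 by nra.
  rewrite (min_r (ltW l2')) (min_l g2) max_l ?n0 // invr1 divff // subrr !mul0r !addr0.
  have := unit_vector (radius_sqr (- 2) x) (pos _ h2).
  set p := _ / _; set q := _ / _ => pq.
  rewrite (_ : vec2 _ _ = vec2 (- 2 + p) q); last by congr vec2; rewrite /p /q; ring.
  by rewrite !sqdist_vec2; split; nra.
rewrite -leNgt => g2'; rewrite (min_l g2) (min_l g2') invr1 subrr !mul0r !addr0.
rewrite n2 in g2; rewrite n2' in g2'.
have [g0|] := boolP (5 < radius 0 x); last first.
  rewrite -leNgt => l0.
  rewrite (max_l l0) divff // subrr !mul0r !addr0 !sqdist_vec2.
  by rewrite n0 in l0; split.
rewrite (max_r (ltW g0)).
have r0 : radius 0 x != 0 by rewrite gt_eqF // (lt_trans _ g0).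
have := unit_vector (radius_sqr 0 x) r0.
set p := (x 0 0 - 0) / _; set q := x 0 1 / _ => pq.
rewrite (_ : vec2 _ _ = vec2 (5 * p) (5 * q)); last first.
  congr vec2; rewrite /p /q; ring.
by rewrite !sqdist_vec2; split; nra.
Qed.

Lemma continuous_within A (u : E -> R) : (forall x, A x -> {for x, continuous u}) ->
  {within A, continuous u}.
Proof.
move=> h; apply/subspace_continuousP => x Ax; apply: cvg_within_filter; exact: h.
Qed.

Lemma retract_continuous : {within region (6 ^+ 2) 4^-1, continuous retract}.
Proof.
have c0 : continuous (fun y : E => y 0 0) by exact: coord_continuous.
have c1 : continuous (fun y : E => y 0 1) by exact: coord_continuous.
have push c x : 4^-1 <= sqdist c x -> {for x, continuous (push_out c)}.
  move=> hc; have r0 : 0 < radius c x.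
    by rewrite sqrtr_gt0; apply: lt_le_trans hc; rewrite invr_gt0.
  have cm : {for x, continuous (fun y : E => Num.min 1 (radius c y))}.
    by apply: continuous_min; [exact: cst_continuous|exact: radius_continuous].
  apply: (@continuousB _ _ _ (fun y => (Num.min 1 (radius c y))^-1) (cst 1)).
    by apply: (continuousV _ cm); rewrite gt_eqF // lt_min ltr01.
  exact: cst_continuous.
have pull x : {for x, continuous pull_in}.
  have cm : {for x, continuous (fun y : E => Num.max 5 (radius 0 y))}.
    by apply: continuous_max; [exact: cst_continuous|exact: radius_continuous].
  apply: (@continuousB _ _ _ (fun y => 5 * (Num.max 5 (radius 0 y))^-1) (cst 1)).
    apply: (@continuousM _ _ (cst 5) (fun y => (Num.max 5 (radius 0 y))^-1)).
      exact: cst_continuous.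
    by apply: (continuousV _ cm); rewrite gt_eqF // lt_max ltr0n.
  exact: cst_continuous.
have shift (t : R) x : {for x, continuous (fun y : E => y 0 0 + t)}.
  by apply: (continuousD (c0 x)); exact: cst_continuous.
apply: within_vec2; apply: continuous_within => x [h0 h1 h2].
  have cD (u v : E -> R) : {for x, continuous u} -> {for x, continuous v} ->
     {for x, continuous (fun y => u y + v y)} by move=> cu cv; exact: continuousD cu cv.
  have cM (u v : E -> R) : {for x, continuous u} -> {for x, continuous v} ->
     {for x, continuous (fun y => u y * v y)} by move=> cu cv; exact: continuousM cu cv.
  apply: (cD _ _); [apply: (cD _ _); [apply: (cD _ _)|]|]; first exact: c0.
  - by apply: (cM _ _); [exact: push|exact: shift].
  - by apply: (cM _ _); [exact: push|exact: shift].
  - by apply: (cM _ _); [exact: pull|exact: c0].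
have cD (u v : E -> R) : {for x, continuous u} -> {for x, continuous v} ->
   {for x, continuous (fun y => u y + v y)} by move=> cu cv; exact: continuousD cu cv.
have cM (u v : E -> R) : {for x, continuous u} -> {for x, continuous v} ->
   {for x, continuous (fun y => u y * v y)} by move=> cu cv; exact: continuousM cu cv.
apply: (cD _ _); [apply: (cD _ _); [apply: (cD _ _)|]|]; first exact: c1.
- by apply: (cM _ _); [exact: push|exact: c1].
- by apply: (cM _ _); [exact: push|exact: c1].
- by apply: (cM _ _); [exact: pull|exact: c1].
Qed.

Lemma pants_retract : retract_nbhd (@pants R) (region (6 ^+ 2) 4^-1) retract 4^-1.
Proof.
split; first exact: region_compact.
- by move=> x [h0 h1 h2]; split; lra.
- by rewrite invr_gt0.
split; [|exact: retract_continuous|exact: retract_pants|exact: retract_id].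
move=> x v [h0 h1 h2] /norm2_coord; rewrite !mxE !ler_norml => -[/andP[a1 a2] /andP[b1 b2]].
move: h0 h1 h2; rewrite /region /= /sqdist subr0 opprK => h0 h1 h2.
have sq (y : R) : - 4^-1 <= y -> y <= 4^-1 -> y ^+ 2 <= 16^-1 by move=> ? ?; nra.
have sa := sq _ a1 a2; have sb := sq _ b1 b2.
rewrite (_ : v 0 0 = x 0 0 + (v 0 0 - x 0 0)); last by rewrite addrC subrK.
rewrite (_ : v 0 1 = x 0 1 + (v 0 1 - x 0 1)); last by rewrite addrC subrK.
move: (v 0 0 - x 0 0) (v 0 1 - x 0 1) sa sb => d e sa sb; move: (x 0 0) (x 0 1) h0 h1 h2 => p q h0 h1 h2.
clear a1 a2 b1 b2 sq.
split.
- have := sqr_ge0 (p - 5 * d); have := sqr_ge0 (q - 5 * e); lra.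
- have := sqr_ge0 (p - 2 + 2 * d); have := sqr_ge0 (q + 2 * e); lra.
- have := sqr_ge0 (p + 2 + 2 * d); have := sqr_ge0 (q + 2 * e); lra.
Qed.

End PantsSpace.

(** * Polygonal loops in the pants *)

Section Loops.
Variable R : realType.
Local Notation E := 'rV[R]_2.
Implicit Types (u t : R) (i : bool) (l : letter) (w : word).

Definition sg i : R := if i then -1 else 1.

Definition loop_x u : R := Num.min (8 * u) (8 - 8 * u).
Definition loop_y u : R := Num.max (- (8 * u)) (Num.min (8 * u - 4) (8 - 8 * u)).

(** The squares with vertices 0, (2, -2), (4, 0), (2, 2) and their opposites:
    polygonal models of the generators, on which the height is affine in the
    parameter inside the arm. *)
Definition side i u : E := vec2 (sg i * loop_x u) (sg i * loop_y u).

Definition side_path l u : E := side l.1 (if l.2 then 1 - u else u).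

Definition poly_loop w : R -> E := foldr (fun l c => path_cat (side_path l) c) (cst (base R)) w.

Lemma sg_sqr i : sg i * sg i = 1.
Proof. by case: i; rewrite /sg ?mulrNN mulr1. Qed.

Lemma sg_sgM i x : sg i * (sg i * x) = x.
Proof. by rewrite mulrA sg_sqr mul1r. Qed.

Lemma norm_sg i x : `|sg i * x| = `|x|.
Proof. by rewrite normrM; case: i; rewrite /sg ?normrN normr1 mul1r. Qed.

Lemma loop_cases u : 0 <= u <= 1 ->
  [\/ u <= 4^-1 /\ (loop_x u = 8 * u /\ loop_y u = - (8 * u)),
      4^-1 <= u <= 2^-1 /\ (loop_x u = 8 * u /\ loop_y u = 8 * u - 4),
      2^-1 <= u <= 3 / 4 /\ (loop_x u = 8 - 8 * u /\ loop_y u = 8 * u - 4) |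
      3 / 4 <= u /\ (loop_x u = 8 - 8 * u /\ loop_y u = 8 - 8 * u)].
Proof.
move=> /andP[u0 u1]; rewrite /loop_x /loop_y.
have [h1|h1] := leP u 4^-1.
  constructor 1; rewrite min_l; last by lra.
  by rewrite min_l ?max_l; lra.
have [h2|h2] := leP u 2^-1.
  constructor 2; rewrite (min_l (_ : 8 * u <= _)); last by lra.
  by rewrite (min_l (_ : 8 * u - 4 <= _)) ?max_r; lra.
have [h3|h3] := leP u (3 / 4).
  constructor 3; rewrite (min_r (_ : _ <= 8 * u)); last by lra.
  by rewrite (min_l (_ : 8 * u - 4 <= _)) ?max_r; lra.
constructor 4; rewrite (min_r (_ : _ <= 8 * u)); last by lra.
by rewrite (min_r (_ : _ <= 8 * u - 4)) ?max_r; lra.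
Qed.

Lemma side_pants i u : 0 <= u <= 1 -> @pants R (side i u).
Proof.
move=> u01; have e x y : @pants R (vec2 x y) <->
    [/\ x ^+ 2 + y ^+ 2 <= 25, 1 <= (x - 2) ^+ 2 + y ^+ 2 & 1 <= (x + 2) ^+ 2 + y ^+ 2].
  rewrite /pants /= !sqdist_vec2 subr0 opprK; have -> : (5 : R) ^+ 2 = 25 by rewrite -natrX.
  by [].
apply/e; case/andP: (u01) => u0 u1.
suff [h1 h2 h3] : [/\ loop_x u ^+ 2 + loop_y u ^+ 2 <= 25,
    1 <= (loop_x u - 2) ^+ 2 + loop_y u ^+ 2 & 1 <= (loop_x u + 2) ^+ 2 + loop_y u ^+ 2].
  by case: i; rewrite /sg ?mul1r ?mulN1r ?sqrrN; split; nra.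
have h (s : R) : 0 <= s <= 4 -> [/\ s ^+ 2 + (s - 4) ^+ 2 <= 25, 1 <= (s - 2) ^+ 2 + (s - 4) ^+ 2 &
    1 <= (s + 2) ^+ 2 + (s - 4) ^+ 2].
  move=> /andP[s0 s4]; have := mulr_ge0 s0 (_ : 0 <= 4 - s); rewrite subr_ge0 => /(_ s4) m.
  have := sqr_ge0 (s - 3); have := sqr_ge0 (s - 1).
  by split; lra.
have h' (s : R) : 0 <= s <= 2 -> [/\ s ^+ 2 + s ^+ 2 <= 25, 1 <= (s - 2) ^+ 2 + s ^+ 2 &
    1 <= (s + 2) ^+ 2 + s ^+ 2].
  move=> /andP[s0 s4]; have := mulr_ge0 s0 (_ : 0 <= 2 - s); rewrite subr_ge0 => /(_ s4) m.
  have := sqr_ge0 (s - 1); have := sqr_ge0 s.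
  by split; lra.
case: (loop_cases u01) => -[hu [-> ->]].
- by rewrite sqrrN; apply: h'; lra.
- by apply: h; lra.
- by rewrite (_ : 8 * u - 4 = - ((8 - 8 * u) - 4)) ?sqrrN; [apply: h; lra | ring].
- by apply: h'; lra.
Qed.

Lemma side0 i : side i 0 = base R.
Proof.
rewrite /side; have h : 0 <= (0 : R) <= 1 by rewrite lexx ler01.
by case: (loop_cases h) => -[h' [-> ->]]; apply: row2P; rewrite !mxE /=; first
  [by rewrite !(mulr0, oppr0) | lra].
Qed.

Lemma side1 i : side i 1 = base R.
Proof.
rewrite /side; have h : 0 <= (1 : R) <= 1 by rewrite lexx ler01.
case: (loop_cases h) => -[h' [-> ->]]; apply: row2P; rewrite !mxE /=; try lra.
all: by rewrite mulr1 subrr mulr0.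
Qed.

Lemma min_lip (a b a' b' e : R) : `|a - a'| <= e -> `|b - b'| <= e ->
  `|Num.min a b - Num.min a' b'| <= e.
Proof.
rewrite !ler_norml => /andP[h1 h2] /andP[h3 h4].
by case: (leP a b) => ?; case: (leP a' b') => ?; apply/andP; split; lra.
Qed.

Lemma max_lip (a b a' b' e : R) : `|a - a'| <= e -> `|b - b'| <= e ->
  `|Num.max a b - Num.max a' b'| <= e.
Proof.
rewrite !ler_norml => /andP[h1 h2] /andP[h3 h4].
by case: (leP a b) => ?; case: (leP a' b') => ?; apply/andP; split; lra.
Qed.

Lemma side_lip i u u' : `|side i u - side i u'| <= 8 * `|u - u'|.
Proof.
have e8 : `|8 * u - 8 * u'| <= 8 * `|u - u'| by rewrite -mulrBr normrM ger0_norm.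
have e1 : `|(8 - 8 * u) - (8 - 8 * u')| <= 8 * `|u - u'|.
  by rewrite (_ : _ - _ = - (8 * u - 8 * u')) ?normrN //; ring.
have e2 : `|(8 * u - 4) - (8 * u' - 4)| <= 8 * `|u - u'|.
  by rewrite (_ : _ - _ = 8 * u - 8 * u') //; ring.
have e3 : `|- (8 * u) - - (8 * u')| <= 8 * `|u - u'|.
  by rewrite -opprD normrN.
apply/norm2_le; rewrite !mxE /= -!mulrBr !norm_sg; split; first exact: min_lip.
by apply: max_lip => //; exact: min_lip.
Qed.

Lemma side_path_pants l u : 0 <= u <= 1 -> @pants R (side_path l u).
Proof. by move=> /andP[u0 u1]; apply: side_pants; case: ifP => _; lra. Qed.

Lemma side_path_lip l u u' : `|side_path l u - side_path l u'| <= 8 * `|u - u'|.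
Proof.
apply: le_trans (side_lip _ _ _) _; case: ifP => // _.
by rewrite (_ : _ - _ = - (u - u')) ?normrN //; ring.
Qed.

Lemma side_path0 l : side_path l 0 = base R.
Proof. by rewrite /side_path; case: ifP; rewrite ?subr0 ?side0 ?side1. Qed.

Lemma side_path1 l : side_path l 1 = base R.
Proof. by rewrite /side_path; case: ifP; rewrite ?subrr ?side0 ?side1. Qed.

Lemma base_pants : @pants R (base R).
Proof. by have := @side_pants false 0; rewrite side0; apply; rewrite lexx ler01. Qed.

Lemma poly_loop_cons l w t : poly_loop (l :: w) t =
  if t <= 2^-1 then side_path l (2 * t) else poly_loop w (2 * t - 1).
Proof. by []. Qed.

Lemma poly_loop0 w : poly_loop w 0 = base R.
Proof. by case: w => // l w; rewrite poly_loop_cons invr_ge0 ler0n mulr0 side_path0. Qed.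

Lemma poly_loop1 w : poly_loop w 1 = base R.
Proof.
elim: w => // l w IH; rewrite poly_loop_cons ifF; last by apply/negbTE; rewrite -ltNge; lra.
by rewrite (_ : 2 * 1 - 1 = 1) //; ring.
Qed.

Lemma poly_loop_half l w : poly_loop (l :: w) 2^-1 = base R.
Proof. by rewrite poly_loop_cons lexx divff // side_path1. Qed.

Lemma poly_loop_snd l w t : 2^-1 <= t -> poly_loop (l :: w) t = poly_loop w (2 * t - 1).
Proof.
rewrite le_eqVlt => /orP[/eqP <-|h].
  by rewrite poly_loop_half divff // subrr poly_loop0.
by rewrite poly_loop_cons leNgt h.
Qed.

Lemma poly_loop_pants w t : 0 <= t <= 1 -> @pants R (poly_loop w t).
Proof.
elim: w t => [|l w IH] t /andP[t0 t1]; first exact: base_pants.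
rewrite poly_loop_cons; case: ifP => h; first by apply: side_path_pants; lra.
by apply: IH; move/negbT: h; rewrite -ltNge => h; lra.
Qed.

Definition loop_lip w : R := 8 * 2 ^+ size w.

Lemma loop_lip_gt0 w : 0 < loop_lip w. Proof. by rewrite mulr_gt0 // exprn_gt0. Qed.

Lemma loop_lip_cons l w : loop_lip (l :: w) = 2 * loop_lip w.
Proof. by rewrite /loop_lip /= exprS; ring. Qed.

Lemma loop_lip_ge8 w : 8 <= loop_lip w.
Proof. by rewrite /loop_lip ler_peMr // exprn_ege1 // ler1n. Qed.

(** Concatenation doubles the speed of each of its parts, hence the constant
    [loop_lip]. *)
Lemma poly_loop_lip w t t' :
  `|poly_loop w t - poly_loop w t'| <= loop_lip w * `|t - t'|.
Proof.
elim: w t t' => [|l w IH] t t'.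
  by rewrite subrr normr0 mulr_ge0 // ltW // loop_lip_gt0.
wlog tt : t t' / t <= t'.
  by move=> h; case: (leP t t') => [/h //|/ltW/h]; rewrite distrC [`|t' - t|]distrC.
have d0 : 0 <= t' - t by rewrite subr_ge0.
have L8 := loop_lip_ge8 w.
have fst (x y : R) : x <= y -> `|side_path l (2 * x) - side_path l (2 * y)| <= loop_lip (l :: w) * (y - x).
  move=> xy; apply: le_trans (side_path_lip _ _ _) _.
  rewrite -mulrBr normrM (ger0_norm (ler0n _ 2)) distrC ger0_norm ?subr_ge0 // loop_lip_cons.
  have := ler_wpM2r (_ : 0 <= y - x) L8; rewrite subr_ge0 => /(_ xy); lra.
have snd (x y : R) : x <= y -> `|poly_loop w (2 * x - 1) - poly_loop w (2 * y - 1)| <= loop_lip (l :: w) * (y - x).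
  move=> xy; apply: le_trans (IH _ _) _.
  rewrite (_ : 2 * x - 1 - _ = - (2 * (y - x))); last by ring.
  rewrite normrN normrM (ger0_norm (ler0n _ 2)) ger0_norm ?subr_ge0 // loop_lip_cons; lra.
rewrite distrC [`|t - t'|]distrC (ger0_norm d0) distrC.
have [h|h] := leP t' 2^-1.
  by rewrite !poly_loop_cons h (le_trans tt h); exact: fst.
have [h'|h'] := leP 2^-1 t.
  by rewrite !poly_loop_snd ?(ltW h) //; exact: snd.
rewrite -(subrK (poly_loop (l :: w) 2^-1) (poly_loop (l :: w) t)) -addrA.
apply: le_trans (ler_normD _ _) _.
rewrite (_ : t' - t = (2^-1 - t) + (t' - 2^-1)); last by ring.
rewrite mulrDr; apply: lerD.
  by rewrite !poly_loop_cons lexx (ltW h'); exact: fst (ltW h').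
by rewrite !poly_loop_snd ?(ltW h) //; exact: snd (ltW h).
Qed.

End Loops.

(** * Transport along paths in the pants *)

Section PantsTransport.
Variable R : realType.
Local Notation E := 'rV[R]_2.
Local Notation "x ** y" := (monoid.mul x y) (at level 40, left associativity).
Local Notation "x ^^-1" := (monoid.inv x) (at level 3).
Implicit Types (u t : R) (i : bool) (l : letter) (w : word) (x y z : E).

(** The part of the pants on the far side of the centre of the hole [i]. For
    [i] the hole of the second generator, [sg] reflects the picture in the
    origin. *)
Definition arm i x : bool := 2 <= sg R i * x 0 0.
Definition height i x : R := sg R i * x 0 1.
Definition above i x : bool := 3 / 4 < height i x.

Definition gen i : free2 := grp [:: (i, false)].
Definition crossing i (b : bool) : free2 := if b then gen i else monoid.one.

(** Crossing the cut at height 3/4 in the arm [i] upwards counts as the generator [i]. *)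
Definition trans x y : free2 :=
  if arm false x && arm false y then
    (crossing false (above false x))^^-1 ** crossing false (above false y)
  else if arm true x && arm true y then
    (crossing true (above true x))^^-1 ** crossing true (above true y)
  else monoid.one.

Lemma arm_disjoint i x : arm i x -> arm (~~ i) x = false.
Proof. by rewrite /arm; case: i; rewrite /sg /= ?mul1r ?mulN1r => h; apply/negbTE; lra. Qed.

Lemma trans_arm i x y : arm i x -> arm i y ->
  trans x y = (crossing i (above i x))^^-1 ** crossing i (above i y).
Proof.
case: i => hx hy; rewrite /trans; last by rewrite hx hy.
by rewrite (arm_disjoint hx) /= hx hy.
Qed.

Lemma trans_out x y : (forall i, ~~ (arm i x && arm i y)) -> trans x y = monoid.one.
Proof. by move=> h; rewrite /trans (negPf (h false)) (negPf (h true)). Qed.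

Lemma near_coords i x y e : `|x - y| < e ->
  `|sg R i * x 0 0 - sg R i * y 0 0| < e /\ `|height i x - height i y| < e.
Proof. by move=> /norm2_lt; rewrite !mxE -!mulrBr !norm_sg. Qed.

Lemma pants_arm i x : @pants R x -> 1 <= (sg R i * x 0 0 - 2) ^+ 2 + height i x ^+ 2.
Proof.
case=> _ h1 h2; rewrite /height exprMn (expr2 (sg R i)) sg_sqr mul1r.
by case: i; rewrite /sg ?mulN1r ?mul1r //; rewrite /sqdist opprK in h2; rewrite -opprD sqrrN.
Qed.

(** The mouth of an arm is split in two by the hole. *)
Lemma arm_mouth i x y : @pants R x -> arm i x -> ~~ arm i y -> `|x - y| < 4^-1 ->
  height i x < - (9 / 10) \/ 9 / 10 < height i x.
Proof.
move=> Px ax ay /(near_coords i)[]; rewrite ltr_norml => /andP[h1 h2] _.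
have := pants_arm i Px; move: ax ay; rewrite /arm -ltNge => ax ay.
set s := sg R i * x 0 0 in h1 h2 ax *; set h := height i x => hh.
have s2 : (s - 2) ^+ 2 < 16^-1 by nra.
have [?|?] := leP h (- (9 / 10)); last by right; nra.
by left; nra.
Qed.

Lemma above_near i x y : height i x < - (9 / 10) \/ 9 / 10 < height i x ->
  height i y < - (9 / 10) \/ 9 / 10 < height i y -> `|x - y| < 4^-1 -> above i x = above i y.
Proof.
move=> hx hy /(near_coords i)[_]; rewrite ltr_norml => /andP[h1 h2]; rewrite /above.
by apply/idP/idP; case: hx hy => hx [] hy; lra.
Qed.

Lemma trans_mouth x y z : @pants R x -> @pants R y ->
  (forall i, ~~ [&& arm i x, arm i y & arm i z]) ->
  `|x - y| < 4^-1 -> `|x - z| < 4^-1 -> `|y - z| < 4^-1 -> trans x y = monoid.one.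
Proof.
move=> Px Py h xy xz yz.
have [[i /andP[ax ay]]|no] := pselect (exists i, arm i x && arm i y); last first.
  by apply: trans_out => i; apply/negP => a; apply: no; exists i.
have az : ~~ arm i z by have := h i; rewrite ax ay.
rewrite (trans_arm ax ay) (above_near (arm_mouth Px ax az xz) (arm_mouth Py ay az yz) xy).
by rewrite mulVg.
Qed.

(** Inside an arm the cocycle identity is a cancellation. Near the mouth,
    where a step may enter or leave the arm, no crossing is counted because
    the hole keeps the mouth away from the height 3/4 of the cut. *)
Lemma pants_transport : transport (@pants R) trans 4^-1.
Proof.
split; first by rewrite invr_gt0.
move=> x y z Px Py Pz xy yz xz.
have [[i /and3P[ax ay az]]|no] := pselect (exists i, [&& arm i x, arm i y & arm i z]).
  by rewrite (trans_arm ax ay) (trans_arm ay az) (trans_arm ax az) -mulgA mulVKg.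
have h i : ~~ [&& arm i x, arm i y & arm i z] by apply/negP => a; apply: no; exists i.
have zy : `|z - y| < 4^-1 by rewrite distrC.
have yx : `|y - x| < 4^-1 by rewrite distrC.
have zx : `|z - x| < 4^-1 by rewrite distrC.
rewrite (trans_mouth Px Py h xy xz yz) mul1g.
rewrite (trans_mouth Py Pz _ yz yx zx) ?(trans_mouth Px Pz _ xz xy zy) // => i.
  by have := h i; apply: contra => /and3P[-> -> ->].
by have := h i; apply: contra => /and3P[-> -> ->].
Qed.

(** The value of the lift along one side path: the cut at height 3/4 is met at
    the parameter u with 8 * u - 4 = 3 / 4, that is u = 19 / 32. *)
Definition side_word l u : free2 :=
  if l.2 then (gen l.1)^^-1 ** crossing l.1 (19 / 32 < 1 - u) else crossing l.1 (19 / 32 < u).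

(** The group element read by [poly_loop] up to time t. *)
Fixpoint loop_word w t : free2 :=
  if w is l :: w' then
    if t <= 2^-1 then side_word l (2 * t) else grp [:: l] ** loop_word w' (2 * t - 1)
  else monoid.one.

Lemma side_arm i u : 0 <= u <= 1 -> arm i (side i u) = (4^-1 <= u <= 3 / 4).
Proof.
move=> u01; rewrite /arm /side vec2_0 sg_sgM; case/andP: (u01) => u0 u1.
by case: (loop_cases u01) => -[hu [-> _]]; apply/idP/idP => h; try lra;
  apply/andP; split; lra.
Qed.

Lemma side_arm_other i j u : 0 <= u <= 1 -> i != j -> arm j (side i u) = false.
Proof.
move=> u01 ij; rewrite /arm /side vec2_0; case/andP: (u01) => u0 u1; apply/negbTE.
have h : 0 <= loop_x u by case: (loop_cases u01) => -[hu [-> _]]; lra.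
rewrite -ltNge; case: i j ij => [] [] // _; rewrite /sg ?mul1r ?mulN1r; lra.
Qed.

Lemma side_height i u : 4^-1 <= u <= 3 / 4 -> height i (side i u) = 8 * u - 4.
Proof.
move=> /andP[h1 h2]; rewrite /height /side vec2_1 sg_sgM.
have u01 : 0 <= u <= 1 by lra.
by case: (loop_cases u01) => -[hu [_ ->]]; lra.
Qed.

Lemma side_trans i u u' : 0 <= u <= 1 -> 0 <= u' <= 1 -> `|u - u'| < 32^-1 ->
  crossing i (19 / 32 < u) ** trans (side i u) (side i u') = crossing i (19 / 32 < u').
Proof.
move=> h h'; rewrite ltr_norml => /andP[d1 d2].
have [/andP[a a']|na] := boolP ((4^-1 <= u <= 3 / 4) && (4^-1 <= u' <= 3 / 4)).
  have e v : 4^-1 <= v <= 3 / 4 -> above i (side i v) = (19 / 32 < v).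
    by move=> hv; rewrite /above side_height //; apply/idP/idP; lra.
  by rewrite (@trans_arm i) ?side_arm // !e // mulVKg.
rewrite trans_out => [|j].
  rewrite mulg1; congr crossing; apply/idP/idP => c;
    by apply: contraNT na; rewrite -leNgt => c'; apply/andP; split; lra.
have [->|ij] := eqVneq j i; first by rewrite !side_arm.
by rewrite side_arm_other // eq_sym.
Qed.

Lemma side_path_trans l u u' : 0 <= u <= 1 -> 0 <= u' <= 1 -> `|u - u'| < 32^-1 ->
  side_word l u ** trans (side_path l u) (side_path l u') = side_word l u'.
Proof.
move=> h h' d; rewrite /side_word /side_path; case: ifP => _; last exact: side_trans.
rewrite -mulgA side_trans //; [lra | lra |].
by rewrite (_ : _ - _ = - (u - u')) ?normrN //; ring.
Qed.

Lemma side_word0 l : side_word l 0 = monoid.one.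
Proof.
rewrite /side_word subr0 (_ : (19 / 32 < 1) = true); last by lra.
by rewrite (_ : (19 / 32 < 0 :> R) = false) ?mulVg; [case: ifP|apply/negbTE; lra].
Qed.

Lemma side_word1 l : side_word l 1 = grp [:: l].
Proof.
rewrite /side_word subrr (_ : (19 / 32 < 1 :> R) = true); last by lra.
rewrite (_ : (19 / 32 < 0 :> R) = false); last by apply/negbTE; lra.
by case: l => i [] /=; rewrite ?mulg1 // -grp_inv_letter.
Qed.

Lemma loop_word0 w : loop_word w 0 = monoid.one.
Proof. by case: w => //= l w; rewrite invr_ge0 ler0n mulr0 side_word0. Qed.

Lemma loop_word_snd l w t : 2^-1 <= t ->
  loop_word (l :: w) t = grp [:: l] ** loop_word w (2 * t - 1).
Proof.
rewrite le_eqVlt => /orP[/eqP <-|h] /=.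
  by rewrite lexx divff // side_word1 subrr loop_word0 mulg1.
by rewrite leNgt h.
Qed.

Lemma loop_word_fst l w t : t <= 2^-1 -> loop_word (l :: w) t = side_word l (2 * t).
Proof. by move=> /= ->. Qed.

Lemma loop_word1 w : loop_word w 1 = grp w.
Proof.
elim: w => // l w IH; rewrite loop_word_snd; last by lra.
by rewrite (_ : 2 * 1 - 1 = 1) ?IH -?grp_cons //; ring.
Qed.

Lemma poly_loop_fst l w t : t <= 2^-1 -> poly_loop (l :: w) t = side_path l (2 * t).
Proof. by rewrite poly_loop_cons => ->. Qed.

Lemma loop_word_trans w t t' : 0 <= t <= 1 -> 0 <= t' <= 1 ->
  `|t - t'| < (4 * loop_lip R w)^-1 ->
  loop_word w t ** trans (poly_loop w t) (poly_loop w t') = loop_word w t'.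
Proof.
elim: w t t' => [|l w IH] t t' ht ht' d.
  by rewrite mul1g (trans1 pants_transport) //; exact: base_pants.
have L0 := loop_lip_gt0 R w; have L8 := loop_lip_ge8 R w.
have LC := loop_lip_cons R l w.
have d64 : (4 * loop_lip R (l :: w))^-1 <= 64^-1.
  by rewrite lef_pV2 ?posrE ?LC; nra.
have dM (x y : R) : `|x - y| < (4 * loop_lip R (l :: w))^-1 ->
    `|2 * x - 2 * y| < 32^-1 /\ `|(2 * x - 1) - (2 * y - 1)| < (4 * loop_lip R w)^-1.
  move=> xy; rewrite (_ : 2 * x - 1 - _ = 2 * x - 2 * y); last by ring.
  rewrite -mulrBr normrM (ger0_norm (ler0n _ 2)); split; first by lra.
  rewrite (_ : (4 * loop_lip R w)^-1 = 2 * (4 * loop_lip R (l :: w))^-1); last first.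
    by rewrite LC; field; rewrite gt_eqF.
  by rewrite ltr_pM2l.
have fst (x y : R) : 0 <= x <= 2^-1 -> 0 <= y <= 2^-1 -> `|x - y| < (4 * loop_lip R (l :: w))^-1 ->
    loop_word (l :: w) x ** trans (poly_loop (l :: w) x) (poly_loop (l :: w) y) = loop_word (l :: w) y.
  move=> /andP[x0 x1] /andP[y0 y1] /dM[xy _]; rewrite !loop_word_fst // !poly_loop_fst //.
  by apply: side_path_trans => //; lra.
have snd (x y : R) : 2^-1 <= x <= 1 -> 2^-1 <= y <= 1 -> `|x - y| < (4 * loop_lip R (l :: w))^-1 ->
    loop_word (l :: w) x ** trans (poly_loop (l :: w) x) (poly_loop (l :: w) y) = loop_word (l :: w) y.
  move=> /andP[x0 x1] /andP[y0 y1] /dM[_ xy]; rewrite !loop_word_snd // !poly_loop_snd //.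
  by rewrite -mulgA IH //; lra.
have close (x y : R) : `|x - y| < (4 * loop_lip R (l :: w))^-1 ->
    `|poly_loop (l :: w) x - poly_loop (l :: w) y| < 4^-1.
  move=> xy; apply: le_lt_trans (poly_loop_lip _ _ _) _.
  have L0' := loop_lip_gt0 R (l :: w).
  by rewrite mulrC -ltr_pdivlMr // -invfM.
have P (x : R) : 0 <= x <= 1 -> @pants R (poly_loop (l :: w) x) by exact: poly_loop_pants.
have cocycle (x : R) : 0 <= x <= 1 -> `|t - x| < (4 * loop_lip R (l :: w))^-1 ->
    `|x - t'| < (4 * loop_lip R (l :: w))^-1 ->
    trans (poly_loop (l :: w) t) (poly_loop (l :: w) t') =
    trans (poly_loop (l :: w) t) (poly_loop (l :: w) x) ** trans (poly_loop (l :: w) x) (poly_loop (l :: w) t').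
  move=> hx h1 h2; apply/esym.
  by case: pants_transport => _; apply; [exact: P|exact: P|exact: P|exact: close|exact: close|exact: close].
have half : 0 <= 2^-1 :> R /\ 2^-1 <= 1 :> R by split; lra.
have {}half : 0 <= (2^-1 : R) <= 1 by case: half => -> ->.
case/andP: (ht) => t0 t1; case/andP: (ht') => t0' t1'; move: (d); rewrite ltr_norml => /andP[d1 d2].
have [h|h] := leP t 2^-1; have [h'|h'] := leP t' 2^-1.
- by apply: fst => //; lra.
- have e1 : `|t - 2^-1| < (4 * loop_lip R (l :: w))^-1 by rewrite ltr_norml; lra.
  have e2 : `|2^-1 - t'| < (4 * loop_lip R (l :: w))^-1 by rewrite ltr_norml; lra.
  by rewrite (cocycle _ half e1 e2) mulgA fst ?snd //; lra.
- have e1 : `|t - 2^-1| < (4 * loop_lip R (l :: w))^-1 by rewrite ltr_norml; lra.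
  have e2 : `|2^-1 - t'| < (4 * loop_lip R (l :: w))^-1 by rewrite ltr_norml; lra.
  by rewrite (cocycle _ half e1 e2) mulgA snd ?fst //; lra.
- by apply: snd => //; lra.
Qed.

End PantsTransport.

(** * A selfmap of the pants through two loops *)

Section HitTimes.
Variable R : realType.
Local Notation "x ** y" := (monoid.mul x y) (at level 40, left associativity).
Implicit Types (c e t u : R) (i : bool) (l : letter) (w : word).

(** The time at which the loop, while it runs along its k-th letter, is at the height
    [c + e * t] of a slowly rising line. *)
Fixpoint hit_time w c e (k : nat) : R :=
  match w, k with
  | [::], _ => 0
  | l :: _, 0%N => if l.2 then (4 - c) / (16 + e) else (c + 4) / (16 - e)
  | _ :: w', k'.+1 => (1 + hit_time w' (c + e / 2) (e / 2) k') / 2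
  end.

(** Fixed points solve height (poly_loop t) = height, where the height is the
    affine function 1/4 + t / 2 of t. Restricting to the second half of the
    loop turns the line c + e * t into the line (c + e/2) + (e/2) * t, whence
    this family, stable under halving. *)
Definition slow_line c e := [/\ 4^-1 <= c, 0 < e & c + e <= 3 / 4].

Lemma slow_line_half c e : slow_line c e -> slow_line (c + e / 2) (e / 2).
Proof. by case=> h1 h2 h3; split; lra. Qed.

(** On its ascending edge the loop has height 16 * t - 4; the backward loop
    has height 4 - 16 * t. *)
Lemma hit_time_head l c e : slow_line c e -> forall w, let t := hit_time (l :: w) c e 0 in
  [/\ 3 / 16 < t, t < 19 / 64 &
      c + e * t = if l.2 then 4 - 16 * t else 16 * t - 4].
Proof.
case=> h1 h2 h3 w /=; case: ifP => _.
  have p : 0 < 16 + e by lra.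
  have hq : (4 - c) / (16 + e) * (16 + e) = 4 - c by rewrite divfK // gt_eqF.
  split; last by lra.
    by rewrite ltr_pdivlMr //; lra.
  by rewrite ltr_pdivrMr //; lra.
have p : 0 < 16 - e by lra.
have hq : (c + 4) / (16 - e) * (16 - e) = c + 4 by rewrite divfK // gt_eqF.
split; last by lra.
  by rewrite ltr_pdivlMr //; lra.
by rewrite ltr_pdivrMr //; lra.
Qed.

Definition occurrence i w (k : nat) := (k < size w)%N && ((nth (i, false) w k).1 == i).

Lemma hit_time_I i w c e k : slow_line c e -> occurrence i w k -> 0 < hit_time w c e k < 1.
Proof.
elim: w c e k => [|l w IH] c e [|k] ce //= ock.
  by have [] := hit_time_head l ce w; rewrite [hit_time _ _ _ _]/= => *; lra.
by have := IH _ _ k (slow_line_half ce) ock => /andP[? ?]; lra.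
Qed.

Lemma side_upper i u : 2^-1 <= u <= 3 / 4 ->
  side i u = vec2 (sg R i * (4 - (8 * u - 4))) (sg R i * (8 * u - 4)).
Proof.
move=> /andP[h1 h2]; have u01 : 0 <= u <= 1 by lra.
rewrite /side; congr vec2; congr (_ * _); by case: (loop_cases u01) => -[h [e1 e2]]; lra.
Qed.

(** In the arm, on its upper edge the loop moves along the diagonal of slope
    -1, so one parameter [y] describes the point; the loop is at least 16
    times as fast as the line, which keeps the fixed point isolated. *)
Lemma hit_time_local i w c e k : slow_line c e -> occurrence i w k ->
  exists M rho : R, [/\ 16 <= `|M|, 0 < rho &
    forall t, `|t - hit_time w c e k| <= rho ->
      let y := c + e * hit_time w c e k + M * (t - hit_time w c e k) in
      poly_loop w t = vec2 (sg R i * (4 - y)) (sg R i * y)].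
Proof.
elim: w c e k => [|l w IH] c e k ce //; case: k => [|k] ock.
  have [h1 h2 h3] := hit_time_head l ce w.
  move: (hit_time (l :: w) c e 0) h1 h2 h3 => t0 h1 h2 h3.
  have li : l.1 = i by case/andP: ock => _ /eqP.
  exists (if l.2 then -16 else 16), 64^-1; split.
  - by case: ifP; rewrite ?normrN ger0_norm.
  - by rewrite invr_gt0.
  move=> t; rewrite ler_norml => /andP[d1 d2] y; rewrite /y.
  rewrite poly_loop_fst; last by lra.
  have [c1 c2 c3] := ce; have et : 0 < e * t0 by rewrite mulr_gt0 //; lra.
  rewrite /side_path li; case: ifP h3 => _ h3; rewrite h3.
    by rewrite side_upper; [congr vec2; congr (_ * _); ring | lra].
  by rewrite side_upper; [congr vec2; congr (_ * _); ring | lra].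
have ock' : occurrence i w k by [].
have [M [rho [M16 rho0 h]]] := IH _ _ k (slow_line_half ce) ock'.
have /andP[t0 t1] := hit_time_I (slow_line_half ce) ock'.
rewrite [hit_time (l :: w) c e k.+1]/=; move: (hit_time w _ _ k) h t0 t1 => s h t0 t1.
exists (2 * M), (Num.min (rho / 2) (s / 2)); split.
- by rewrite normrM ger0_norm //; lra.
- by rewrite lt_min !divr_gt0.
move=> t; rewrite le_min => /andP[d1]; rewrite ler_norml => /andP[d2 d3] y; rewrite /y.
rewrite poly_loop_snd; last by lra.
rewrite h; last first.
  rewrite (_ : 2 * t - 1 - s = 2 * (t - (1 + s) / 2)); last by field.
  by rewrite normrM ger0_norm //; lra.
by congr vec2; congr (_ * _); field.
Qed.

Lemma hit_time_complete i w c e t : slow_line c e -> 0 <= t <= 1 ->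
  arm i (poly_loop w t) -> height i (poly_loop w t) = c + e * t ->
  exists2 k, occurrence i w k & t = hit_time w c e k.
Proof.
have base_arm : arm i (base R) = false.
  by apply/negbTE; rewrite /arm /base mxE mulr0 -ltNge.
elim: w c e t => [|l w IH] c e t ce t01; first by rewrite /= base_arm.
have [h|h] := leP t 2^-1; last first.
  rewrite poly_loop_snd ?(ltW h) // => a ht.
  have t01' : 0 <= 2 * t - 1 <= 1 by lra.
  have ht' : height i (poly_loop w (2 * t - 1)) = c + e / 2 + e / 2 * (2 * t - 1).
    by rewrite ht; field.
  have [k ock e'] := IH _ _ _ (slow_line_half ce) t01' a ht'.
  by exists k.+1 => //=; rewrite -e'; field.
rewrite poly_loop_fst // /side_path.
have v01 : 0 <= (if l.2 then 1 - 2 * t else 2 * t) <= 1 by case: ifP => _; lra.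
have [li|nli] := eqVneq l.1 i; last by rewrite side_arm_other.
rewrite li side_arm // => a; rewrite side_height // => ht.
exists 0%N; first by rewrite /occurrence /= li eqxx.
have [h1 h2 h3] := ce; move: ht => /=; case: ifP => _ ht.
  apply: (@mulIf _ (16 + e)); first by rewrite gt_eqF //; lra.
  by rewrite divfK; [lra | rewrite gt_eqF //; lra].
apply: (@mulIf _ (16 - e)); first by rewrite gt_eqF //; lra.
by rewrite divfK; [lra | rewrite gt_eqF //; lra].
Qed.

(** The cut lies above all the lines considered, so a forward letter has not
    yet been read when its fixed point is met, and a backward letter has. *)
Lemma hit_time_word i w c e k : slow_line c e -> occurrence i w k ->
  loop_word w (hit_time w c e k) = grp (take (k + (nth (i, false) w k).2) w).
Proof.
elim: w c e k => [|l w IH] c e k ce //; case: k => [|k] ock.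
  have [h1 h2 h3] := hit_time_head l ce w.
  move: (hit_time (l :: w) c e 0) h1 h2 h3 => t0 h1 h2 h3; have [c1 c2 c3] := ce.
  have et : 0 < e * t0 < e by rewrite mulr_gt0 //= ?gtr_pMr //; lra.
  rewrite loop_word_fst; last by lra.
  have li : l.1 = i by case/andP: ock => _ /eqP.
  rewrite /side_word add0n; case el: l.2 h3 => h3.
    rewrite (_ : (19 / 32 < 1 - 2 * t0) = false); last by apply/negbTE; lra.
    rewrite /= take0 mulg1 /gen -grp_inv_letter; congr grp; congr (_ :: _).
    by rewrite [RHS]surjective_pairing el.
  rewrite (_ : (19 / 32 < 2 * t0) = false) /= ?el /=; first by [].
  by apply/negbTE; lra.
have ock' : occurrence i w k by [].
have /andP[t0 t1] := hit_time_I (slow_line_half ce) ock'.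
rewrite [hit_time (l :: w) c e k.+1]/=; set s := hit_time w _ _ k in t0 t1 *.
rewrite loop_word_snd; last by lra.
rewrite (_ : 2 * ((1 + s) / 2) - 1 = s); last by field.
rewrite /s (IH _ _ _ (slow_line_half ce) ock').
by rewrite -(grp_cons l).
Qed.

End HitTimes.

Section LoopMap.
Variable R : realType.
Local Notation E := 'rV[R]_2.
Local Notation "x ** y" := (monoid.mul x y) (at level 40, left associativity).
Local Notation "x ^^-1" := (monoid.inv x) (at level 3).
Implicit Types (u t : R) (i : bool) (l : letter) (x y z : E).
Variable w : bool -> word.

(** The strip of heights from 1/4 to 3/4 in an arm is spread over the unit interval. *)
Definition strip_time (h : R) : R := Num.max 0 (Num.min 1 (2 * h - 2^-1)).

Definition loop_map x : E :=
  if arm false x then poly_loop (w false) (strip_time (height false x))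
  else if arm true x then poly_loop (w true) (strip_time (height true x))
  else base R.

(** The lift of the loop, corrected above the cut so that it is equivariant
    across it. *)
Definition arm_lift i x : free2 :=
  (endo w (crossing i (above i x)))^^-1 ** loop_word (w i) (strip_time (height i x)).

Definition lift_word x : free2 :=
  if arm false x then arm_lift false x
  else if arm true x then arm_lift true x
  else monoid.one.

Lemma loop_map_arm i x : arm i x -> loop_map x = poly_loop (w i) (strip_time (height i x)).
Proof. by case: i => h; rewrite /loop_map; [rewrite (arm_disjoint h) h | rewrite h]. Qed.

Lemma lift_word_arm i x : arm i x -> lift_word x = arm_lift i x.
Proof. by case: i => h; rewrite /lift_word; [rewrite (arm_disjoint h) h | rewrite h]. Qed.

Lemma strip_time_I h : 0 <= strip_time h <= 1.
Proof.
rewrite /strip_time le_max lexx /= ge_max ler01 /= ge_min lexx //.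
Qed.

Lemma strip_time_lip h h' : `|strip_time h - strip_time h'| <= 2 * `|h - h'|.
Proof.
have e : 0 <= 2 * `|h - h'| by rewrite mulr_ge0.
apply: max_lip; first by rewrite subrr normr0.
apply: min_lip; first by rewrite subrr normr0.
by rewrite (_ : _ - _ = 2 * (h - h')); [rewrite normrM ger0_norm | ring].
Qed.

Lemma strip_time_low h : h <= 4^-1 -> strip_time h = 0.
Proof. by move=> hl; rewrite /strip_time max_l // ge_min; apply/orP; right; lra. Qed.

Lemma strip_time_high h : 3 / 4 <= h -> strip_time h = 1.
Proof. by move=> hl; rewrite /strip_time min_l ?max_r //; lra. Qed.

Lemma strip_time_mid h : 4^-1 <= h <= 3 / 4 -> strip_time h = 2 * h - 2^-1.
Proof. by move=> hl; rewrite /strip_time min_r ?max_r //; lra. Qed.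

Lemma loop_map_out x : (forall i, arm i x = false) -> loop_map x = base R.
Proof. by move=> h; rewrite /loop_map !h. Qed.

Lemma lift_word_out x : (forall i, arm i x = false) -> lift_word x = monoid.one.
Proof. by move=> h; rewrite /lift_word !h. Qed.

Lemma mouth_trivial i x : arm i x -> height i x < - (9 / 10) \/ 9 / 10 < height i x ->
  loop_map x = base R /\ lift_word x = monoid.one.
Proof.
move=> ax hx; rewrite (loop_map_arm ax) (lift_word_arm ax) /arm_lift.
case: hx => hx.
  rewrite strip_time_low ?poly_loop0 ?loop_word0; last by lra.
  rewrite (_ : above i x = false); last by apply/negbTE; rewrite /above -leNgt; lra.
  by rewrite mulg1 endo1 invg1.
rewrite strip_time_high ?poly_loop1 ?loop_word1; last by lra.
rewrite (_ : above i x = true); last by rewrite /above; lra.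
by rewrite /= /gen endo_grp /subst /= cats0 /letter_image /= mulVg.
Qed.

(** Two nearby points lie in the same arm, or the map is trivial at both of them. *)
Lemma near_cases x y : @pants R x -> @pants R y -> `|x - y| < 4^-1 ->
  (exists i, arm i x /\ arm i y) \/
  [/\ loop_map x = base R /\ loop_map y = base R,
      lift_word x = monoid.one /\ lift_word y = monoid.one & trans x y = monoid.one].
Proof.
move=> Px Py xy.
have [both|nb] := pselect (exists i, arm i x /\ arm i y); [by left | right].
have yx : `|y - x| < 4^-1 by rewrite distrC.
have tr1 : trans x y = monoid.one.
  by apply: trans_out => i; apply/andP => a; apply: nb; exists i.
have triv a b : @pants R a -> @pants R b -> `|a - b| < 4^-1 ->
    (forall i, ~ (arm i a /\ arm i b)) -> loop_map a = base R /\ lift_word a = monoid.one.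
  move=> Pa Pb ab h.
  have [[i ai]|no] := pselect (exists i, arm i a).
    have bi : ~~ arm i b by apply/negP => bi; exact: (h i).
    exact: mouth_trivial ai (arm_mouth Pa ai bi ab).
  have out i : arm i a = false by apply/negP => ai; apply: no; exists i.
  by rewrite loop_map_out // lift_word_out.
have [] := triv x y Px Py xy; first by move=> i h; apply: nb; exists i.
have [] := triv y x Py Px yx; first by move=> i [h1 h2]; apply: nb; exists i.
by [].
Qed.

Definition lip_bound : R := loop_lip R (w false) + loop_lip R (w true).

Lemma loop_lip_bound i : loop_lip R (w i) <= lip_bound.
Proof.
by have := loop_lip_gt0 R (w false); have := loop_lip_gt0 R (w true);
  case: i; rewrite /lip_bound => *; lra.
Qed.

Lemma lip_bound_gt0 : 0 < lip_bound.
Proof. by rewrite addr_gt0 ?loop_lip_gt0. Qed.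

Lemma loop_map_near x y : @pants R x -> @pants R y -> `|x - y| < 4^-1 ->
  `|loop_map x - loop_map y| <= lip_bound * (2 * `|x - y|).
Proof.
move=> Px Py xy; have [[i [ax ay]]|[[-> ->] _ _]] := near_cases Px Py xy; last first.
  by rewrite subrr normr0 !mulr_ge0 ?(ltW lip_bound_gt0).
rewrite !(loop_map_arm (i := i)) //; apply: le_trans (poly_loop_lip _ _ _) _.
apply: ler_pM; rewrite ?(ltW (loop_lip_gt0 _ _)) ?loop_lip_bound //.
apply: le_trans (strip_time_lip _ _) _; rewrite ler_pM2l //.
rewrite /height -mulrBr norm_sg.
by have [_] := norm2_coord (lexx `|x - y|); rewrite !mxE.
Qed.

Lemma loop_map_selfmap : selfmap (@pants R) loop_map.
Proof.
split.
  apply/within_continuousP => x Px e e0.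
  exists (Num.min 4^-1 (e / (2 * lip_bound))).
    by rewrite lt_min invr_gt0 ltr0n divr_gt0 // mulr_gt0 // lip_bound_gt0.
  move=> y Py /ball2E; rewrite lt_min => /andP[d1 d2].
  apply: le_lt_trans (loop_map_near Px Py d1) _.
  have L0 := lip_bound_gt0; have L2 : 0 < 2 * lip_bound by rewrite mulr_gt0.
  by move: d2; rewrite ltr_pdivlMr // => d2; lra.
move=> _ [x Px <-].
have [[i ax]|no] := pselect (exists i, arm i x).
  by rewrite (loop_map_arm ax); apply: poly_loop_pants; exact: strip_time_I.
rewrite loop_map_out; first exact: base_pants.
by move=> i; apply/negP => ai; apply: no; exists i.
Qed.

Lemma loop_map_lifts : lifts (@pants R) (@trans R) loop_map lift_word (endo w) (8 * lip_bound)^-1.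
Proof.
have L0 := lip_bound_gt0; have lb := loop_lip_bound.
split; first by rewrite invr_gt0 mulr_gt0.
  exact: endoM.
move=> x y Px Py xy.
have xy4 : `|x - y| < 4^-1.
  apply: lt_trans xy _; rewrite ltf_pV2 ?posrE ?mulr_gt0 //.
  have := loop_lip_ge8 R (w false); have := loop_lip_gt0 R (w true).
  by rewrite /lip_bound => *; lra.
have [[i [ax ay]]|[[-> ->] [-> ->] ->]] := near_cases Px Py xy4; last first.
  by rewrite (trans1 (pants_transport R)) ?endo1 //; exact: base_pants.
rewrite !(loop_map_arm (i := i)) // !(lift_word_arm (i := i)) // /arm_lift.
rewrite (trans_arm ax ay) -mulgA loop_word_trans ?strip_time_I //.
  by rewrite endoM endoV -!mulgA mulVKg.
apply: le_lt_trans (strip_time_lip _ _) _.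
have h : `|height i x - height i y| <= `|x - y|.
  rewrite /height -mulrBr norm_sg.
  by have [_] := norm2_coord (lexx `|x - y|); rewrite !mxE.
have : (8 * lip_bound)^-1 <= (8 * loop_lip R (w i))^-1.
  by rewrite lef_pV2 ?posrE ?mulr_gt0 ?loop_lip_gt0 // ler_pM2l.
have -> : (4 * loop_lip R (w i))^-1 = 2 * (8 * loop_lip R (w i))^-1.
  by field; rewrite gt_eqF // loop_lip_gt0.
by move=> ?; lra.
Qed.

Definition fix_height i k : R := 4^-1 + 2^-1 * hit_time (w i) 4^-1 2^-1 k.

Definition fix_point i k : E :=
  vec2 (sg R i * (4 - fix_height i k)) (sg R i * fix_height i k).

Lemma strip_line : slow_line (4^-1 : R) 2^-1.
Proof. by split; lra. Qed.

Lemma fix_height_strip i k : occurrence i (w i) k -> 4^-1 < fix_height i k < 3 / 4.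
Proof. by move=> /(hit_time_I strip_line)/andP[h1 h2]; rewrite /fix_height; lra. Qed.

Lemma height_fix_point i k : height i (fix_point i k) = fix_height i k.
Proof. by rewrite /height vec2_1 sg_sgM. Qed.

Lemma arm_fix_point i k : occurrence i (w i) k -> arm i (fix_point i k).
Proof. by move=> /fix_height_strip/andP[h1 h2]; rewrite /arm vec2_0 sg_sgM; lra. Qed.

Lemma strip_time_fix i k : occurrence i (w i) k ->
  strip_time (fix_height i k) = hit_time (w i) 4^-1 2^-1 k.
Proof.
move=> /fix_height_strip/andP[h1 h2]; rewrite strip_time_mid; last by lra.
by rewrite /fix_height; field.
Qed.

Lemma poly_loop_fix i k : occurrence i (w i) k ->
  poly_loop (w i) (hit_time (w i) 4^-1 2^-1 k) = fix_point i k.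
Proof.
move=> ock; have [M [rho [_ rho0 h]]] := hit_time_local strip_line ock.
by rewrite h ?subrr ?normr0 ?(ltW rho0) // mulr0 addr0.
Qed.

Lemma lift_word_fix i k : occurrence i (w i) k ->
  lift_word (fix_point i k) = grp (take (k + (nth (i, false) (w i) k).2) (w i)).
Proof.
move=> ock; rewrite (lift_word_arm (arm_fix_point ock)) /arm_lift height_fix_point.
rewrite strip_time_fix // (hit_time_word strip_line ock) /above height_fix_point.
have /andP[h1 h2] := fix_height_strip ock.
rewrite (_ : (3 / 4 < fix_height i k) = false); last by apply/negbTE; lra.
by rewrite endo1 invg1 mul1g.
Qed.

(** The map moves the points of the strip along a line and depends on the
    height only, so id - f has the form [saddle] with determinant 1 - 2 * M,
    and 2 * M is at least 32 in absolute value. *)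
Lemma fix_point_affine i k : occurrence i (w i) k ->
  exists rho a m, affine_fixed_point (@pants R) loop_map (fix_point i k) rho a m.
Proof.
move=> ock; have [M [rho [M16 rho0 h]]] := hit_time_local strip_line ock.
have /andP[h1 h2] := fix_height_strip ock.
set y := fix_height i k in h1 h2.
exists (Num.min (rho / 2) (Num.min (y - 4^-1) (3 / 4 - y))), (- (2 * M)), (1 - 2 * M).
split.
- by rewrite !lt_min !subr_gt0 h1 h2 divr_gt0.
- apply/eqP => M1; have e : M = 2^-1 by lra.
  by move: M16; rewrite e ger0_norm ?invr_ge0 //; lra.
move=> v; rewrite !le_min => /and3P[d1 d2 d3].
have [c0 c1] := norm2_coord (lexx `|v - fix_point i k|).
rewrite !mxE /= in c0 c1.
have a0 : `|sg R i * v 0 0 - (4 - y)| <= `|v - fix_point i k|.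
  by rewrite -(norm_sg i) mulrBr sg_sgM.
have a1 : `|height i v - y| <= `|v - fix_point i k|.
  by rewrite -(norm_sg i) mulrBr sg_sgM.
move: a0 a1 (le_trans a1 d1); rewrite !ler_norml => /andP[a0 a0'] /andP[a1 a1'] /andP[e1 e1'].
have av : arm i v by rewrite /arm; lra.
have tv : strip_time (height i v) = 2 * height i v - 2^-1 by apply: strip_time_mid; lra.
have ht : hit_time (w i) 4^-1 2^-1 k = 2 * y - 2^-1 by rewrite /y /fix_height; field.
have ev : loop_map v = vec2 (sg R i * (4 - (y + 2 * M * (height i v - y))))
                            (sg R i * (y + 2 * M * (height i v - y))).
  rewrite (loop_map_arm av) tv h; last by rewrite ht ler_norml; lra.
  by rewrite ht; congr vec2; congr (_ * _); field.
split.
  have hx0 : 3 <= sg R i * v 0 0 <= 4 by lra.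
  have hx1 : 0 <= height i v <= 1 by lra.
  rewrite /pants /= /sqdist subr0 opprK.
  move: hx0 hx1; rewrite /height; case: (i); rewrite /sg ?mul1r ?mulN1r => /andP[? ?] /andP[? ?];
    by split; nra.
rewrite ev; apply: row2P; rewrite !mxE /= /height -/y; case: (i); rewrite /sg; ring.
Qed.

Lemma base_affine : affine_fixed_point (@pants R) loop_map (base R) 1 0 1.
Proof.
split=> [||v]; rewrite ?oner_neq0 //.
rewrite subr0 => /norm2_coord[]; rewrite !ler_norml => /andP[h1 h2] /andP[h3 h4].
rewrite loop_map_out.
  split; last by apply: row2P; rewrite !mxE /= !subr0 ?mul0r ?mul1r ?subr0.
  by rewrite /pants /= /sqdist subr0 opprK; split; nra.
by move=> i; apply/negbTE; rewrite /arm -ltNge; case: i; rewrite /sg ?mul1r ?mulN1r; lra.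
Qed.

Lemma fixed_complete x : loop_map x = x -> x = base R \/
  exists i k, occurrence i (w i) k /\ x = fix_point i k.
Proof.
move=> fx; have [[i ax]|no] := pselect (exists i, arm i x); last first.
  left; rewrite -fx loop_map_out // => i; apply/negP => ai; apply: no; by exists i.
right; exists i; have nb : arm i (base R) = false.
  by apply/negbTE; rewrite /arm /base mxE mulr0 -ltNge.
move: fx; rewrite (loop_map_arm ax) => fx.
have [lo|lo] := leP (height i x) 4^-1.
  by move: ax; rewrite -fx strip_time_low // poly_loop0 nb.
have [hi|hi] := leP (3 / 4) (height i x).
  by move: ax; rewrite -fx strip_time_high // poly_loop1 nb.
have tm : strip_time (height i x) = 2 * height i x - 2^-1 by apply: strip_time_mid; lra.
have ax' : arm i (poly_loop (w i) (strip_time (height i x))) by rewrite fx.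
have hx' : height i (poly_loop (w i) (strip_time (height i x))) =
    4^-1 + 2^-1 * strip_time (height i x) by rewrite fx tm; field.
have [k ock e] := hit_time_complete strip_line (strip_time_I _) ax' hx'.
by exists k; split=> //; rewrite -fx e poly_loop_fix.
Qed.

Definition fixed_points : seq E :=
  base R :: [seq fix_point false k | k <- iota 0 (size (w false)) & occurrence false (w false) k] ++
            [seq fix_point true k | k <- iota 0 (size (w true)) & occurrence true (w true) k].

Lemma fixed_pointsP x : x \in fixed_points <->
  x = base R \/ exists i k, occurrence i (w i) k /\ x = fix_point i k.
Proof.
rewrite inE mem_cat; split.
  case/orP => [/eqP ->|/orP[]/mapP[k]]; first by left.
    by rewrite mem_filter => /andP[ock _] ->; right; exists false, k.
  by rewrite mem_filter => /andP[ock _] ->; right; exists true, k.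
case=> [->|[i [k [ock ->]]]]; first by rewrite eqxx.
have mk : k \in [seq k <- iota 0 (size (w i)) | occurrence i (w i) k].
  by rewrite mem_filter ock mem_iota; case/andP: ock.
by case: i {ock} mk => mk; rewrite map_f ?orbT.
Qed.

(** The value of [lift_word_fix] is the tail [zeta]. *)
Lemma occurrence_occurs i k : occurrence i (w i) k ->
  occurs w (i, false) (take k (w i)) (nth (i, false) (w i) k) (drop k.+1 (w i)) /\
  zeta (i, false) (take k (w i)) (nth (i, false) (w i) k) =
    take (k + (nth (i, false) (w i) k).2) (w i).
Proof.
move=> /andP[kw /eqP ax]; split.
  by split=> //; rewrite /letter_image /= -drop_nth // cat_take_drop.
move: ax; rewrite /zeta; have := take_nth (i, false) kw.
case: (nth _ _ _) => j s e /= ej; subst j.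
case: s e => e; last by rewrite eqxx addn0.
by rewrite addn1 e ifF // xpair_eqE andbF.
Qed.

Lemma twisted_sym (phi : free2 -> free2) : {morph phi : a b / a ** b} ->
  forall a b, twisted_equiv phi a b -> twisted_equiv phi b a.
Proof.
move=> pM a b [z e]; exists z^^-1.
have p1 : phi monoid.one = monoid.one.
  by apply/(@mulgI _ (phi monoid.one)); rewrite -pM !mulg1.
have -> : phi z^^-1 = (phi z)^^-1 by apply/(@mulIg _ (phi z)); rewrite -pM !mulVg.
by apply/(@mulIg _ z); rewrite mulgVK -mulgA e mulKg.
Qed.

(** All fixed points have affine displacement, and by [base_separated] and
    [occurs_separated] they lie in pairwise different classes. *)
Theorem loop_map_wecken K : separated w K -> wecken (@pants R) loop_map.
Proof.
move=> sp.
have base_lift : lift_word (base R) = monoid.one.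
  apply: lift_word_out => i; apply/negbTE.
  by rewrite /arm /base mxE mulr0 -ltNge.
have endoM' := endoM w.
have sep_base i k : occurrence i (w i) k ->
    ~ twisted_equiv (endo w) (lift_word (base R)) (lift_word (fix_point i k)).
  move=> ock [z]; rewrite base_lift mul1g lift_word_fix //.
  by have [oc <-] := occurrence_occurs ock; move/(base_separated sp oc).
have sep p q : p \in fixed_points -> q \in fixed_points ->
    twisted_equiv (endo w) (lift_word p) (lift_word q) -> q = p.
  move=> /fixed_pointsP[->|[i [k [ock ->]]]] /fixed_pointsP[->|[j [k' [ock' ->]]]] //.
  - by move=> /(sep_base _ _ ock').
  - by move=> /(twisted_sym endoM') /(sep_base _ _ ock).
  rewrite !lift_word_fix // => -[z].
  have [oc <-] := occurrence_occurs ock; have [oc' <-] := occurrence_occurs ock'.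
  move=> /(occurs_separated sp _ _ oc oc')[] // [ij] ek; subst j.
  have : size (take k (w i)) = size (take k' (w i)) by rewrite ek.
  case/andP: ock => h1 _; case/andP: ock' => h2 _.
  by rewrite !size_takel ?(ltnW h1) ?(ltnW h2) // => ->.
refine (wecken_of_affine (pts := fixed_points) (pants_transport R) loop_map_lifts
  (pants_retract R) (@pants_compact R) loop_map_selfmap _ _ _ sep).
- have inj i : {in [seq k <- iota 0 (size (w i)) | occurrence i (w i) k] &, injective (fix_point i)}.
    move=> k k'; rewrite !mem_filter => /andP[ock _] /andP[ock' _] e.
    have : twisted_equiv (endo w) (lift_word (fix_point i k)) (lift_word (fix_point i k')).
      by rewrite e; exists monoid.one; rewrite mulg1 endo1 mul1g.
    rewrite !lift_word_fix // => -[z].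
    have [oc <-] := occurrence_occurs ock; have [oc' <-] := occurrence_occurs ock'.
    move=> /(occurs_separated sp _ _ oc oc')[] // _ ek.
    have : size (take k (w i)) = size (take k' (w i)) by rewrite ek.
    case/andP: ock => h1 _; case/andP: ock' => h2 _.
    by rewrite !size_takel ?(ltnW h1) ?(ltnW h2).
  have notbase i k : occurrence i (w i) k -> fix_point i k != base R.
    move=> ock; apply/eqP => e; apply: (sep_base _ _ ock); rewrite e.
    by exists monoid.one; rewrite mulg1 endo1 mul1g.
  rewrite /fixed_points /= mem_cat negb_or cat_uniq !map_inj_in_uniq //; try exact: inj.
  rewrite !filter_uniq ?iota_uniq //= andbT -andbA; apply/and3P; split.
  + by apply/negP => /mapP[k]; rewrite mem_filter => /andP[ock _] e;
      move: (notbase _ _ ock); rewrite -e eqxx.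
  + by apply/negP => /mapP[k]; rewrite mem_filter => /andP[ock _] e;
      move: (notbase _ _ ock); rewrite -e eqxx.
  + apply/hasPn => x /mapP[k]; rewrite mem_filter => /andP[ock _] ->.
    apply/negP => /mapP[k']; rewrite mem_filter => /andP[ock' _] e.
    have := arm_disjoint (arm_fix_point ock); rewrite /= e.
    by rewrite arm_fix_point.
- move=> p /fixed_pointsP[->|[i [k [ock ->]]]]; last exact: fix_point_affine.
  by exists 1, 0, 1; exact: base_affine.
- by move=> x _ fx; apply/fixed_pointsP; exact: fixed_complete.
Qed.

End LoopMap.

(** * Homotopies of paths *)

Section PathHomotopy.
Variable R : realType.
Local Notation E := 'rV[R]_2.
Local Notation I01 := (`[0, 1]%classic : set R).
Variable X : set E.
Implicit Types (a b c d : R -> E) (x y : E).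

Lemma I01P t : I01 t <-> 0 <= t <= 1.
Proof. by rewrite /= in_itv. Qed.

Lemma I01_0 : I01 0. Proof. by apply/I01P; rewrite lexx ler01. Qed.
Lemma I01_1 : I01 1. Proof. by apply/I01P; rewrite lexx ler01. Qed.

Definition unif1 c := forall e, 0 < e -> exists2 r : R, 0 < r &
  forall t t', I01 t -> I01 t' -> `|t - t'| < r -> `|c t - c t'| < e.

(** Continuity on the compact square in its uniform form, which composes and
    glues by elementary estimates. *)
Definition unif2 (H : R -> R -> E) := forall e, 0 < e -> exists2 r : R, 0 < r &
  forall s t s' t', I01 s -> I01 t -> I01 s' -> I01 t' ->
    `|s - s'| < r -> `|t - t'| < r -> `|H s t - H s' t'| < e.

Lemma unif1P c : {within I01, continuous c} <-> unif1 c.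
Proof.
split=> h.
  move=> e e0; have [r r0 hr] := compact_unif_continuous (@segment_compact _ 0 1) h e0.
  by exists r => // t t' It It' tt; apply: hr; rewrite // -ball_normE.
apply/within_continuousP => t It e e0; have [r r0 hr] := h e e0.
by exists r => // t' It'; rewrite -ball_normE => tt; exact: hr.
Qed.

Lemma unif2P H :
  {within I01 `*` I01, continuous (fun z : R * R => H z.1 z.2)} <-> unif2 H.
Proof.
split=> h.
  have Ic := @segment_compact R 0 1.
  move=> e e0; have [r r0 hr] := compact_unif_continuous (compact_setX Ic Ic) h e0.
  exists r => // s t s' t' Is It Is' It' ss tt.
  by apply: (hr (s, t) (s', t')) => //; split; rewrite /= -ball_normE.
apply/within_continuousP => -[s t] [/= Is It] e e0; have [r r0 hr] := h e e0.
by exists r => // -[s' t'] [/= Is' It'] []; rewrite /= -!ball_normE => ss tt; exact: hr.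
Qed.

Definition lip2 (h : R -> R -> R) := exists2 L : R, 0 < L & forall s t s' t',
  I01 s -> I01 t -> I01 s' -> I01 t' ->
  `|h s t - h s' t'| <= L * (`|s - s'| + `|t - t'|).

Lemma unif2_comp c h : unif1 c -> lip2 h ->
  (forall s t, I01 s -> I01 t -> I01 (h s t)) -> unif2 (fun s t => c (h s t)).
Proof.
move=> uc [L L0 hL] hI e e0; have [r r0 hr] := uc e e0.
have r2 : 0 < r / (2 * L) by rewrite divr_gt0 // mulr_gt0.
exists (r / (2 * L)) => // s t s' t' Is It Is' It' ss tt.
apply: hr; [exact: hI|exact: hI|]; apply: le_lt_trans (hL _ _ _ _ Is It Is' It') _.
rewrite mulrC -ltr_pdivlMr //; have -> : r / L = r / (2 * L) + r / (2 * L).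
  by field; rewrite gt_eqF.
exact: ltrD.
Qed.

Definition inX c := forall t, I01 t -> X (c t).

Definition path c := unif1 c /\ inX c.

Lemma is_pathP x y c : is_path X x y c <-> [/\ path c, c 0 = x & c 1 = y].
Proof.
split=> [[cc cX c0 c1]|[[uc cX] c0 c1]].
  by split=> //; split; [exact/unif1P | move=> t It; apply: cX; exists t].
by split=> //; [exact/unif1P | move=> _ [t It <-]; exact: cX].
Qed.

Definition homot c d := exists H : R -> R -> E, [/\ unif2 H,
  forall s t, I01 s -> I01 t -> X (H s t),
  forall t, I01 t -> H 0 t = c t,
  forall t, I01 t -> H 1 t = d t &
  forall s, I01 s -> H s 0 = c 0 /\ H s 1 = c 1].

Lemma homotP c d : path_homotopic X c d <-> homot c d.
Proof.
by split=> -[H [h1 h2 h3 h4 h5]]; exists H; split=> //; exact/unif2P.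
Qed.

Lemma homot_ends c d : homot c d -> d 0 = c 0 /\ d 1 = c 1.
Proof.
case=> H [_ _ _ h1 he]; have [e0 e1] := he 1 I01_1.
by rewrite -e0 -e1 !h1 //; [exact: I01_1 | exact: I01_0].
Qed.

Lemma homot_path c d : homot c d -> path c /\ path d.
Proof.
case=> H [uH HX h0 h1 he].
have slice s e : I01 s -> (forall t, I01 t -> H s t = e t) -> path e.
  move=> Is eq; split; last by move=> t It; rewrite -eq //; exact: HX.
  move=> eps eps0; have [r r0 hr] := uH eps eps0; exists r => // t t' It It' tt.
  by rewrite -!eq //; apply: hr => //; rewrite subrr normr0.
by split; [exact: slice I01_0 h0 | exact: slice I01_1 h1].
Qed.

Lemma homot_refl c : path c -> homot c c.
Proof.
move=> [uc cX]; exists (fun _ => c); split=> // [e e0|s t _ It]; last exact: cX.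
by have [r r0 hr] := uc e e0; exists r => // s t s' t' _ It _ It' _; exact: hr.
Qed.

Lemma homot_ext c d e : (forall t, I01 t -> d t = e t) -> homot c d -> homot c e.
Proof. by move=> de [H [h1 h2 h3 h4 h5]]; exists H; split=> // t It; rewrite h4 // de. Qed.

Lemma homot_sym c d : homot c d -> homot d c.
Proof.
move=> hcd; have [d0 d1] := homot_ends hcd; case: hcd => H [uH HX h0 h1 he].
have I1 s : I01 s -> I01 (1 - s) by move=> /I01P ?; apply/I01P; lra.
exists (fun s => H (1 - s)); split.
- move=> e e0; have [r r0 hr] := uH e e0; exists r => // s t s' t' Is It Is' It' ss.
  apply: hr => //; try exact: I1.
  by rewrite (_ : _ - _ = - (s - s')) ?normrN //; ring.
- by move=> s t /I1 Is; exact: HX.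
- by move=> t It; rewrite subr0 h1.
- by move=> t It; rewrite subrr h0.
- by move=> s /I1 Is; rewrite d0 d1; exact: he.
Qed.

Lemma unif2_glue (A B : R -> R -> E) : unif2 A -> unif2 B ->
  (forall s, I01 s -> A s 1 = B s 0) ->
  unif2 (fun s t => if t <= 2^-1 then A s (2 * t) else B s (2 * t - 1)).
Proof.
move=> uA uB AB e e0; have e2 : 0 < e / 2 by rewrite divr_gt0.
have [r1 r10 h1] := uA _ e2; have [r2 r20 h2] := uB _ e2.
exists (Num.min r1 r2 / 2); first by rewrite divr_gt0 // lt_min r10.
move=> s t s' t' Is /I01P/andP[t0 t1] Is' /I01P/andP[t0' t1'].
rewrite ltr_pdivlMr // lt_min => /andP[s1 s2].
rewrite ltr_pdivlMr // lt_min => /andP[d1 d2].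
have n2 (u v : R) : `|2 * u - 2 * v| = `|u - v| * 2.
  by rewrite -mulrBr normrM ger0_norm // mulrC.
have n2' (u v : R) : `|2 * u - 1 - (2 * v - 1)| = `|u - v| * 2.
  by rewrite -n2; congr (`| _ |); ring.
have ns : `|s - s'| <= `|s - s'| * 2 by rewrite ler_peMr // ler1n.
have ss1 := le_lt_trans ns s1; have ss2 := le_lt_trans ns s2.
have I1 := I01_1; have I0 := I01_0.
have tt1 : t - t' <= `|t - t'| by exact: ler_norm.
have tt2 : t' - t <= `|t - t'| by rewrite distrC; exact: ler_norm.
have [h|h] := leP t 2^-1; have [h'|h'] := leP t' 2^-1.
- apply: lt_trans (_ : e / 2 < e); last by rewrite ltr_pdivrMr // ltr_pMr // ltr1n.
  by apply: h1; rewrite ?n2 //; apply/I01P; lra.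
- rewrite -(subrK (A s' 1) (A s (2 * t))) -addrA; apply: le_lt_trans (ler_normD _ _) _.
  rewrite (splitr e); apply: ltrD.
    apply: h1 => //; first by apply/I01P; lra.
    by rewrite ltr_norml; lra.
  rewrite AB //; apply: h2 => //; [by apply/I01P; lra | by rewrite subrr normr0 |].
  by rewrite ltr_norml; lra.
- rewrite -(subrK (A s' 1) (B s (2 * t - 1))) -addrA; apply: le_lt_trans (ler_normD _ _) _.
  rewrite (splitr e); apply: ltrD.
    rewrite AB //; apply: h2 => //; first by apply/I01P; lra.
    by rewrite ltr_norml; lra.
  apply: h1 => //; [by apply/I01P; lra | by rewrite subrr normr0 |].
  by rewrite ltr_norml; lra.
- apply: lt_trans (_ : e / 2 < e); last by rewrite ltr_pdivrMr // ltr_pMr // ltr1n.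
  by apply: h2; rewrite ?n2' //; apply/I01P; lra.
Qed.

Lemma homot_trans c d e : homot c d -> homot d e -> homot c e.
Proof.
move=> hcd; have [d0 d1] := homot_ends hcd.
case: hcd => H [uH HX h0 h1 he] [K [uK KX k0 k1 ke]].
exists (fun s t => if s <= 2^-1 then H (2 * s) t else K (2 * s - 1) t).
have swap (F : R -> R -> E) : unif2 F -> unif2 (fun t s => F s t).
  move=> uF eps eps0; have [r r0 hr] := uF eps eps0; exists r => // s t s' t' *.
  exact: hr.
have first s : I01 s -> s <= 2^-1 -> I01 (2 * s) by move=> /I01P ? ?; apply/I01P; lra.
have second s : I01 s -> 2^-1 < s -> I01 (2 * s - 1) by move=> /I01P ? ?; apply/I01P; lra.
split.
- apply: (swap (fun t s => if s <= 2^-1 then H (2 * s) t else K (2 * s - 1) t)).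
  apply: (unif2_glue (swap _ uH) (swap _ uK)) => t It.
  by rewrite h1 // k0.
- move=> s t Is It; case: (leP s 2^-1) => h; first by apply: HX => //; exact: first.
  by apply: KX => //; exact: second.
- by move=> t It; rewrite invr_ge0 ler0n mulr0 h0.
- move=> t It; rewrite ifF; last by apply/negbTE; rewrite -ltNge; lra.
  by rewrite (_ : 2 * 1 - 1 = 1) ?k1 //; ring.
move=> s Is; case: (leP s 2^-1) => h; first by apply: he; exact: first.
by rewrite -d0 -d1; apply: ke; exact: second.
Qed.

Lemma homot_cat c c' d d' : c 1 = d 0 -> homot c c' -> homot d d' ->
  homot (path_cat c d) (path_cat c' d').
Proof.
move=> cd [H [uH HX h0 h1 he]] [K [uK KX k0 k1 ke]].
exists (fun s t => if t <= 2^-1 then H s (2 * t) else K s (2 * t - 1)).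
have first s : I01 s -> s <= 2^-1 -> I01 (2 * s) by move=> /I01P ? ?; apply/I01P; lra.
have second s : I01 s -> 2^-1 < s -> I01 (2 * s - 1) by move=> /I01P ? ?; apply/I01P; lra.
have n1 : (1 <= 2^-1 :> R) = false by apply/negbTE; rewrite -ltNge; lra.
have e1 : 2 * 1 - 1 = 1 :> R by ring.
split.
- apply: unif2_glue => // s Is.
  by have [_ ->] := he s Is; have [-> _] := ke s Is.
- move=> s t Is It; case: (leP t 2^-1) => h; first by apply: HX => //; exact: first.
  by apply: KX => //; exact: second.
- move=> t It; rewrite /path_cat; case: (leP t 2^-1) => h; first by apply: h0; exact: first.
  by apply: k0; exact: second.
- move=> t It; rewrite /path_cat; case: (leP t 2^-1) => h; first by apply: h1; exact: first.
  by apply: k1; exact: second.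
move=> s Is; rewrite /path_cat n1 e1 invr_ge0 ler0n mulr0.
by have [-> _] := he s Is; have [_ ->] := ke s Is.
Qed.

Lemma path_path_cat c d : path c -> path d -> c 1 = d 0 -> path (path_cat c d).
Proof.
by move=> /homot_refl hc /homot_refl hd cd; case: (homot_path (homot_cat cd hc hd)).
Qed.

Definition reparam (h : R -> R) := (exists2 L : R, 0 < L & forall t t',
   `|h t - h t'| <= L * `|t - t'|) /\ forall t, I01 t -> I01 (h t).

(** Two reparametrisations of a path with the same ends are homotopic along it. *)
Lemma homot_reparam c h k : path c -> reparam h -> reparam k ->
  h 0 = k 0 -> h 1 = k 1 -> homot (c \o h) (c \o k).
Proof.
move=> [uc cX] [[L L0 hL] hI] [[M M0 kM] kI] e0 e1.
pose g s t := (1 - s) * h t + s * k t.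
have gI s t : I01 s -> I01 t -> I01 (g s t).
  move=> /I01P/andP[s0 s1] It; have /I01P/andP[h0 h1] := hI t It.
  have /I01P/andP[k0 k1] := kI t It; apply/I01P; rewrite /g.
  have a1 : 0 <= 1 - s by rewrite subr_ge0.
  have := mulr_ge0 a1 h0; have := mulr_ge0 s0 k0.
  have := ler_wpM2l a1 h1; have := ler_wpM2l s0 k1; rewrite !mulr1 => *; lra.
exists (fun s t => c (g s t)); split.
- apply: unif2_comp => //; exists (2 + L + M); first by rewrite addr_gt0 // addr_gt0.
  move=> s t s' t' Is It Is' It'.
  have /I01P/andP[h0 h1] := hI t' It'; have /I01P/andP[k0 k1] := kI t' It'.
  have /I01P/andP[s0 s1] := Is.
  rewrite (_ : g s t - g s' t' = (1 - s) * (h t - h t') + s * (k t - k t') +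
    ((s - s') * k t' - (s - s') * h t')); last by rewrite /g; ring.
  apply: le_trans (ler_normD _ _) _.
  have a1 : `|(1 - s) * (h t - h t') + s * (k t - k t')| <= (L + M) * `|t - t'|.
    apply: le_trans (ler_normD _ _) _; rewrite !normrM mulrDl; apply: lerD.
      apply: le_trans (hL t t'); rewrite ger0_norm ?subr_ge0 // ler_piMl //; lra.
    by apply: le_trans (kM t t'); rewrite ger0_norm // ler_piMl.
  have a2 : `|(s - s') * k t' - (s - s') * h t'| <= 2 * `|s - s'|.
    apply: le_trans (ler_normB _ _) _; rewrite !normrM (ger0_norm h0) (ger0_norm k0).
    have := normr_ge0 (s - s') => n0.
    by have := ler_wpM2l n0 h1; have := ler_wpM2l n0 k1; rewrite mulr1 => *; lra.
  have := mulr_ge0 (ltW (addr_gt0 L0 M0)) (normr_ge0 (s - s')).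
  by have := normr_ge0 (t - t'); rewrite !mulrDl !mulrDr in a1 a2 * => *; lra.
- by move=> s t Is It; apply: cX; exact: gI.
- by move=> t It; rewrite /g subr0 mul1r mul0r addr0.
- by move=> t It; rewrite /g subrr mul1r mul0r add0r.
move=> s Is; rewrite /= /g e0 e1; split; congr c; ring.
Qed.

End PathHomotopy.

Section PathAlgebra.
Variable R : realType.
Local Notation E := 'rV[R]_2.
Local Notation I01 := (`[0, 1]%classic : set R).
Variable X : set E.
Implicit Types (a b c d : R -> E) (x y : E).

Lemma reparam_id : reparam (@id R).
Proof. by split=> //; exists 1 => // t t'; rewrite mul1r. Qed.

Lemma affine_lip (p q r : R) t t' :
  `|(p * t + q) - (p * t' + r)| <= `|p| * `|t - t'| + `|q - r|.
Proof.
rewrite (_ : _ - _ = p * (t - t') + (q - r)); last by ring.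
by apply: le_trans (ler_normD _ _) _; rewrite normrM.
Qed.

Lemma lip_affine (p q : R) : exists2 L : R, 0 < L & forall t t',
  `|(p * t + q) - (p * t' + q)| <= L * `|t - t'|.
Proof.
exists (`|p| + 1); first by rewrite ltr_wpDl.
move=> t t'; apply: le_trans (affine_lip _ _ _ _ _) _.
by rewrite subrr normr0 addr0 mulrDl lerDl mul1r.
Qed.

Lemma lip_min (h k : R -> R) : (exists2 L : R, 0 < L & forall t t', `|h t - h t'| <= L * `|t - t'|) ->
  (exists2 L : R, 0 < L & forall t t', `|k t - k t'| <= L * `|t - t'|) ->
  exists2 L : R, 0 < L & forall t t',
    `|Num.min (h t) (k t) - Num.min (h t') (k t')| <= L * `|t - t'|.
Proof.
move=> [L L0 hL] [M M0 kM]; exists (L + M); first exact: addr_gt0.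
move=> t t'; apply: min_lip; rewrite mulrDl.
  by apply: le_trans (hL _ _) _; rewrite lerDl mulr_ge0 ?(ltW M0).
by apply: le_trans (kM _ _) _; rewrite lerDr mulr_ge0 ?(ltW L0).
Qed.

Lemma lip_max (h k : R -> R) : (exists2 L : R, 0 < L & forall t t', `|h t - h t'| <= L * `|t - t'|) ->
  (exists2 L : R, 0 < L & forall t t', `|k t - k t'| <= L * `|t - t'|) ->
  exists2 L : R, 0 < L & forall t t',
    `|Num.max (h t) (k t) - Num.max (h t') (k t')| <= L * `|t - t'|.
Proof.
move=> [L L0 hL] [M M0 kM]; exists (L + M); first exact: addr_gt0.
move=> t t'; apply: max_lip; rewrite mulrDl.
  by apply: le_trans (hL _ _) _; rewrite lerDl mulr_ge0 ?(ltW M0).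
by apply: le_trans (kM _ _) _; rewrite lerDr mulr_ge0 ?(ltW L0).
Qed.

Lemma homot_of_reparam c d h : path X c -> reparam h -> h 0 = 0 -> h 1 = 1 ->
  (forall t, I01 t -> d t = c (h t)) -> homot X d c.
Proof.
move=> pc rh h0 h1 e; apply: homot_sym; apply: homot_ext (homot_reparam pc reparam_id rh _ _) => //.
by move=> t It /=; rewrite e.
Qed.

Lemma homot_unitl c : path X c -> homot X (path_cat (cst (c 0)) c) c.
Proof.
move=> pc; apply: (@homot_of_reparam _ _ (fun t => Num.max (0 * t + 0) (2 * t + -1))) => //.
- split; first exact: lip_max (lip_affine _ _) (lip_affine _ _).
  by move=> t /I01P/andP[? ?]; apply/I01P; case: (leP (0 * t + 0)) => ?; lra.
- by rewrite mulr0 max_l //; lra.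
- by rewrite max_r; lra.
move=> t /I01P/andP[t0 t1]; rewrite /path_cat; case: leP => h.
  by rewrite max_l ?mul0r ?addr0 //; lra.
by rewrite max_r //; lra.
Qed.

Lemma homot_unitr c : path X c -> homot X (path_cat c (cst (c 1))) c.
Proof.
move=> pc; apply: (@homot_of_reparam _ _ (fun t => Num.min (0 * t + 1) (2 * t + 0))) => //.
- split; first exact: lip_min (lip_affine _ _) (lip_affine _ _).
  by move=> t /I01P/andP[? ?]; apply/I01P; case: (leP (0 * t + 1)) => ?; lra.
- by rewrite min_r; lra.
- by rewrite min_l; lra.
move=> t /I01P/andP[t0 t1]; rewrite /path_cat; case: leP => h.
  by rewrite min_r ?addr0 //; lra.
by rewrite min_l ?mul0r ?add0r //; lra.
Qed.

Lemma homot_assoc a b c : path X a -> path X b -> path X c -> a 1 = b 0 -> b 1 = c 0 ->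
  homot X (path_cat (path_cat a b) c) (path_cat a (path_cat b c)).
Proof.
move=> pa pb pc ab bc.
have pbc : path X (path_cat b c) by exact: path_path_cat.
have bc0 : path_cat b c 0 = b 0 by rewrite /path_cat invr_ge0 ler0n mulr0.
have pm : path X (path_cat a (path_cat b c)) by apply: path_path_cat => //; rewrite bc0.
pose h (t : R) := Num.min (2 * t + 0) (Num.min (1 * t + 4^-1) (2^-1 * t + 2^-1)).
have hE t : [/\ t <= 4^-1 -> h t = 2 * t, 4^-1 <= t <= 2^-1 -> h t = t + 4^-1 &
    2^-1 <= t -> h t = 2^-1 * t + 2^-1].
  rewrite /h; split=> ht.
  - by rewrite min_l ?addr0 // le_min; apply/andP; split; lra.
  - by rewrite (min_l (_ : 1 * t + 4^-1 <= _)) ?min_r; lra.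
  - by rewrite (min_r (_ : _ <= 1 * t + 4^-1)) ?min_r; lra.
apply: (homot_of_reparam (h := h)) => //.
- split; first exact: lip_min (lip_affine _ _) (lip_min (lip_affine _ _) (lip_affine _ _)).
  move=> t /I01P/andP[t0 t1]; have [e1 e2 e3] := hE t; apply/I01P.
  have [h1|h1] := leP t 4^-1; first by rewrite e1 //; lra.
  have [h2|h2] := leP t 2^-1; first by rewrite e2; lra.
  by rewrite e3; lra.
- by have [e _ _] := hE 0; rewrite e ?mulr0 //; lra.
- by have [_ _ e] := hE 1; rewrite e; lra.
move=> t /I01P/andP[t0 t1]; have [e1 e2 e3] := hE t; rewrite /path_cat.
have [h2|h2] := leP t 2^-1; last first.
  rewrite e3; last by lra.
  rewrite ifF; last by apply/negbTE; rewrite -ltNge; lra.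
  rewrite ifF; last by apply/negbTE; rewrite -ltNge; lra.
  by congr c; field.
have [h1|h1] := leP (2 * t) 2^-1.
  by rewrite e1 ?ifT //; lra.
rewrite e2; last by lra.
rewrite ifF; last by apply/negbTE; rewrite -ltNge; lra.
rewrite ifT; last by lra.
by congr b; field.
Qed.

Lemma reparam_rev : reparam (fun t : R => 1 - t).
Proof.
split; last by move=> t /I01P/andP[? ?]; apply/I01P; lra.
exists 1 => // t t'; rewrite mul1r (_ : _ - _ = - (t - t')) ?normrN //; ring.
Qed.

Lemma path_path_rev c : path X c -> path X (path_rev c).
Proof.
move=> [uc cX]; have [[L L0 hL] hI] := reparam_rev; split; last first.
  by move=> t /hI; exact: cX.
move=> e e0; have [r r0 hr] := uc e e0; exists r => // t t' It It' tt.
apply: hr; [exact: hI|exact: hI|].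
by rewrite (_ : _ - _ = - (t - t')) ?normrN //; ring.
Qed.

Lemma path_cst x : X x -> path X (cst x).
Proof. by move=> Xx; split=> // e e0; exists 1 => // *; rewrite subrr normr0. Qed.

Lemma homot_inv c : path X c -> homot X (path_cat c (path_rev c)) (cst (c 0)).
Proof.
move=> pc; pose h (t : R) := Num.min (2 * t + 0) (-2 * t + 2).
have rh : reparam h.
  split; first exact: lip_min (lip_affine _ _) (lip_affine _ _).
  by move=> t /I01P/andP[? ?]; apply/I01P; rewrite /h; case: (leP (2 * t + 0)) => ?; lra.
have r0 : reparam (fun _ : R => (0 : R)).
  split; last by move=> t _; exact: I01_0.
  by exists 1 => // t t'; rewrite subrr normr0 mul1r.
have h0 : h 0 = 0 by rewrite /h min_l; lra.
have h1 : h 1 = 0 by rewrite /h min_r; lra.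
have hh := homot_reparam pc r0 rh (esym h0) (esym h1).
apply: homot_sym; apply: homot_ext hh => t /I01P/andP[t0 t1].
rewrite /path_cat /path_rev /= /h; case: (leP t 2^-1) => ht.
  by rewrite min_l ?addr0 //; lra.
by rewrite min_r; [congr c; ring | lra].
Qed.

Lemma path_revK c : path_rev (path_rev c) = c.
Proof. by apply/funext => t; rewrite /path_rev; congr c; ring. Qed.

Lemma homot_rev c d : homot X c d -> homot X (path_rev c) (path_rev d).
Proof.
case=> H [uH HX h0 h1 he]; have [_ hI] := reparam_rev.
exists (fun s t => H s (1 - t)); split.
- move=> e e0; have [r r0 hr] := uH e e0; exists r => // s t s' t' Is It Is' It' ss tt.
  apply: hr => //; try exact: hI.
  by rewrite (_ : _ - _ = - (t - t')) ?normrN //; ring.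
- by move=> s t Is /hI It; exact: HX.
- by move=> t /hI It; exact: h0.
- by move=> t /hI It; exact: h1.
move=> s Is; rewrite /path_rev subr0 subrr; by have [-> ->] := he s Is.
Qed.

Lemma homot_map (f : E -> E) c d : selfmap X f -> homot X c d -> homot X (f \o c) (f \o d).
Proof.
move=> [fc fX] [H [uH HX h0 h1 he]].
have /unif2P cH := uH.
exists (fun s t => f (H s t)); split.
- apply/unif2P/within_continuousP => -[s t] [/= Is It] e e0.
  have [r r0 hr] := (within_continuousP X f).1 fc _ (HX s t Is It) e e0.
  have [r' r'0 hr'] := uH r r0; exists r' => // -[s' t'] [/= Is' It'] [].
  rewrite /= -!ball_normE => ss tt; apply: hr; first exact: HX.
  by rewrite -ball_normE; exact: hr'.
- by move=> s t Is It; apply: fX; exists (H s t) => //; exact: HX.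
- by move=> t It /=; rewrite h0.
- by move=> t It /=; rewrite h1.
by move=> s Is /=; have [-> ->] := he s Is.
Qed.

(** The straight line homotopy, when it stays inside the space. *)
Lemma homot_segment c d (B : R) : path X c -> path X d -> d 0 = c 0 -> d 1 = c 1 ->
  (forall x, X x -> `|x| <= B) ->
  (forall s t, I01 s -> I01 t -> X ((1 - s) *: c t + s *: d t)) -> homot X c d.
Proof.
move=> [uc cX] [ud dX] e0 e1 XB seg.
exists (fun s t => (1 - s) *: c t + s *: d t); split.
- move=> e e0'; have e4 : 0 < e / 4 by rewrite divr_gt0.
  have [r1 r10 h1] := uc _ e4; have [r2 r20 h2] := ud _ e4.
  have B1 : 0 < `|B| + 1 by rewrite ltr_wpDl.
  exists (Num.min (Num.min r1 r2) (e / (4 * (`|B| + 1)))).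
    by rewrite !lt_min r10 r20 divr_gt0 // mulr_gt0.
  move=> s t s' t' Is It Is' It'; rewrite !lt_min => /andP[_ ss] /andP[/andP[t1 t2] _].
  have a1 := h1 t t' It It' t1; have a2 := h2 t t' It It' t2.
  have bnd x : X x -> `|s - s'| * `|x| <= e / 4.
    move=> /XB xB; have xB' : `|x| <= `|B| + 1.
      by apply: le_trans xB _; apply: le_trans (ler_norm B) _; rewrite lerDl.
    apply: le_trans (ler_wpM2l (normr_ge0 _) xB') _; apply: ltW.
    by rewrite -ltr_pdivlMr // -mulrA -invfM.
  have /I01P/andP[s0 s1] := Is.
  rewrite (_ : _ - _ = ((1 - s) *: (c t - c t') + s *: (d t - d t')) +
     ((s - s') *: d t' - (s - s') *: c t')); last first.
    by apply: row2P; rewrite !mxE; ring.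
  apply: le_lt_trans (ler_normD _ _) _.
  have b1 : `|(1 - s) *: (c t - c t') + s *: (d t - d t')| < e / 2.
    apply: le_lt_trans (ler_normD _ _) _; rewrite !normrZ !ger0_norm ?subr_ge0 //.
    have n1 := normr_ge0 (c t - c t'); have n2 := normr_ge0 (d t - d t').
    have m1 : (1 - s) * `|c t - c t'| <= `|c t - c t'| by rewrite ler_piMl //; lra.
    have m2 : s * `|d t - d t'| <= `|d t - d t'| by rewrite ler_piMl.
    by lra.
  have b2 : `|(s - s') *: d t' - (s - s') *: c t'| <= e / 2.
    apply: le_trans (ler_normB _ _) _; rewrite !normrZ.
    by have := bnd _ (dX t' It'); have := bnd _ (cX t' It'); lra.
  by lra.
- exact: seg.
- by move=> t It; rewrite subr0 scale1r scale0r addr0.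
- by move=> t It; rewrite subrr scale0r scale1r add0r.
by move=> s Is; rewrite e0 e1 -!scalerDl subrK !scale1r.
Qed.

End PathAlgebra.

(** * Word loops and induced endomorphisms *)

Section WordLoops.
Variable R : realType.
Local Notation E := 'rV[R]_2.
Local Notation I01 := (`[0, 1]%classic : set R).
Local Notation P := (@pants R).
Implicit Types (l : letter) (i : bool) (u w : word).

Lemma trig_signs (t : R) : 0 <= t <= 1 -> let c := cos (2 * pi * t) in let s := sin (2 * pi * t) in
  [/\ t <= 4^-1 -> 0 <= c /\ 0 <= s, 4^-1 <= t <= 2^-1 -> c <= 0 /\ 0 <= s,
      2^-1 <= t <= 3 / 4 -> c <= 0 /\ s <= 0 & 3 / 4 <= t -> 0 <= c /\ s <= 0].
Proof.
move=> /andP[t0 t1] c s; have p0 := pi_gt0 R.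
have pt k : t <= k -> pi * t <= pi * k by move=> ?; rewrite ler_pM2l.
have tp k : k <= t -> pi * k <= pi * t by move=> ?; rewrite ler_pM2l.
have p_t := tp 0 t0; have pt_1 := pt 1 t1; rewrite mulr0 in p_t; rewrite mulr1 in pt_1.
have cE : c = - cos (2 * pi * t - pi) by rewrite -cosDpi subrK.
have sE : s = - sin (2 * pi * t - pi) by rewrite -sinDpi subrK.
have cE2 : c = cos (2 * pi * t - 2 * pi).
  rewrite cE -(subrK pi (2 * pi * t - pi)) cosDpi opprK; congr cos; ring.
split=> [h|/andP[h h']|/andP[h h']|h].
- have := pt _ h; split; [apply: cos_ge0_pihalf | apply: sin_ge0_pi]; lra.
- have := tp _ h; have := pt _ h' => ? ?; split; last by apply: sin_ge0_pi; lra.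
  by rewrite cE oppr_le0; apply: cos_ge0_pihalf; lra.
- have := tp _ h; have := pt _ h' => ? ?; split.
    by rewrite cE oppr_le0; apply: cos_ge0_pihalf; lra.
  by rewrite sE oppr_le0; apply: sin_ge0_pi; lra.
have := tp _ h => ?; split; first by rewrite cE2; apply: cos_ge0_pihalf; lra.
by rewrite sE oppr_le0; apply: sin_ge0_pi; lra.
Qed.

(** In each quadrant around the centre of a hole the arc of the circle of
    radius 2 and the edge of the square join the same two half axes, and every
    segment between them stays out of the unit disc. *)
Lemma quadrant_segment (sx sy : bool) (u v u' v' s : R) : 0 <= s <= 1 ->
  0 <= u -> 0 <= v -> u ^+ 2 + v ^+ 2 = 4 ->
  0 <= u' <= 2 -> 0 <= v' <= 2 -> u' + v' = 2 -> forall i,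
  P (vec2 (sg R i * (2 + sg R sx * ((1 - s) * u + s * u'))) (sg R i * (sg R sy * ((1 - s) * v + s * v')))).
Proof.
move=> /andP[s0 s1] u0 v0 uv /andP[u0' u1'] /andP[v0' v1'] uv' i.
have u2 : u <= 2 by nra.
have v2 : v <= 2 by nra.
have uv2 : 2 <= u + v by nra.
have s1' : 0 <= 1 - s by lra.
set U := (1 - s) * u + s * u'; set V := (1 - s) * v + s * v'.
have [U0 U2] : 0 <= U /\ U <= 2 by rewrite /U; split; nra.
have [V0 V2] : 0 <= V /\ V <= 2 by rewrite /V; split; nra.
have UV : 2 <= U + V by rewrite /U /V; nra.
clearbody U V; have h : 1 <= U ^+ 2 + V ^+ 2.
  have UV0 : 0 <= (U + V) * (U + V - 2) by rewrite mulr_ge0 //; lra.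
  by have := sqr_ge0 (U - V); lra.
have sq (b : bool) (x : R) : (sg R b * x) ^+ 2 = x ^+ 2.
  by case: b; rewrite /sg ?mul1r // mulN1r sqrrN.
have [e1 e2] : 1 <= (2 + sg R sx * U - 2) ^+ 2 + V ^+ 2 /\ 1 <= (2 + sg R sx * U + 2) ^+ 2 + V ^+ 2.
  rewrite (_ : 2 + sg R sx * U - 2 = sg R sx * U); last by ring.
  rewrite sq; split=> //; case: (sx); rewrite /sg ?mul1r ?mulN1r; nra.
have e3 : (2 + sg R sx * U) ^+ 2 + V ^+ 2 <= 5 ^+ 2.
  by case: (sx); rewrite /sg ?mul1r ?mulN1r; nra.
rewrite /pants /= !sqdist_vec2 subr0 opprK !sq.
move: (2 + sg R sx * U) e1 e2 e3 => A e1 e2 e3.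
by case: i; rewrite /sg ?mul1r ?mulN1r; split=> //; lra.
Qed.

Lemma generatorE i t : generator i t =
  vec2 (sg R i * (2 - 2 * cos (2 * pi * t))) (sg R i * (- (2 * sin (2 * pi * t)))).
Proof. by apply: row2P; rewrite !mxE /=; case: i; rewrite /sg; ring. Qed.

Lemma generator_side_segment i s t : I01 s -> I01 t ->
  P ((1 - s) *: generator i t + s *: side i t).
Proof.
move=> /I01P s01 /I01P t01; have [q1 q2 q3 q4] := trig_signs t01.
have cs := cos2Dsin2 (2 * pi * t); rewrite generatorE.
move: (cos (2 * pi * t)) (sin (2 * pi * t)) cs q1 q2 q3 q4 => c z cs q1 q2 q3 q4.
have sq (k : R) : (2 * k) ^+ 2 = 4 * k ^+ 2 by ring.
have cs4 : (2 * c) ^+ 2 + (2 * z) ^+ 2 = 4 by rewrite !sq; lra.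
case/andP: (t01) => t0 t1; rewrite /side.
case: (loop_cases t01) => -[ht [-> ->]].
- have [c0 z0] := q1 ht.
  rewrite (_ : _ + _ = vec2 (sg R i * (2 + sg R true * ((1 - s) * (2 * c) + s * (2 - 8 * t))))
    (sg R i * (sg R true * ((1 - s) * (2 * z) + s * (8 * t))))).
    by apply: quadrant_segment => //; rewrite ?mulr_ge0 //; lra.
  by apply: row2P; rewrite !mxE /= /(sg R true); ring.
- have [c0 z0] := q2 ht.
  rewrite (_ : _ + _ = vec2 (sg R i * (2 + sg R false * ((1 - s) * (- (2 * c)) + s * (8 * t - 2))))
    (sg R i * (sg R true * ((1 - s) * (2 * z) + s * (4 - 8 * t))))).
    by apply: quadrant_segment => //; rewrite ?sqrrN //; lra.
  by apply: row2P; rewrite !mxE /= /(sg R true) /(sg R false); ring.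
- have [c0 z0] := q3 ht.
  rewrite (_ : _ + _ = vec2 (sg R i * (2 + sg R false * ((1 - s) * (- (2 * c)) + s * (6 - 8 * t))))
    (sg R i * (sg R false * ((1 - s) * (- (2 * z)) + s * (8 * t - 4))))).
    by apply: quadrant_segment => //; rewrite ?sqrrN //; lra.
  by apply: row2P; rewrite !mxE /= /(sg R false); ring.
have [c0 z0] := q4 ht.
rewrite (_ : _ + _ = vec2 (sg R i * (2 + sg R true * ((1 - s) * (2 * c) + s * (8 * t - 6))))
  (sg R i * (sg R false * ((1 - s) * (- (2 * z)) + s * (8 - 8 * t))))).
  by apply: quadrant_segment => //; rewrite ?sqrrN //; lra.
by apply: row2P; rewrite !mxE /= /(sg R true) /(sg R false); ring.
Qed.

Lemma generator0 i : generator i 0 = base R.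
Proof. by rewrite generatorE mulr0 cos0 sin0; apply: row2P; rewrite !mxE /=; ring. Qed.

Lemma generator1 i : generator i 1 = base R.
Proof.
have e : 2 * pi * 1 = 0 + pi + pi :> R by ring.
rewrite generatorE e cosDpi sinDpi cosDpi sinDpi cos0 sin0.
by apply: row2P; rewrite !mxE /=; ring.
Qed.

Lemma side_path_homot i : homot P (generator i) (side i).
Proof.
have I0 := I01_0 R; have I1 := I01_1 R.
apply: (homot_segment (B := 5)).
- split; last first.
    move=> t It; have := generator_side_segment i I0 It.
    by rewrite subr0 scale1r scale0r addr0.
  have ct (k : R -> R) : continuous k -> {within I01, continuous (fun t => k (2 * pi * t))}.
    move=> ck; apply: continuous_subspaceT => t.
    apply: (continuous_comp (f := fun t => 2 * pi * t) _ (ck _)).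
    by apply: continuousM; [exact: cst_continuous | exact: cvg_id].
  have sub (c0 c1 : R) (k : R -> R) : {within I01, continuous k} ->
      {within I01, continuous (fun t => c0 * (c1 - 2 * k t))}.
    move=> /within_continuousP ck; apply/within_continuousP => t It e e0.
    have e0' : 0 < e / (2 * `|c0| + 1) by rewrite divr_gt0 // ltr_wpDl // mulr_ge0.
    have [d d0 hd] := ck t It _ e0'; exists d => // t' It' tt.
    rewrite (_ : _ - _ = - (2 * (c0 * (k t - k t')))); last by ring.
    have := hd t' It' tt; rewrite ltr_pdivlMr ?ltr_wpDl ?mulr_ge0 // => h.
    rewrite normrN !normrM ger0_norm //; apply: le_lt_trans h.
    have := normr_ge0 (k t - k t'); lra.
  apply/unif1P; rewrite (_ : generator i = fun t => vec2 (sg R i * (2 - 2 * cos (2 * pi * t))) (sg R i * (0 - 2 * sin (2 * pi * t)))).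
    by apply: within_vec2; apply: sub; apply: ct; [exact: continuous_cos | exact: continuous_sin].
  by apply/funext => t; rewrite generatorE sub0r.
- split; last by move=> t /I01P; exact: side_pants.
  move=> e e0; exists (e / 8); first by rewrite divr_gt0.
  move=> t t' _ _ tt; apply: le_lt_trans (side_lip _ _ _) _; lra.
- by rewrite side0 generator0.
- by rewrite side1 generator1.
- move=> x [h _ _]; apply/norm2_le; move: h; rewrite /sqdist subr0 => h.
  by rewrite !ler_norml; split; nra.
- by move=> s t Is It; exact: generator_side_segment.
Qed.

Lemma letter_loop_homot l : homot P (@letter_loop R l) (side_path l).
Proof.
have -> : side_path l = if l.2 then path_rev (side l.1) else side l.1 :> (R -> E).
  by rewrite /side_path; apply/funext => t; case: ifP.
rewrite /letter_loop; case: ifP => _; last exact: side_path_homot.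
exact/homot_rev/side_path_homot.
Qed.

Lemma letter_loop0 l : @letter_loop R l 0 = base R.
Proof. by rewrite /letter_loop; case: ifP; rewrite /path_rev ?subr0 ?generator0 ?generator1. Qed.

Lemma letter_loop1 l : @letter_loop R l 1 = base R.
Proof. by rewrite /letter_loop; case: ifP; rewrite /path_rev ?subrr ?generator0 ?generator1. Qed.

Lemma word_loop0 w : @word_loop R w 0 = base R.
Proof.
by case: w => // l w; rewrite /word_loop /= /path_cat invr_ge0 ler0n mulr0 letter_loop0.
Qed.

Lemma path_cat1 (c d : R -> E) : path_cat c d 1 = d 1.
Proof.
rewrite /path_cat ifF; last by apply/negbTE; rewrite -ltNge; lra.
by congr d; ring.
Qed.

Lemma path_cat0 (c d : R -> E) : path_cat c d 0 = c 0.
Proof. by rewrite /path_cat invr_ge0 ler0n mulr0. Qed.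

Lemma word_loop1 w : @word_loop R w 1 = base R.
Proof. by elim: w => // l w IH; rewrite /word_loop /= path_cat1. Qed.

Lemma poly_loop_homot w : homot P (@word_loop R w) (poly_loop w).
Proof.
elim: w => [|l w IH]; first exact/homot_refl/path_cst/base_pants.
by apply: homot_cat (letter_loop_homot l) IH; rewrite letter_loop1 word_loop0.
Qed.

Lemma path_letter l : path P (@letter_loop R l).
Proof. by have [] := homot_path (letter_loop_homot l). Qed.

Lemma path_word w : path P (@word_loop R w).
Proof. by have [] := homot_path (poly_loop_homot w). Qed.

Lemma letter_loop_inv l : @letter_loop R (inv_letter l) = path_rev (@letter_loop R l).
Proof. by case: l => i []; rewrite /letter_loop //= path_revK. Qed.

Lemma word_loop_cat u w : homot P (@word_loop R (u ++ w)) (path_cat (@word_loop R u) (@word_loop R w)).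
Proof.
elim: u => [|l u IH] /=.
  apply: homot_sym; have := homot_unitl (path_word w); rewrite word_loop0.
  exact.
have e1 : @letter_loop R l 1 = @word_loop R u 0 by rewrite letter_loop1 word_loop0.
have e2 : @word_loop R u 1 = @word_loop R w 0 by rewrite word_loop1 word_loop0.
have a := homot_assoc (path_letter l) (path_word u) (path_word w) e1 e2.
apply: homot_trans (homot_sym a).
apply: homot_cat (homot_refl (path_letter l)) IH.
by rewrite letter_loop1 word_loop0.
Qed.

Lemma word_loop_push l w :
  homot P (@word_loop R (push l w)) (path_cat (@letter_loop R l) (@word_loop R w)).
Proof.
have pc : path P (path_cat (@letter_loop R l) (@word_loop R w)).
  by apply: path_path_cat; [exact: path_letter|exact: path_word|rewrite letter_loop1 word_loop0].
rewrite /push; case: ifP => [|_]; last exact: homot_refl.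
case: w {pc} => //= m w /eqP[->]; rewrite letter_loop_inv.
have pl := path_letter l; have pw := path_word w; have pr := path_path_rev pl.
have e1 : @letter_loop R l 1 = path_rev (@letter_loop R l) 0 by rewrite /path_rev subr0.
have e2 : path_rev (@letter_loop R l) 1 = @word_loop R w 0.
  by rewrite /path_rev subrr letter_loop0 word_loop0.
apply: homot_trans (homot_assoc pl pr pw e1 e2).
apply: homot_sym; apply: homot_trans (homot_unitl pw).
apply: homot_cat (homot_refl pw); first by rewrite path_cat1.
by have := homot_inv pl; rewrite letter_loop0 word_loop0.
Qed.

Lemma word_loop_reduce w : homot P (@word_loop R (grp w)) (@word_loop R w).
Proof.
rewrite [free2_word _]/(act w [::]); elim: w => [|l w IH] /=; first exact: homot_refl (path_word [::]).
apply: homot_trans (word_loop_push _ _) _.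
by apply: homot_cat (homot_refl (path_letter l)) IH; rewrite letter_loop1 word_loop0.
Qed.

Variable w : bool -> word.

(** Deform the generator to the square loop, on which the strip is crossed at
    constant speed; the image then is a reparametrisation of the loop of [w
    i]. *)
Lemma loop_map_generator i : homot P (loop_map w \o generator i) (@word_loop R (w i)).
Proof.
apply: homot_trans (homot_map (loop_map_selfmap R w) (side_path_homot i)) _.
apply: homot_sym; apply: homot_trans (poly_loop_homot _) _.
have pp : path P (poly_loop (w i)) by have [] := homot_path (poly_loop_homot (w i)).
apply: homot_sym; apply: (homot_of_reparam (h := fun t => strip_time (8 * t - 4)) pp).
- split; last by move=> t _; apply/I01P; exact: strip_time_I.
  exists 16 => // t t'; apply: le_trans (strip_time_lip _ _) _.
  by rewrite (_ : 8 * t - 4 - _ = 8 * (t - t')); [rewrite normrM ger0_norm //; lra | ring].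
- by rewrite strip_time_low //; lra.
- by rewrite strip_time_high //; lra.
move=> t /I01P t01; rewrite /=.
have [a|na] := boolP (4^-1 <= t <= 3 / 4).
  by rewrite (loop_map_arm w (i := i)) ?side_arm // side_height.
rewrite loop_map_out; last first.
  move=> j; have [->|ij] := eqVneq j i; first by rewrite side_arm // (negPf na).
  by rewrite side_arm_other // eq_sym.
case/andP: t01 => t0 t1; have [h|h] := leP t 4^-1.
  by rewrite strip_time_low ?poly_loop0 //; lra.
rewrite strip_time_high ?poly_loop1 //.
by move: na; rewrite (ltW h) /= -ltNge => ?; lra.
Qed.

Lemma loop_map_base : loop_map w (base R) = base R.
Proof.
apply: loop_map_out => i; apply/negbTE.
by rewrite /arm /base mxE mulr0 -ltNge.
Qed.

Lemma loop_map_induces : induces (loop_map w : E -> E) (w false, w true).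
Proof.
exists (cst (base R)); split.
  by apply/is_pathP; split; [exact/path_cst/base_pants | | rewrite loop_map_base].
move=> i; apply/homotP; rewrite (_ : (if i then _ else _) = w i); last by case: i.
have hg := loop_map_generator i; have [pg pw] := homot_path hg.
have g0 : (loop_map w \o generator i) 0 = base R by rewrite /= generator0 loop_map_base.
have g1 : (loop_map w \o generator i) 1 = base R by rewrite /= generator1 loop_map_base.
have ul := homot_unitl pg; have ur := homot_unitr pg; rewrite g0 in ul; rewrite g1 in ur.
apply: homot_trans hg; apply: homot_trans ul.
apply: homot_cat ur; first by rewrite path_cat0 g0.
exact/homot_refl/path_cst/base_pants.
Qed.

(** Running a letter before and its inverse after every loop conjugates the
    induced endomorphism. *)
Lemma loop_map_induces_conj x (phi : word * word) :
  (forall i, (if i then phi.2 else phi.1) = grp (x :: w i ++ [:: inv_letter x])) ->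
  induces (loop_map w : E -> E) phi.
Proof.
move=> hphi; exists (@letter_loop R x); split.
  by apply/is_pathP; rewrite loop_map_base letter_loop0 letter_loop1; split=> //; exact: path_letter.
move=> i; apply/homotP; rewrite hphi.
have pl := path_letter x.
apply: homot_sym; apply: homot_trans (word_loop_reduce _) _ => /=.
apply: homot_cat (homot_refl pl) _; first by rewrite letter_loop1 word_loop0.
apply: homot_trans (word_loop_cat _ _) _.
apply: homot_sym; apply: homot_cat; first by rewrite /= generator1 loop_map_base /path_rev subr0 letter_loop1.
  exact: loop_map_generator.
apply: homot_sym; rewrite /= letter_loop_inv.
have pr := path_path_rev pl; have := homot_unitr pr.
by rewrite /path_rev subrr letter_loop0.
Qed.

End WordLoops.

Local Open Scope nat_scope.

(** * Prefix patterns that force the criterion *)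

Definition letters : seq letter :=
  [:: (false, false); (false, true); (true, false); (true, true)].

Lemma mem_letters x : x \in letters.
Proof. by case: x => [] [] []. Qed.

(** Prefixes of the images of the four letters. *)
Definition pattern := letter -> word.

Definition may_hit (d : letter) (prev : option letter) (x : letter) : bool :=
  (x == d) || (prev == Some (inv_letter d)).

(** Decides from the prefixes alone that two images separate, with no position
    hit by both letters on the way. [prev] is the last common letter, which
    the second case of [hit] looks at. *)
Fixpoint resolved d d' prev (u v : word) : bool :=
  match u, v with
  | x :: u', y :: v' => ~~ (may_hit d prev x && may_hit d' prev y) &&
      ((x != y) || resolved d d' (Some x) u' v')
  | _, _ => false
  end.

Definition good (t : pattern) : bool :=
  all (fun d => ohead (t d) \notin [:: None; Some d]) letters &&
  all (fun d => all (fun d' => (d == d') || resolved d d' None (t d) (t d'))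
    letters) letters.

Lemma resolvedP d d' c prev u v r r' :
  (forall z, (prev == Some z) = (0 < size c) && (onth c (size c).-1 == Some z)) ->
  resolved d d' prev u v -> exists e x y s s',
  [/\ u ++ r = e ++ x :: s, v ++ r' = e ++ y :: s', x != y, size e < size u &
   forall j, j <= size e -> ~~ (hit d (c ++ u ++ r) (size c + j) &&
     hit d' (c ++ v ++ r') (size c + j))].
Proof.
have hitE b (a : word) o x : (forall z, (o == Some z) = (0 < size c) && (onth c (size c).-1 == Some z)) ->
    hit b (c ++ x :: a) (size c + 0) = may_hit b o x.
  move=> ho; rewrite /hit /may_hit ho addn0 onth_cat ltnn subnn /=.
  congr orb; case: ltnP => //= c0; rewrite onth_cat prednK // leqnn //.
elim: u v c prev hitE => [//|x u IH] [//|y v] c prev hitE hp /= /andP[nh].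
have [exy /= hr|xy _] := eqVneq x y; last first.
  exists [::], x, y, (u ++ r), (v ++ r'); split=> // j.
  by rewrite leqn0 => /eqP->; rewrite /= !(hitE _ _ prev).
rewrite -{}exy in nh *; have [|||e [x' [y' [s [s' [e1 e2 xy sz hj]]]]]] := IH v (rcons c x) (Some x).
- move=> b a o z ho; rewrite /hit /may_hit ho addn0 onth_cat ltnn subnn /=.
  congr orb; case: ltnP => //= c0; rewrite onth_cat prednK // leqnn //.
- by move=> z; rewrite size_rcons /= -cats1 onth_cat ltnn subnn.
- exact: hr.
exists (x :: e), x', y', s, s'; split=> //; rewrite /= ?e1 ?e2 //.
case=> [_|j je]; first by rewrite !(hitE _ _ prev).
by have := hj j je; rewrite size_rcons !cat_rcons e1 e2 addSnnS.
Qed.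

(** The conditions of [separated] concern finitely many positions before the
    places of separation, all visible in the prefixes. *)
Lemma good_separated (w : bool -> word) (t : pattern) K :
  (forall i, reduced (w i)) -> (forall i, 2 * K + 2 <= size (w i)) ->
  (forall d, size (t d) <= K) -> (forall d, prefix (t d) (letter_image w d)) ->
  good t -> separated w K.
Proof.
move=> rw sw st pt /andP[/allP h1 /allP h2].
have {}h1 d := h1 d (mem_letters d).
split=> // [d|d d' dd'].
  have := h1 d; have /prefixP[r ->] := pt d.
  by rewrite /hit; case: (t d) => // x u; rewrite !inE /= orbF.
have := allP (h2 d (mem_letters d)) d' (mem_letters d').
rewrite (negPf dd') /=.
have /prefixP[r er] := pt d; have /prefixP[r' er'] := pt d'.
move/(@resolvedP d d' [::] None _ _ r r' (fun=> erefl)).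
move=> [e [x [y [s [s' [e1 e2 xy sz hj]]]]]].
exists (size e); split; first exact: leq_trans sz (st d).
  by exists e, x, y, s, s'; rewrite er er'.
by move=> j je; have := hj j je; rewrite er er'.
Qed.

(** The effect on prefixes of conjugating by the inverse of [x]. *)
Definition conj_word (x : letter) (u : word) : word :=
  if u is y :: s then if x == y then s else inv_letter x :: u else u.

Definition accept (t : pattern) : bool :=
  good t || has (fun x => good (fun d => conj_word x (t d))) letters.

Lemma conj_wordE x (u : word) : u != [::] -> conj_word x u = push (inv_letter x) u.
Proof.
by case: u => // y s _; rewrite /push /= inv_letterK -[Some y == _]/(y == x) eq_sym.
Qed.

Lemma prefix_conj_word x (u v : word) : u != [::] -> prefix u v ->
  prefix (conj_word x u) (conj_word x v).
Proof.
case: u => // y u _ /prefixP[r ->] /=; case: ifP => _; first exact: prefix_prefix.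
by rewrite -cat_cons prefix_prefix.
Qed.

Lemma reduced_rcons (u : word) x : reduced u -> ohead (rev u) != Some (inv_letter x) ->
  reduced (rcons u x).
Proof.
case/lastP: u => // u y ru; rewrite rev_rcons /= => yx.
rewrite -cats1; apply: reduced_cat_joint => //.
by apply: contraNneq yx => ->; rewrite inv_letterK.
Qed.

Lemma prefix_grp_rcons (q v : word) x : reduced v -> prefix q v -> size q < size v ->
  prefix q (grp (rcons v x)) /\ size v <= (size (grp (rcons v x))).+1.
Proof.
case/lastP: v => [|v y] rv pq; first by rewrite ltn0.
rewrite size_rcons ltnS => sq.
have [exy|nxy] := eqVneq y (inv_letter x); last first.
  have rr : reduced (rcons (rcons v y) x).
    by apply: reduced_rcons => //; rewrite rev_rcons.
  rewrite val_grp // -[rcons (rcons v y) x]cats1; split.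
    by apply: prefix_trans pq _; exact: prefix_prefix.
  by rewrite size_cat !size_rcons addn1 ltnW.
have rv' : reduced v by move: rv; rewrite -cats1 => /reduced_catl.
have -> : grp (rcons (rcons v y) x) = grp v.
  rewrite exy -!cats1 -catA grp_cat /= (grp_cons (inv_letter x)) grp_inv_letter.
  by rewrite mulVg mulg1.
rewrite val_grp //; split=> //.
have /prefixP[r er] := pq.
have : take (size q) (rcons v y) = q by rewrite er take_size_cat.
by rewrite -cats1 takel_cat // => <-; exact: prefix_take.
Qed.

(** The right factor of the conjugation cancels at most the last letter,
    beyond the prefix. *)
Lemma prefix_conj x (u v : word) : reduced v -> u != [::] -> prefix u v ->
  size u + 2 < size v ->
  prefix (conj_word x u) (grp (inv_letter x :: rcons v x)) /\
  size v <= size (grp (inv_letter x :: rcons v x)) + 2.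
Proof.
move=> rv un puv suv; have vn : v != [::] by case: v suv {rv puv}; rewrite // addn2.
have -> : grp (inv_letter x :: rcons v x) = grp (rcons (conj_word x v) x).
  rewrite -!cats1 -[_ :: _]/((_ :: _) ++ _) !grp_cat conj_wordE //; congr (_ * _)%g.
  by apply: free2_inj; rewrite (val_grp (reduced_push _ rv)) /grp /= act_nil.
have rc : reduced (conj_word x v) by rewrite conj_wordE //; exact: reduced_push.
have su : size (conj_word x u) <= (size u).+1 by case: (u) => //= y s; case: ifP => _ //=; lia.
have sv : size v <= (size (conj_word x v)).+1 by case: (v) => //= y s; case: ifP => _ //=; lia.
have [] := prefix_grp_rcons x rc (prefix_conj_word x un puv); first by lia.
by move=> -> sz; split=> //; lia.
Qed.

Definition values (phi : word * word) (i : bool) : word := if i then phi.2 else phi.1.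

Definition matches (t : pattern) (phi : word * word) : bool :=
  all (fun d => prefix (t d) (letter_image (values phi) d)) letters.

Lemma letter_image_conj (w : bool -> word) x d : (forall i, reduced (w i)) ->
  letter_image (fun i => grp (inv_letter x :: rcons (w i) x)) d =
  grp (inv_letter x :: rcons (letter_image w d) x).
Proof.
case: d => i [] // rw.
rewrite -[LHS]/(winv (grp _)) -[RHS]/(free2_word (grp (_ :: rcons (winv (w i)) x))).
rewrite -(val_grp (reduced_winv (free2P (grp _)))) grp_winv grp_free2; congr free2_word.
by rewrite -grp_winv winv_cons winv_rcons inv_letterK.
Qed.

Section Criterion.
Variable R : realType.

Theorem separated_wecken (phi : word * word) K :
  separated (values phi) K -> wecken_endo R phi.
Proof.
case: phi => u v sp; have [rw _ _ _] := sp; split; [exact: (rw false)|exact: (rw true)|].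
exists (loop_map (values (u, v))); split.
- exact: loop_map_selfmap.
- exact: (@loop_map_induces R (values (u, v))).
- exact: loop_map_wecken sp.
Qed.

(** The map built from the conjugate words also induces [phi], by a change of
    the path from the base point to its image. *)
Theorem separated_conj_wecken (phi : word * word) x K :
  reduced phi.1 -> reduced phi.2 ->
  separated (fun i => grp (inv_letter x :: rcons (values phi i) x)) K -> wecken_endo R phi.
Proof.
move=> r1 r2 sp; split=> //.
set w := fun i => _ in sp; exists (loop_map w); split.
- exact: loop_map_selfmap.
- apply: (@loop_map_induces_conj R w x) => i.
  have ri : reduced (values phi i) by case: (i).
  rewrite -[LHS]/(values phi i) -[LHS]val_grp //; congr free2_word.
  rewrite /w -[x :: _]cat1s !grp_cat grp_free2 -[_ :: rcons _ _]cat1s -cats1 !grp_cat.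
  by rewrite !grp_inv_letter !mulgA mulgV mul1g mulgK.
- exact: loop_map_wecken sp.
Qed.

(** Prefixes have size at most 5, and at most 6 after conjugation; words of
    size 16 keep size 14 = 2 * 6 + 2. *)
Lemma accept_wecken (t : pattern) (phi : word * word) :
  reduced phi.1 -> reduced phi.2 -> (forall d, 0 < size (t d) <= 5) ->
  16 <= size phi.1 -> 16 <= size phi.2 -> matches t phi -> accept t ->
  wecken_endo R phi.
Proof.
move=> r1 r2 st l1 l2 /allP mt.
have {}mt d := mt d (mem_letters d).
have rw i : reduced (values phi i) by case: i.
have lw i : 16 <= size (values phi i) by case: i.
case/orP => [gt|/hasP[x _ gt]].
  apply: (@separated_wecken phi 5); apply: good_separated gt => // [i|d].
    by apply: leq_trans (lw i).
  by case/andP: (st d).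
have rW d : reduced (letter_image (values phi) d).
  by rewrite /letter_image; case: ifP => _ //; exact: reduced_winv.
have lW d : 16 <= size (letter_image (values phi) d).
  by rewrite /letter_image; case: ifP => _; rewrite ?size_winv.
have tn d : t d != [::] by case/andP: (st d); case: (t d).
have lt d : size (t d) + 2 < size (letter_image (values phi) d).
  by have := lW d; case/andP: (st d) => _; lia.
have cj d := prefix_conj x (rW d) (tn d) (mt d) (lt d).
have eW d : letter_image (fun i => grp (inv_letter x :: rcons (values phi i) x)) d =
    grp (inv_letter x :: rcons (letter_image (values phi) d) x).
  exact: letter_image_conj.
apply: (@separated_conj_wecken phi x 6) => //; apply: good_separated gt => [i|i|d|d].
- exact: free2P.
- have [_] := cj (i, false); rewrite -[letter_image _ _]/(values phi i) => /(leq_trans (lw i)) h.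
  by rewrite -(leq_add2r 2).
- by have := st d; case: (t d) => //= y s; case: ifP => _ /=; lia.
- by rewrite eW; have [] := cj d.
Qed.

End Criterion.

(** * Counting reduced words with prescribed ends *)

Definition after (x : letter) : seq letter := [seq z <- letters | z != inv_letter x].

Arguments after : simpl never.
Local Arguments reduced : simpl never.

Fixpoint continuations (n : nat) (x : letter) : seq word :=
  if n is n'.+1 then
    [seq z :: m | z <- after x, m <- continuations n' z]
  else [:: [::]].

Lemma mem_continuations n x m :
  (m \in continuations n x) = (size m == n) && reduced (x :: m).
Proof.
elim: n x m => [|n IH] x m /=; first by rewrite inE; case: m.
apply/allpairsPdep/idP => [[z [u [hz hu ->]]]|].
  move: hz hu; rewrite /after seq.mem_filter IH => /andP[zx _] /andP[/eqP <- ru].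
  by rewrite eqxx reduced_cons ru andbT (inj_eq Some_inj).
case: m => // z u; rewrite reduced_cons eqSS => /andP[su /andP[zx ru]].
by exists z, u; split=> //; rewrite /after ?seq.mem_filter ?mem_letters ?andbT ?IH ?su.
Qed.

Lemma uniq_continuations n x : uniq (continuations n x).
Proof.
elim: n x => //= n IH x; apply: allpairs_uniq_dep => //.
  by rewrite filter_uniq.
by move=> [z u] [z' u'] _ _ /= [-> ->].
Qed.

Definition closing n x y : nat :=
  count (fun m => y != inv_letter (last x m)) (continuations n x).

Lemma count_allpairs (S T U : Type) (P : pred U) (s : seq S) (t : S -> seq T) (f : S -> T -> U) :
  count P [seq f x y | x <- s, y <- t x] = \sum_(x <- s) count (fun y => P (f x y)) (t x).
Proof.
elim: s => [|x s IH]; first by rewrite big_nil.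
by rewrite big_cons /= count_cat IH count_map.
Qed.

Lemma big_letters (f : letter -> nat) :
  \sum_(z <- letters) f z =
  f (false, false) + f (false, true) + f (true, false) + f (true, true).
Proof. by rewrite !big_cons big_nil addn0 !addnA. Qed.

Lemma closing_step n x y :
  closing n.+1 x y + closing n (inv_letter x) y = \sum_(z <- letters) closing n z y.
Proof.
rewrite {1}/closing /= count_allpairs -/(closing n _ _) /after big_filter.
rewrite [RHS](bigID (fun z => z == inv_letter x)) /= [RHS]addnC; congr addn.
rewrite -big_filter (_ : [seq z <- letters | z == inv_letter x] = [:: inv_letter x]).
  by rewrite big_cons big_nil addn0.
by case: x => [] [] [].
Qed.

Lemma sum_closing n y : \sum_(x <- letters) closing n x y = 3 ^ n.+1.
Proof.
elim: n => [|n IH].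
  by rewrite big_letters; case: y => [] [] [].
have : \sum_(x <- letters) (closing n.+1 x y + closing n (inv_letter x) y) = 4 * 3 ^ n.+1.
  by rewrite big_letters !closing_step IH; ring.
rewrite big_split /= (_ : \sum_(x <- letters) closing n (inv_letter x) y = 3 ^ n.+1).
  by rewrite (expnS 3 n.+1); lia.
by rewrite -IH !big_letters /inv_letter /=; ring.
Qed.

(** By [closing_step] and [sum_closing], passing from n to n+1 replaces x by its
    inverse and changes the sign of the deviation from the mean 3^(n+1) / 4. So
    its absolute value never exceeds the one at n = 0. *)
Lemma closing_bounds n x y :
  3 ^ n.+1 <= 4 * closing n x y + 3 /\ 4 * closing n x y <= 3 ^ n.+1 + 3.
Proof.
elim: n x => [|n IH] x; first by case: x => [] [] []; case: y => [] [] [].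
have := closing_step n x y; rewrite sum_closing (expnS 3 n.+1).
have [] := IH (inv_letter x).
by move: (3 ^ n.+1) (closing n.+1 x y) (closing n _ y) => a b c; lia.
Qed.

Lemma size_continuations n x : size (continuations n x) = 3 ^ n.
Proof.
elim: n x => //= n IH x; rewrite size_allpairs_dep.
rewrite (eq_map (fun z => IH z)) expnS.
by case: x => [] [] [] /=; lia.
Qed.

Section Cylinders.
Variable p : nat.
Local Notation T := {bseq p of letter}.

Lemma card_by_size (P : pred T) :
  #|P| = \sum_(n < p.+1) #|[pred w : T | P w & size w == n]|.
Proof.
rewrite -sum1_card (partition_big (fun w : T => inord (size w) : 'I_p.+1) xpredT) //=.
apply: eq_bigr => n _; rewrite -sum1_card; apply: eq_bigl => w; rewrite !inE.
congr andb; rewrite -val_eqE /= inordK // ltnS; exact: size_bseq.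
Qed.

Lemma card_ge_seq (P : pred T) (s : seq word) :
  uniq s -> (forall w, w \in s -> exists2 t : T, P t & val t = w) -> size s <= #|P|.
Proof.
move=> us hs; rewrite cardE -(size_map val); apply: uniq_leq_size => // w /hs[t pt <-].
by apply: map_f; rewrite mem_enum.
Qed.

Lemma card_le_seq (P : pred T) (s : seq word) :
  (forall t : T, P t -> val t \in s) -> #|P| <= size s.
Proof.
move=> hs; rewrite cardE -(size_map val); apply: uniq_leq_size.
  by rewrite map_inj_uniq ?enum_uniq //; exact: val_inj.
by move=> w /mapP[t]; rewrite mem_enum => pt ->; exact: hs.
Qed.

Lemma card_reduced : #|[pred w : T | reduced w]| < 2 * 3 ^ p.
Proof.
rewrite card_by_size.
have le (n : nat) : #|[pred w : T | reduced w & size w == n]| <=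
    if n is m.+1 then 4 * 3 ^ m else 1.
  case: n => [|n].
    apply: (@card_le_seq _ [:: [::]]) => t /andP[_]; rewrite inE.
    by rewrite size_eq0.
  apply: (@leq_trans (size [seq x :: m | x <- letters, m <- continuations n x])).
    apply: card_le_seq => -[[|x m] sp] /andP[rm sm]; first by [].
    apply/allpairsPdep; exists x, m; split=> //; first exact: mem_letters.
    by rewrite mem_continuations -eqSS sm.
  by rewrite size_allpairs_dep (eq_map (fun z => size_continuations n z)) /= ; lia.
apply: (@leq_ltn_trans (\sum_(n < p.+1) (if n : nat is m.+1 then 4 * 3 ^ m else 1))).
  by apply: leq_sum => n _; exact: le.
rewrite big_ord_recl /=; elim: (p) => [|q IH]; first by rewrite big_ord0.
rewrite big_ord_recr /= addnA expnS add0n; move: IH; move: (\sum_(i < q) _) (3 ^ q) => a b; lia.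
Qed.

(** The bound [L] discards the short words, for which the two ends may overlap. *)
Definition cylinder (L : nat) (u v : word) : pred T :=
  [pred w : T | [&& reduced w, L <= size w, prefix u w & prefix v (winv w)]].

(** Such words are u, followed by a middle part, followed by the inverse of v;
    the middle part is a continuation of the last letter of u that lets the
    rest follow. *)
Lemma card_cylinder_size L u v n : reduced u -> reduced v -> 0 < size u -> 0 < size v ->
  L <= n <= p -> size u + size v <= n -> exists x y,
  closing (n - (size u + size v)) x y <= #|[pred w | cylinder L u v w & size w == n]|.
Proof.
move=> ru rv u0 v0 /andP[Ln np] uvn.
case: u u0 ru uvn => // a u _ ru.
have rw := reduced_winv rv; have sw := size_winv v.
case ew : (winv v) rw sw => [|b v'] rw sw; first by rewrite -sw in v0.
move=> uvn; set j := n - _.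
exists (last a u), b; rewrite /closing -size_filter.
pose mk (m : word) : word := (a :: u) ++ m ++ b :: v'.
have mk_inj : injective mk.
  move=> m m' /eqP; rewrite /mk eqseq_cat // eqxx /= => /eqP e.
  have := congr1 size e; rewrite !size_cat => /eqP; rewrite eqn_add2r => /eqP sz.
  by move/eqP: e; rewrite eqseq_cat // => /andP[/eqP].
rewrite -(size_map mk); apply: card_ge_seq.
  by rewrite map_inj_uniq // filter_uniq // uniq_continuations.
move=> w /mapP[m]; rewrite seq.mem_filter mem_continuations => /and3P[bm /eqP sm rm] ->.
have smk : size (mk m) = n by rewrite /mk !size_cat sm sw /j; lia.
have smkp : size (mk m) <= p by rewrite smk.
exists (Bseq smkp) => //; apply/andP; split; last exact/eqP.
rewrite [cylinder _ _ _ _]/cylinder; apply/and4P; split.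
- move: rw rm ru; rewrite /reduced /mk /= !cat_path /= => -> -> ->.
  by rewrite bm.
- by rewrite -[size _]/(size (mk m)) smk.
- exact: prefix_prefix.
- by rewrite -[bseqval _]/(mk m) /mk catA winv_cat -ew winvK prefix_prefix.
Qed.

End Cylinders.

Lemma linear_le_expn c p : 4 * c <= p -> c * p.+1 <= 3 ^ p.
Proof.
move=> cp; have : p.+1 * p.+1 <= 4 * 3 ^ p.
  elim: (p) => // q IH; rewrite expnS; move: (3 ^ q) IH => e; nia.
move: (3 ^ p) => e; nia.
Qed.

(** By [closing_bounds] the words of size n with prescribed ends number 3^(n -
    s + 1) / 4 up to an additive constant, where s is the size of the ends.
    Summing the geometric progression over n leaves an error linear in p. *)
Lemma card_cylinder L s : exists c, forall p u v,
  reduced u -> reduced v -> 0 < size u -> 0 < size v -> size u + size v <= s ->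
  9 * 3 ^ p <= 8 * 3 ^ (size u + size v) * #|cylinder (p := p) L u v| + c * p.+1.
Proof.
pose c := 6 * 3 ^ s + 6 * 3 ^ (L + s); exists (c + 3) => p u v ru rv u0 v0.
set k := size u + size v => ks; rewrite card_by_size.
have term n : n < p.+1 ->
    6 * 3 ^ n <= 8 * 3 ^ k * #|[pred w | cylinder (p := p) L u v w & size w == n]| + c.
  move=> np; have [/andP[Ln kn]|short] := boolP ((L <= n) && (k <= n)); last first.
    have : 3 ^ n <= 3 ^ (L + s) by rewrite leq_exp2l //; lia.
    by rewrite /c; move: (3 ^ n) (3 ^ (L + s)) (8 * _ * _) => *; lia.
  have Lnp : L <= n <= p by rewrite Ln -ltnS.
  have [x [y]] := card_cylinder_size ru rv u0 v0 Lnp kn.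
  have [h _] := closing_bounds (n - k) x y.
  have : 3 ^ k <= 3 ^ s by rewrite leq_exp2l.
  have en : 3 * 3 ^ n = 3 ^ k * 3 ^ (n - k).+1 by rewrite -expnD -expnS addnS subnKC.
  rewrite /c; move: h en; move: (3 ^ (n - k).+1) (3 ^ n) (3 ^ k) (3 ^ s) (3 ^ (L + s)) #|_| (closing _ _ _).
  move=> e1 e2 e3 e4 e5 card cl h en h34 hc.
  have : e3 * e1 <= e3 * (4 * card + 3).
    by rewrite leq_mul2l; apply/orP; right; lia.
  by rewrite mulnDr -mulnA; move: en; rewrite mulnCA; nia.
have geom q : \sum_(n < q) 6 * 3 ^ n + 3 = 3 * 3 ^ q.
  elim: q => [|q IH]; first by rewrite big_ord0.
  by rewrite big_ord_recr /= expnS; move: IH; move: (\sum_(n < q) _) (3 ^ q) => *; lia.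
have h : \sum_(n < p.+1) 6 * 3 ^ n <= \sum_(n < p.+1)
    (8 * 3 ^ k * #|[pred w | cylinder (p := p) L u v w & size w == n]| + c).
  by apply: leq_sum => n _; exact: term.
rewrite [X in _ <= X]big_split [X in _ <= X + _]/= -[X in _ <= X + _]big_distrr in h.
move: h; rewrite sum_nat_const card_ord (mulnC p.+1) mulnDl /=.
have := geom p.+1; rewrite expnS.
move: (\sum_(n < p.+1) 6 * 3 ^ n) (8 * 3 ^ k * _) (3 ^ p) (c * p.+1) => e1 e2 e3 e4.
by clear; lia.
Qed.

(** Asymptotically the left side is 567 * 2 = 1134 times 3^p and the right
    side is 1024 * 9 / 8 = 1152 times 3^p; the gap absorbs the error. *)
Lemma card_cylinder_ge L s : exists p0, forall p u v, p0 <= p ->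
  reduced u -> reduced v -> 0 < size u -> 0 < size v -> size u + size v <= s ->
  567 * #|[pred w : {bseq p of letter} | reduced w]| <=
  1024 * 3 ^ (size u + size v) * #|cylinder (p := p) L u v|.
Proof.
have [c hc] := card_cylinder L s.
exists (4 * (8 * c)) => p u v pp ru rv u0 v0 uvs.
have := hc p u v ru rv u0 v0 uvs; have := card_reduced p.
have := linear_le_expn pp.
move: #|_| => N; rewrite -!mulnA; move: (3 ^ p) (3 ^ _ * #|_|) (c * p.+1) => a b d; lia.
Qed.

(** * The tree of patterns *)

Definition extend (t : pattern) (d x : letter) : pattern :=
  fun d' => if d == d' then rcons (t d) x else t d'.

(** A letter whose prefix is contained in the prefix of another: this pair can
    be separated only by looking further. *)
Definition ambiguous (t : pattern) : option letter :=
  ohead [seq q.1 | q <- [seq (d, d') | d <- letters, d' <- letters] &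
                   (q.1 != q.2) && prefix (t q.1) (t q.2)].

(** The number of accepted patterns among the extensions of [t] by [n]
    letters, an accepted pattern with k letters to spare counting for 3^k. The
    order in which prefixes are extended is dictated by [ambiguous], and any
    order is sound. *)
Fixpoint mass (n : nat) (t : pattern) : nat :=
  if accept t then 3 ^ n else
  if n is n'.+1 then
    if ambiguous t is Some d then
      sumn [seq mass n' (extend t d x) | x <- letters & ohead (rev (t d)) != Some (inv_letter x)]
    else 0
  else 0.

Definition initial (q : (letter * letter) * (letter * letter)) : pattern :=
  fun d => [:: if d.1 then (if d.2 then q.2.2 else q.2.1)
               else if d.2 then q.1.2 else q.1.1].

Definition letter_pairs := [seq (x, y) | x <- letters, y <- letters].

Definition initials := [seq (x, y) | x <- letter_pairs, y <- letter_pairs].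

Lemma mass_initials : 4681 <= sumn [seq mass 4 (initial q) | q <- initials].
Proof.
by lazy.
Qed.

Local Arguments reduced : simpl never.

Lemma card_split (T : finType) (I : eqType) (r : seq I) (A : pred T) (B : I -> pred T) :
  uniq r -> (forall x w, B x w -> A w) -> (forall x y w, B x w -> B y w -> x = y) ->
  \sum_(x <- r) #|B x| <= #|A|.
Proof.
move=> ur BA dB.
have cE (C : pred T) : #|C| = \sum_w (C w : nat).
  by rewrite -sum1_card big_mkcond; apply: eq_bigr => w _; rewrite unfold_in; case: (C w).
under eq_bigr => x _ do rewrite cE.
rewrite exchange_big cE /=; apply: leq_sum => w _.
have -> : \sum_(x <- r) (B x w : nat) = count (B^~ w) r.
  by rewrite -sum1_count [RHS]big_mkcond; apply: eq_bigr => x _; case: (B x w).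
have [/hasP[x xr Bx]|nh] := boolP (has (B^~ w) r); last by move: nh; rewrite has_count -leqNgt leqn0 => /eqP ->.
rewrite (BA x w Bx) (@eq_in_count _ _ (pred1 x)) ?count_uniq_mem ?xr // => y _.
by apply/idP/eqP => [By|->] //; exact: dB By Bx.
Qed.

Definition weight (t : pattern) : nat := \sum_(d <- letters) size (t d).

Lemma weight_extend t d x : weight (extend t d x) = (weight t).+1.
Proof.
have sE d' : size (extend t d x d') = size (t d') + (d == d').
  by rewrite /extend; case: eqP => [<-|_]; rewrite ?size_rcons ?addn1 ?addn0.
by rewrite /weight !big_letters !sE; case: d {sE} => [[] []]; rewrite ?xpair_eqE /=; lia.
Qed.

Section Tree.
Variables (p : nat).
Local Notation T := {bseq p of letter}.
Variable S : pred (T * T).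
Local Notation N := #|[pred w : T | reduced w]|.

Definition block (t : pattern) : pred (T * T) :=
  predX (cylinder (p := p) 16 (t (false, false)) (t (false, true)))
        (cylinder (p := p) 16 (t (true, false)) (t (true, true))).

Lemma blockP (t : pattern) (w : T * T) : reflect
  [/\ reduced w.1, reduced w.2, 16 <= size w.1, 16 <= size w.2 &
      forall d, prefix (t d) (letter_image (values (w.1 : word, w.2 : word)) d)]
  (block t w).
Proof.
apply: (iffP andP) => [[/and4P[r1 l1 p1 q1] /and4P[r2 l2 p2 q2]]|[r1 r2 l1 l2 h]].
  by split=> // -[[] []].
split; apply/and4P; split=> //.
Qed.

Hypothesis accepted : forall t w, (forall d, 0 < size (t d) <= 5) -> accept t ->
  block t w -> S w.

Hypothesis cylinder_big : forall u v, reduced u -> reduced v ->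
  0 < size u -> 0 < size v -> size u + size v <= 6 ->
  567 * N <= 1024 * 3 ^ (size u + size v) * #|cylinder (p := p) 16 u v|.

Definition meets (t : pattern) : pred (T * T) := fun w => S w && block t w.

Lemma leaf_meets n t : (forall d, reduced (t d)) -> (forall d, 0 < size (t d)) ->
  weight t + n = 8 -> accept t ->
  3 ^ n * (567 * N) ^ 2 <= 1024 ^ 2 * 3 ^ 8 * #|meets t|.
Proof.
move=> rt tn wn tacc.
have st d : 0 < size (t d) <= 5.
  rewrite tn; apply: (allP (_ : all (fun d => size (t d) <= 5) letters)) (mem_letters d).
  move: wn; rewrite /weight big_letters /=.
  have := tn (false, false); have := tn (false, true).
  have := tn (true, false); have := tn (true, true). move: (size (t (true, true))) (size (t (true, false))) (size (t (false, true))) (size (t (false, false))) => *; lia.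
have -> : #|meets t| = #|block t|.
  by apply: eq_card => w; rewrite !unfold_in /meets; case E: (block t w); rewrite ?andbF // (accepted st).
rewrite cardX; set c1 := #|_|; set c2 := #|_|.
have := wn; rewrite /weight big_letters => wn'.
have := tn (false, false); have := tn (false, true).
have := tn (true, false); have := tn (true, true) => n1 n2 n3 n4.
have s1 : size (t (false, false)) + size (t (false, true)) <= 6 by lia.
have s2 : size (t (true, false)) + size (t (true, true)) <= 6 by lia.
have := cylinder_big (rt _) (rt _) n4 n3 s1.
have := cylinder_big (rt _) (rt _) n2 n1 s2.
rewrite -/c1 -/c2 => h2 h1.
have -> : 3 ^ 8 = 3 ^ (size (t (false, false)) + size (t (false, true))) *
    3 ^ (size (t (true, false)) + size (t (true, true))) * 3 ^ n.
  by rewrite -!expnD -wn'; congr (_ ^ _); lia.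
rewrite -mulnn -[1024 ^ 2]mulnn; move: (567 * N) h1 h2; move: 1024 (3 ^ n) (3 ^ _) (3 ^ _).
move=> k e e1 e2 a h1 h2.
have -> : k * k * (e2 * e1 * e) * (c1 * c2) = e * (k * e2 * c1 * (k * e1 * c2)) by ring.
by rewrite leq_mul2l; apply/orP; right; exact: leq_mul.
Qed.

(** Extensions of one prefix by different letters are disjoint, so the counts
    add up along the tree; each letter of a pattern costs a factor 3 by
    [leaf_meets]. *)
Lemma mass_meets n t : (forall d, reduced (t d)) -> (forall d, 0 < size (t d)) ->
  weight t + n = 8 -> mass n t * (567 * N) ^ 2 <= 1024 ^ 2 * 3 ^ 8 * #|meets t|.
Proof.
elim: n t => [|n IH] t rt tn wn; rewrite [mass _ _]/mass -/mass; case: ifPn => tacc //.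
- exact: leaf_meets.
- exact: leaf_meets.
case: (ambiguous t) => [d|//]; rewrite sumnE big_map big_filter.
pose ok x := ohead (rev (t d)) != Some (inv_letter x).
apply: (@leq_trans (\sum_(x <- letters) 1024 ^ 2 * 3 ^ 8 * #|meets (extend t d x)|)); last first.
  rewrite -big_distrr leq_mul2l; apply/orP; right; apply: card_split => // [x w|x y w].
    case/andP => sw /blockP[r1 r2 l1 l2 h]; rewrite /meets sw /=; apply/blockP; split=> // d'.
    have := h d'; rewrite /extend; case: eqP => // -> .
    by apply: prefix_trans; exact: prefix_rcons.
  case/andP => _ /blockP[_ _ _ _ /(_ d) h1] /andP[_ /blockP[_ _ _ _ /(_ d)]].
  move: h1; rewrite /extend eqxx => /prefixP[r ->] /prefixP[r'] /(congr1 (fun s => onth s (size (t d)))).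
  by rewrite !cat_rcons !onth_cat ltnn subnn => -[].
rewrite big_distrl big_mkcond; apply: leq_sum => x _; case: ifP => // okx.
apply: IH.
- by move=> d'; rewrite /extend; case: eqP => // _; exact: reduced_rcons.
- by move=> d'; rewrite /extend; case: eqP => // _; rewrite size_rcons.
- by rewrite weight_extend addSnnS.
Qed.

Lemma initials_meets : 4681 * (567 * N) ^ 2 <= 1024 ^ 2 * 3 ^ 8 * #|S|.
Proof.
apply: leq_trans (leq_mul mass_initials (leqnn _)) _; rewrite sumnE big_map.
apply: (@leq_trans (\sum_(q <- initials) 1024 ^ 2 * 3 ^ 8 * #|meets (initial q)|)).
  rewrite big_distrl; apply: leq_sum => q _; apply: mass_meets => //.
  by rewrite /weight big_letters.
rewrite -big_distrr leq_mul2l; apply/orP; right; apply: card_split => // [q w|q q' w].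
  by case/andP.
case/andP => _ /blockP[_ _ _ _ h] /andP[_ /blockP[_ _ _ _ h']].
have eqh d : initial q d = initial q' d.
  have := h d; have := h' d; case: letter_image => // x s.
  by rewrite /initial /= => /andP[/eqP -> _] /andP[/eqP -> _].
have := eqh (false, false); have := eqh (false, true).
have := eqh (true, false); have := eqh (true, true).
case: q {h eqh} => [[a b] [c e]]; case: q' {h'} => [[a' b'] [c' e']].
by rewrite /initial /= => -[->] [->] [->] [->].
Qed.

End Tree.

Local Open Scope classical_set_scope.
Local Open Scope ring_scope.

(** * The density of Wecken endomorphisms *)

(** 4681 * 567^2 / (1024^2 * 3^8) exceeds 0.218. *)
Lemma mass_ratio (R : realFieldType) (x s : R) : 0 <= x ->
  4681 * (567 * x) ^+ 2 <= 1024 ^+ 2 * 3 ^+ 8 * s -> 23 / 108 * (x * x) <= s.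
Proof.
move=> x0.
have -> : (567 * x) ^+ 2 = 567 * 567 * (x * x) by ring.
have -> : 1024 ^+ 2 * 3 ^+ 8 = 1024 * 1024 * 81 * 81 :> R by ring.
have : 0 <= x * x by rewrite mulr_ge0.
move: (x * x) => y; lra.
Qed.

Lemma density_ratio_ge (R : realType) : exists p0, forall p, (p0 <= p)%N ->
  23 / 108 <= density_ratio R (wecken_endo R) p.
Proof.
have [p0 hp0] := card_cylinder_ge 16 6; exists p0 => p pp.
rewrite /density_ratio; set S := [pred w | _].
set N := #|[pred w : {bseq p of letter} | reduced w]|%N.
have -> : #|[pred w : {bseq p of letter} * {bseq p of letter} | reduced w.1 && reduced w.2]| = (N * N)%N.
  exact: cardX.
have h : (4681 * (567 * N) ^ 2 <= 1024 ^ 2 * 3 ^ 8 * #|S|)%N.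
  apply: initials_meets => [t w st tacc /blockP[r1 r2 l1 l2 mt]|u v]; last exact: hp0.
  apply/and3P; split=> //; apply/asboolP; apply: accept_wecken tacc => //.
  by apply/allP.
have N0 : (0 < N)%N by apply/card_gt0P; exists (@Bseq p letter [::] (leq0n p)).
move: h; rewrite -(ler_nat R) (natrM R 4681) (natrX R (567 * N)) (natrM R 567).
rewrite (natrM R (1024 ^ 2 * 3 ^ 8)) (natrM R (1024 ^ 2)) (natrX R 1024) (natrX R 3) => h.
have N0' : 0 < N%:R :> R by rewrite ltr0n.
by rewrite ler_pdivlMr natrM ?mulr_gt0 //; apply: mass_ratio h; exact: ltW.
Qed.

Theorem theorem7 (R : realType) (d : R) :
  density_ratio R (wecken_endo R) p @[p --> \oo] --> d ->
  23 / 108 <= d.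
Proof.
move=> cvd; have [p0 hp0] := density_ratio_ge R.
rewrite -(cvg_lim _ cvd) //; apply: limr_ge; first by apply/cvg_ex; exists d.
by exists p0 => // p; exact: hp0.
Qed.
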